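(* Let $q$ be a power of $3$, and fix an irreducible $P \in \mathbb{F}_q[T]$. Then for a positive integer $n$ we have $$\sum_{\substack{f \in \mathbb{F}_q[T]^+ \\ |f| \leq X \\ f \equiv 1 \bmod P^n}} \mu(f) = o\left(\frac{X}{|P|^n}\right), \quad \frac{X}{|P|^n} \to \infty.$$ That is, for every $\varepsilon>0$ there is an $N = N(q,P,\varepsilon)$ such that for every positive integer $n$ and every real $X$ with $X/|P|^n \geq N$, the absolute value of the sum is at most $\varepsilon X/|P|^n$.
   Context: $\mathbb{F}_q[T]^+$ is the set of monic polynomials over $\mathbb{F}_q$; $|f| = q^{\deg f}$ for nonzero $f$. For monic $f$, $\mu(f) = 0$ if $Q^2 \mid f$ for some monic irreducible $Q$, and otherwise $\mu(f) = (-1)^{\#\{Q : Q \mid f\}}$ with $Q$ ranging over monic irreducible polynomials. *)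

(* Defs.v *)
From mathcomp Require Import all_boot all_order all_algebra.
From mathcomp Require Import finmap.
From mathcomp Require Import mathcomp_extra boolp classical_sets functions.
From mathcomp Require Import cardinality fsbigop reals.

Set Implicit Arguments.
Unset Strict Implicit.
Unset Printing Implicit Defensive.

Import Order.TTheory GRing.Theory Num.Theory.

Local Open Scope classical_set_scope.
Local Open Scope ring_scope.

(* Only meaningful for f != 0: pnorm 0 = 1 because (size 0).-1 = 0. *)
Definition pnorm (F : finFieldType) (f : {poly F}) : nat :=
  (#|F| ^ (size f).-1)%N.

Definition monic_irreducible (F : finFieldType) (Q : {poly F}) : Prop :=
  Q \is monic /\ irreducible_poly Q.

Definition prime_divisors (F : finFieldType) (f : {poly F}) : set {poly F} :=
  [set Q | monic_irreducible Q /\ Q %| f].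

(* fset_set sends infinite sets to fset0; finite_prime_divisors below rules
   this case out for f != 0. *)
Definition poly_mu (F : finFieldType) (f : {poly F}) : int :=
  if `[< exists Q : {poly F}, monic_irreducible Q /\ Q ^+ 2 %| f >] then 0
  else (-1) ^+ #|` fset_set (prime_divisors f)|.

Definition monic_progression (F : finFieldType) (R : realType)
    (M : {poly F}) (X : R) : set {poly F} :=
  [set f | [/\ f \is monic, (pnorm f)%:R <= X & M %| f - 1]].

Lemma finite_size_le (F : finFieldType) (m : nat) :
  finite_set [set f : {poly F} | (size f <= m)%N].
Proof.
apply: (@sub_finite_set _ _ ((fun v : 'rV[F]_m => rVpoly v) @` setT)).
  by move=> f /= sf; exists (poly_rV f) => //; rewrite poly_rV_K.
by apply: finite_image; exact: finite_finset.
Qed.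

Lemma finite_prime_divisors (F : finFieldType) (f : {poly F}) :
  f != 0 -> finite_set (prime_divisors f).
Proof.
move=> f0; apply: sub_finite_set (@finite_size_le F (size f)).
by move=> Q [_ /(dvdp_leq f0)].
Qed.

(* Hence the finitely supported sum over this set is a genuine sum. *)
Lemma finite_monic_progression (F : finFieldType) (R : realType)
    (M : {poly F}) (X : R) : finite_set (monic_progression M X).
Proof.
apply: sub_finite_set (@finite_size_le F (Num.truncn X).+1).
move=> f [_ fX _] /=.
have fX' : (pnorm f <= Num.truncn X)%N.
  by rewrite truncn_ge_nat // (le_trans _ fX).
have := leq_trans (ltn_expl (size f).-1 (card_finNzRing_gt1 F)) fX'.
by case: (size f) => //= m /ltnW.
Qed.

(* Main.v *)
Require Import Defs.
From HB Require Import structures.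
From mathcomp Require Import all_boot all_order all_algebra all_field.
From mathcomp Require Import zify ring finmap.
From mathcomp Require Import boolp classical_sets functions cardinality.
From mathcomp Require Import fsbigop reals.

Set Implicit Arguments.
Unset Strict Implicit.
Unset Printing Implicit Defensive.

Import Order.TTheory GRing.Theory Num.Theory.
Local Open Scope ring_scope.

(** Write f = 1 + P^n g with g monic, and n = 3m + n2 with n2 <= 2. In
    characteristic 3 the factor P^(3m) is a cube, so f' = P^(3m) D, where
    D = (P^n2 g)' has degree less than deg g + 2 deg P, a size independent of n.
    Pellet's formula ([poly_mu_pellet]) says that mu(f) is, up to a sign that
    depends only on deg f, the Jacobi symbol (f'/f); by quadratic reciprocity
    and f = 1 mod P this is +-(f/D) ([mu_jac]).

    Cubes have zero derivative. Hence replacing g by g + P^(2 n2) (A c)^3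
    leaves D unchanged, and f becomes f + (W c)^3 with W = P^(m + n2) A. Choose
    for A the product of the primes of small degree dividing D, and let B be
    the product of the large primes dividing D to an odd power. The small primes
    then contribute a constant to (f/D), the large primes of even multiplicity
    matter only when they divide f, which is rare, and what remains is
    ((f + (W c)^3)/B). Cubing is a bijection modulo the squarefree polynomial B
    and is additive, so this symbol equals +-((y + c)/B) for a fixed y
    ([odd_part_sum]). As the shift must not change deg g, c ranges over the
    polynomials of degree up to nearly deg D / 3: a short character sum, but
    one beyond the Burgess threshold deg B / 4.

    Burgess' bound ([burgess]) is proved in the classical way. One replaces c by
    c + u v, so that the sum is controlled by short sums in v at the points
    (y + c)/u; the number of representations of a point in this way is handled
    by counting solutions of e u' = e' u ([quad_count]), and the short sums by
    their moment of order 2r ([moment_bound]). Expanding the moment leaves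
    complete sums, which factor over the primes dividing B ([crt_sum_prod]); for
    a single prime, square-root cancellation is proved by Stepanov's method
    ([stepanov_bound], [weil_sum]). As large primes have degree at least a fixed
    proportion of deg B, their number is bounded and the constants of the prime
    moduli multiply to a constant.

    The argument fails for two kinds of g: those for which A has large degree,
    rare by Markov's inequality since a prime Q divides D with probability
    about 1/|Q| ([count_large_small_part]), and those with B = 1, for which D
    is a square times a polynomial of small degree
    ([count_trivial_odd_part]). The degree of D is bounded independently of n,
    and the estimates depend on n only through it, whence the uniformity. *)

(** * Hasse derivatives *)

Section HasseDerivatives.
Variable K : fieldType.
Implicit Types p q f r : {poly K}.

Lemma nderivnM n p q :
  (p * q)^`N(n) = \sum_(i < n.+1) p^`N(i) * q^`N(n - i).
Proof.
have S (u : {poly K}) m : (u * 'X)^`N(m.+1) = u^`N(m) + u^`N(m.+1) * 'X.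
  by rewrite -[u * 'X]addr0 -[0]/(0%:P) nderivnMXaddC.
elim/poly_ind: p n => [|p c IH] n.
  rewrite mul0r linear0 big1 // => i _.
  by rewrite linear0 mul0r.
have -> : (p * 'X + c%:P) * q = p * q * 'X + c *: q.
  by rewrite mulrDl mul_polyC mulrAC.
rewrite nderivnD nderivnZ.
case: n => [|n].
  by rewrite big_ord_recl big_ord0 addr0 !nderivn0 mulrDl mul_polyC mulrAC.
rewrite S !IH [RHS]big_ord_recl /= !nderivn0 subn0.
under [X in _ = _ + X]eq_bigr => i _ do rewrite /bump /= add1n nderivnMXaddC subSS mulrDl.
rewrite big_split /= [X in _ + X * _ + _ = _]big_ord_recl /= nderivn0 subn0.
rewrite mulrDl (mulrDl (p * 'X)) mul_polyC mulr_suml.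
have -> : \sum_(i < n.+1) p^`N(i.+1) * 'X * q^`N(n - i) =
  \sum_(i < n.+1) p^`N(lift ord0 i) * q^`N(n.+1 - lift ord0 i) * 'X.
  by apply: eq_bigr => i _; rewrite /= /bump /= add1n subSS mulrAC.
by rewrite [p * _ * 'X]mulrAC; ring.
Qed.

Lemma nderivn_size n p : (size p^`N(n) <= size p - n)%N.
Proof.
apply/leq_sizeP => i Hi; rewrite coef_nderivn nth_default ?mul0rn //.
by rewrite -leq_subLR.
Qed.

(** This lets the auxiliary polynomial of Stepanov's method be differentiated
    with a common factor f^(l-k) removed, which keeps the degrees small. *)
Lemma dvdp_nderivn_exp f r l k : f ^+ (l - k) %| (f ^+ l * r)^`N(k).
Proof.
elim: l k r => [|l IH] k r; first by rewrite expr0 dvd1p.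
rewrite exprS -mulrA nderivnM.
apply: (big_ind (fun p => f ^+ (l.+1 - k) %| p)) => [|p q|i _]; first exact: dvdp0.
  exact: dvdp_add.
case: i => [[|i] /= Hi].
  rewrite nderivn0 subn0.
  case: (leqP k l) => Hkl; first by rewrite subSn // exprS dvdp_mul.
  by rewrite (_ : (l.+1 - k)%N = 0%N) ?expr0 ?dvd1p //; lia.
apply: dvdp_mull; apply: dvdp_trans (IH _ _); apply: dvdp_exp2l; lia.
Qed.

(** Hasse derivatives detect multiplicities in any characteristic, through
    Taylor's formula at a. *)
Lemma dvdp_of_nderivn p a l :
  (forall k, (k < l)%N -> p^`N(k).[a] = 0) -> ('X - a%:P) ^+ l %| p.
Proof.
move=> H.
have -> : p = \sum_(i < size p) (p^`N(i).[a])%:P * ('X - a%:P) ^+ i.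
  have C : GRing.comm (a%:P) ('X - a%:P) by exact: mulrC.
  have := nderiv_taylor (map_poly polyC p) C.
  rewrite addrC subrK size_map_polyC -[_.['X]]/(p \Po 'X) comp_polyXr => {1}->.
  by apply: eq_bigr => i _; rewrite nderivn_map horner_map.
apply: (big_ind (fun p => ('X - a%:P) ^+ l %| p)) => [|u v|i _]; first exact: dvdp0.
  exact: dvdp_add.
case: (ltnP i l) => Hi; first by rewrite H // mul0r dvdp0.
by apply: dvdp_mull; apply: dvdp_exp2l.
Qed.

Variable Q : nat.
Hypothesis charQ : [pchar K].-nat Q.

(** Compare the coefficients of (X + 1)^Q = X^Q + 1. *)
Lemma bin_pchar_eq0 k : (0 < k < Q)%N -> 'C(Q, k)%:R = 0 :> K.
Proof.
move=> /andP[k0 kQ].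
have cP : [pchar {poly K}].-nat Q by rewrite (eq_pnat _ (pchar_lalg {poly K})).
have := exprDn_pchar 'X (1 : {poly K}) cP.
rewrite exprDn expr1n => /(congr1 (fun p : {poly K} => p`_(Q - k))).
rewrite coef_sum coefD coefXn coef1 (bigD1 (inord k)) //= inordK; last by lia.
rewrite expr1n mulr1 coefMn coefXn eqxx big1 => [|i /eqP Hi].
  have -> : (Q - k == Q)%N = false by lia.
  have -> : (Q - k == 0)%N = false by lia.
  by rewrite !addr0.
rewrite expr1n mulr1 coefMn coefXn.
case: eqP => [E|_]; last by rewrite mul0rn.
by case: Hi; apply: val_inj; rewrite /= inordK; have := ltn_ord i; lia.
Qed.

(** The Hasse derivatives of X^Q of orders 1 to Q-1 vanish, so X^(jQ) behaves as
    a constant. *)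
Lemma nderivnMXQ k j p : (k < Q)%N -> (p * 'X^(j * Q))^`N(k) = p^`N(k) * 'X^(j * Q).
Proof.
move=> kQ; elim: j p => [|j IH] p; first by rewrite mul0n expr0 !mulr1.
rewrite mulSn exprD mulrA IH mulrA; congr (_ * _).
rewrite nderivnM big_ord_recr /= subnn nderivn0 big1 ?add0r // => i _.
rewrite nderivnXn -mulr_natr -polyC_natr bin_pchar_eq0 ?mulr0 //.
have := ltn_ord i; lia.
Qed.

End HasseDerivatives.

(** * Stepanov's method *)

Lemma linear_kernel_nontriv (K : fieldType) (U V : vectType K) (phi : U -> V) :
  linear phi -> (\dim {:V} < \dim {:U})%N -> exists2 u, u != 0 & phi u = 0.
Proof.
move=> lphi dVU.
pose phiL := GRing.isLinear.Build _ _ _ _ phi lphi.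
pose f : {linear U -> V} := HB.pack phi phiL.
have := limg_ker_dim (linfun f) fullv.
rewrite capfv => E.
have : (0 < \dim (lker (linfun f)))%N.
  have := dimvS (subvf (linfun f @: fullv)%VS); lia.
rewrite lt0n dimv_eq0 -vpick0 => nz.
exists (vpick (lker (linfun f))) => //.
by have := memv_pick (lker (linfun f)); rewrite memv_ker lfunE => /eqP.
Qed.

Section StepanovNonvanishing.
Variable K : fieldType.
Variable Q : nat.
Hypothesis charQ : [pchar K].-nat Q.
Implicit Types p f r s : {poly K}.

Lemma size_sum_le (I : Type) (t : seq I) (P : pred I) (G : I -> {poly K}) n :
  (forall i, P i -> size (G i) <= n)%N -> (size (\sum_(i <- t | P i) G i)%R <= n)%N.
Proof.
move=> H; apply: (big_ind (fun p : {poly K} => (size p <= n)%N)) => //.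
  by rewrite size_poly0.
by move=> p q Hp Hq; apply: leq_trans (size_polyD _ _) _; rewrite geq_max Hp.
Qed.

Lemma Q_gt0 : (0 < Q)%N. Proof. by case/andP: charQ. Qed.

Lemma expr_sum_pchar (R : comNzRingType) (I : Type) (t : seq I) (G : I -> R) :
  [pchar R].-nat Q -> (\sum_(i <- t) G i) ^+ Q = \sum_(i <- t) G i ^+ Q.
Proof.
move=> cR; elim: t => [|i t IH]; first by rewrite !big_nil expr0n gtn_eqF // Q_gt0.
by rewrite !big_cons exprDn_pchar // IH.
Qed.

(** Valid because f has coefficients in the field with Q elements. *)
Lemma expQ_comp_poly f : (forall i, f`_i ^+ Q = f`_i) -> f ^+ Q = f \Po 'X^Q.
Proof.
move=> H; rewrite -[f in LHS]coefK poly_def comp_polyE expr_sum_pchar.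
  by apply: eq_bigr => i _; rewrite exprZn H -!exprM mulnC.
by rewrite (eq_pnat _ (pchar_lalg {poly K})).
Qed.

(** The coefficients of G are the digits in base X^Q of G(X, X^Q). *)
Lemma base_digits_inj (G : {poly {poly K}}) :
  (forall i, size (G`_i)%R <= Q)%N -> G.['X^Q] = 0 -> G = 0.
Proof.
elim/poly_ind: G => [//|G c IH] H.
have Hc : (size c <= Q)%N by have := H 0%N; rewrite coefD coefMX coefC /= add0r.
have HG i : (size (G`_i)%R <= Q)%N.
  by have := H i.+1; rewrite coefD coefMX coefC /= addr0.
rewrite hornerD hornerM hornerX hornerC => E.
have c0 : c = 0.
  apply/polyP => i; rewrite coef0.
  case: (ltnP i Q) => Hi; last by rewrite nth_default //; apply: leq_trans Hc Hi.
  by move/(congr1 (fun p : {poly K} => p`_i)): E; rewrite coefD coefMXn Hi add0r coef0.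
rewrite c0 addr0 in E; rewrite c0 polyC0 addr0.
move/eqP: E; rewrite mulf_eq0 expf_eq0 polyX_eq0 andbF orbF => /eqP /(IH HG) ->.
by rewrite mul0r.
Qed.

Lemma odd_mup_not_square f r s alpha : f != 0 -> odd (mup alpha f) -> r != 0 -> f * r ^+ 2 <> s ^+ 2.
Proof.
move=> f0 of_ r0 E.
have s0 : s != 0.
  have : f * r ^+ 2 != 0 by rewrite mulf_neq0 ?expf_neq0.
  by rewrite E; apply: contraNneq => ->; rewrite expr0n.
have := congr1 (mup alpha) E.
rewrite !expr2 !mupM ?mulf_neq0 // => /(congr1 odd).
by rewrite !oddD !addbb addbF of_.
Qed.

Variables (h m D J : nat) (f : {poly K}) (alpha : K).
Hypothesis Qh : Q = h.*2.+1.
Hypothesis monf : f \is monic.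
Hypothesis sizef : size f = m.*2.+1.
Hypothesis frobf : forall i, f`_i ^+ Q = f`_i.
Hypothesis simplef : odd (mup alpha f).
Hypothesis D0 : (0 < D)%N.
Hypothesis HD : (D + D + m.*2 <= Q.+1)%N.

(** If the sum vanishes then H0(X^Q) = - f^h H1(X^Q). Squaring and multiplying by
    f turns f^(2h+1) = f^Q into f(X^Q); reading off digits in base X^Q gives
    f(X) H0^2 = f(Y) H1^2 in two independent variables, and its leading
    coefficient in Y exhibits f(X) as a quotient of squares, which a root
    of odd multiplicity forbids. *)
Lemma stepanov_nonvanishing (r s : nat -> {poly K}) :
  (forall j, size (r j) <= D)%N -> (forall j, size (s j) <= D)%N ->
  \sum_(j < J) (r j + s j * f ^+ h) * 'X^(j * Q) = 0 ->
  forall j, (j < J)%N -> r j = 0 /\ s j = 0.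
Proof.
move=> Hr Hs E.
pose H0 := \poly_(j < J) r j; pose H1 := \poly_(j < J) s j.
have EH (u : nat -> {poly K}) : (\poly_(j < J) u j).['X^Q] = \sum_(j < J) u j * 'X^(j * Q).
  rewrite (horner_coef_wide _ (size_poly _ _)); apply: eq_bigr => j _.
  by rewrite coef_poly ltn_ord -exprM mulnC.
have {}E : H0.['X^Q] = - (f ^+ h * H1.['X^Q]).
  apply/eqP; rewrite -addr_eq0 !EH mulr_sumr -big_split /= -[X in _ == X]E.
  by apply/eqP; apply: eq_bigr => j _; rewrite mulrDl mulrA [f ^+ h * _]mulrC.
have {}E : f%:P * H0 ^+ 2 = f^:P * H1 ^+ 2.
  apply/eqP; rewrite -subr_eq0; apply/eqP; apply: base_digits_inj.
    have sz (u : nat -> {poly K}) : (forall j, size (u j) <= D)%N ->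
      forall i, (size (((\poly_(j < J) u j) ^+ 2)`_i)%R <= (D + D).-1)%N.
      move=> Hu i; rewrite expr2 coefM; apply: size_sum_le => k _.
      rewrite !coef_poly; apply: leq_trans (size_polyMleq _ _) _.
      have H k' : (size (if (k' < J)%N then u k' else 0)%R <= D)%N.
        by case: ifP => // _; rewrite size_poly0.
      by rewrite -!subn1 leq_sub2r // leq_add //; apply: H.
    move=> i; rewrite coefB coefCM; apply: leq_trans (size_polyD _ _) _.
    rewrite size_polyN geq_max; apply/andP; split.
      apply: leq_trans (size_polyMleq _ _) _; rewrite sizef.
      apply: (@leq_trans (m.*2.+1 + (D + D).-1).-1); last by lia.
      by have := sz r Hr i; rewrite -/H0; move: (size _) => z; lia.
    rewrite coefM; apply: size_sum_le => k _; rewrite coef_map /= mul_polyC.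
    apply: leq_trans (size_scale_leq _ _) _.
    by apply: leq_trans (sz s Hs _) _; lia.
  rewrite !expr2 hornerD hornerN !hornerM hornerC E.
  rewrite -[f^:P.[_]]/(f \Po (polyX K) ^+ Q) -expQ_comp_poly //; move: (H1.[_]) => z.
  have ->: f ^+ Q = f * f ^+ h * f ^+ h by rewrite Qh exprS -addnn exprD mulrA.
  by ring.
suff [H00 H10] : H0 = 0 /\ H1 = 0.
  move=> j Hj; split.
    by move/(congr1 (fun p : {poly {poly K}} => p`_j)): H00; rewrite coef_poly Hj coef0.
  by move/(congr1 (fun p : {poly {poly K}} => p`_j)): H10; rewrite coef_poly Hj coef0.
have f0 : f != 0 by exact: monic_neq0.
have fP0 : f^:P != 0 by rewrite map_polyC_eq0.
have H1_nz : H0 != 0 -> H1 != 0.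
  move=> nz; have : f%:P * H0 ^+ 2 != 0 by rewrite mulf_neq0 ?expf_neq0 ?polyC_eq0.
  by rewrite E; apply: contraNneq => ->; rewrite expr0n mulr0.
case: (eqVneq H0 0) => [H00|nz].
  split=> //; move/eqP: E; rewrite H00 expr0n mulr0 eq_sym mulf_eq0 (negPf fP0) /=.
  by rewrite expf_eq0 => /eqP.
have := congr1 lead_coef E.
rewrite !expr2 !lead_coefM lead_coefC lead_coef_map_inj //; last exact: polyC_inj.
rewrite (monicP monf) mul1r -!expr2 => H.
by case: (odd_mup_not_square f0 simplef _ H); rewrite lead_coef_eq0.
Qed.
End StepanovNonvanishing.

Section StepanovBound.
Variable K : fieldType.
Variable Q : nat.
Hypothesis charQ : [pchar K].-nat Q.
Variables (h m w : nat) (f : {poly K}) (alpha a : K) (pts : seq K).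
Hypothesis Qh : Q = h.*2.+1.
Hypothesis monf : f \is monic.
Hypothesis sizef : size f = m.*2.+1.
Hypothesis frobf : forall i, f`_i ^+ Q = f`_i.
Hypothesis simplef : odd (mup alpha f).
Hypothesis w0 : (0 < w)%N.
Hypothesis Hw : (w * (4 * m * w + w + 1) + m <= h)%N.
Hypothesis upts : uniq pts.
Hypothesis ptsP : {in pts, forall x, x ^+ Q = x /\ f.[x] ^+ h = a}.

(* D is the largest size allowed by [stepanov_nonvanishing]; 2w is the order
   of vanishing imposed at each point. *)
Let D := (h.+1 - m)%N.
Let l := w.*2.
Let A k (r : {poly K}) := (f ^+ l * r)^`N(k) %/ f ^+ (l - k).
Let A' k (s : {poly K}) := (f ^+ (l + h) * s)^`N(k) %/ f ^+ (l + h - k).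

Let linA b k c r s : ((f ^+ b * (c *: r + s))^`N(k) %/ f ^+ (b - k)) =
  c *: ((f ^+ b * r)^`N(k) %/ f ^+ (b - k)) + ((f ^+ b * s)^`N(k) %/ f ^+ (b - k)).
Proof. by rewrite mulrDr -scalerAr nderivnD nderivnZ divpD divpZl. Qed.

Let f0 : f != 0. Proof. exact: monic_neq0. Qed.

Let size_fexp b : size (f ^+ b) = (b * m.*2).+1.
Proof. by rewrite -[LHS]prednK ?size_exp ?sizef ?size_poly_gt0 ?expf_neq0 //= mulnC. Qed.

Let sizeA b k (r : {poly K}) : (size r <= D)%N -> (k < l)%N -> (k <= b)%N ->
  (size ((f ^+ b * r)^`N(k) %/ f ^+ (b - k))%R <= D + l * m.*2)%N.
Proof.
move=> Hr kl kb; rewrite size_divp ?expf_neq0 // size_fexp /=.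
have H1 := nderivn_size k (f ^+ b * r).
have H2 := size_polyMleq (f ^+ b) r.
rewrite size_fexp in H2.
have {H1 H2} := leq_trans H1 (leq_sub2r k H2); move: (size _) => x H1.
have Hk : (k * m.*2 <= l * m.*2)%N by rewrite leq_mul2r ltnW ?orbT.
rewrite mulnBl.
have : (k * m.*2 <= b * m.*2)%N by rewrite leq_mul2r kb orbT.
lia.
Qed.

(* A matrix encodes the pairs (R j, S j) of unknown polynomials, a row for each
   j. On the points, X^Q = X and f^h = a, so up to a factor f^(l-k) the k-th
   derivative of the auxiliary polynomial takes there the values of [e u k],
   a polynomial of small degree that is linear in u. *)
Let U := 'M[K]_(w.+1, D + D).
Let R (u : U) (j : nat) := rVpoly (lsubmx (row (inord j) u)).
Let S (u : U) (j : nat) := rVpoly (rsubmx (row (inord j) u)).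
Let sz := (D + l * m.*2 + w)%N.
Let e u k := \sum_(j < w.+1) (A k (R u j) + a *: A' k (S u j)) * 'X^j.
Let phi u : 'M[K]_(l, sz) := \matrix_(k < l) poly_rV (e u k).

Let phi_lin : linear phi.
Proof.
move=> c u v; apply/row_matrixP => k; rewrite linearD linearZ /= !rowK -linearP.
congr poly_rV; rewrite /e scaler_sumr -big_split; apply: eq_bigr => j _ /=.
rewrite /R /S !linearP /= /A /A' !linA scalerAl -mulrDl; congr (_ * _).
by rewrite !scalerDr !scalerA [a * c]mulrC; ring.
Qed.

Let size_e u k : (k < l)%N -> (size (e u k) <= sz)%N.
Proof.
move=> kl; apply: size_sum_le => j _.
apply: leq_trans (size_polyMleq _ _) _; rewrite size_polyXn addnS /=.
have Hj := ltn_ord j; rewrite /sz leq_add //.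
apply: leq_trans (size_polyD _ _) _; rewrite geq_max.
rewrite sizeA ?size_poly //=; last exact: ltnW.
apply: leq_trans (size_scale_leq _ _) _.
by rewrite sizeA ?size_poly //=; lia.
Qed.

Lemma dvdp_prod_exp_XsubC (p : {poly K}) (t : seq K) n : uniq t ->
  {in t, forall x, ('X - x%:P) ^+ n %| p} -> (\prod_(x <- t) ('X - x%:P)) ^+ n %| p.
Proof.
elim: t => [|x t IH] /=; first by rewrite big_nil expr1n dvd1p.
move=> /andP[xt ut] H; rewrite big_cons exprMn Gauss_dvdp.
  by rewrite H ?mem_head // IH // => y yt; apply: H; rewrite inE yt orbT.
apply: coprimep_expl; apply: coprimep_expr.
rewrite coprimep_sym coprimep_XsubC root_prod_XsubC //.
Qed.

(** The auxiliary polynomial p = f^l sum_j (r_j + s_j f^h) X^(jQ) has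
    2 D (w + 1) free coefficients; vanishing to order l = 2w at all the points
    costs l (D + 2 l m + w) linear equations, slightly fewer. So some p
    is nonzero and vanishes at the points to order l, and
    l * #pts <= deg p, which is about w Q: the number of points is at most
    Q/2 up to an error of order the square root of Q. *)
Lemma stepanov_bound :
  (w.*2 * size pts <= w * Q + 4 * w * m + h + 2 * m * h)%N.
Proof.
have [u u0 phi0] : exists2 u, u != 0 & phi u = 0.
  apply: linear_kernel_nontriv phi_lin _.
  rewrite !dimvf !dim_matrix /sz /l /D; nia.
have wh : (w <= h)%N by nia.
have mh : (m <= h)%N by lia.
have lQ : (l <= Q)%N by rewrite /l Qh; lia.
have e0 k : (k < l)%N -> e u k = 0.
  move=> kl; rewrite -[LHS](@poly_rV_K _ sz) ?size_e //.
  have := congr1 (row (Ordinal kl)) phi0; rewrite rowK /= => ->.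
  by rewrite linear0 linear0.
pose p := f ^+ l * \sum_(j < w.+1) (R u j + S u j * f ^+ h) * 'X^(j * Q).
have p_nz : p != 0.
  rewrite mulf_neq0 ?expf_neq0 //; apply: contra_neq u0 => E.
  have RS0 j : (j < w.+1)%N -> R u j = 0 /\ S u j = 0.
    apply: (stepanov_nonvanishing (D := D) charQ Qh monf sizef frobf simplef _ _ _ _ E) => [||i|i].
    - rewrite /D; lia.
    - rewrite /D Qh; lia.
    - exact: size_poly.
    - exact: size_poly.
  apply/row_matrixP => j; rewrite linear0 -[row j u]hsubmxK.
  have [] := RS0 j (ltn_ord j); rewrite /R /S inord_val.
  move=> /(congr1 (@poly_rV K D)) + /(congr1 (@poly_rV K D)).
  by rewrite !rVpolyK !linear0 => -> ->; rewrite row_mx0.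
have pE : p = \sum_(j < w.+1) (f ^+ l * R u j + f ^+ (l + h) * S u j) * 'X^(j * Q).
  rewrite /p mulr_sumr; apply: eq_bigr => j _; rewrite mulrA; congr (_ * _).
  by rewrite mulrDr exprD; ring.
(* At a point x the k-th derivative of p is f(x)^(l-k) times (e u k)(x). *)
have dvd_pts : {in pts, forall x, ('X - x%:P) ^+ l %| p}.
  move=> x xp; apply: dvdp_of_nderivn => k kl.
  have [xQ xa] := ptsP xp.
  have -> : p^`N(k).[x] = f.[x] ^+ (l - k) * (e u k).[x].
    rewrite pE linear_sum !horner_sum mulr_sumr; apply: eq_bigr => j _ /=.
    rewrite (nderivnMXQ charQ) ?(leq_trans kl) // nderivnD.
    rewrite -(divpK (dvdp_nderivn_exp f (R u j) l k)).
    rewrite -(divpK (dvdp_nderivn_exp f (S u j) (l + h) k)).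
    rewrite -/(A k (R u j)) -/(A' k (S u j)) addnC -addnBA ?(ltnW kl) // exprD.
    rewrite !hornerE mulnC exprM xQ /= ?horner_exp -xa.
    ring.
  by rewrite e0 // horner0 mulr0.
have := dvdp_leq p_nz (dvdp_prod_exp_XsubC upts dvd_pts).
have -> : size ((\prod_(x <- pts) ('X - x%:P)) ^+ l) = (size pts * l).+1.
  rewrite -[LHS]prednK ?size_exp ?size_prod_XsubC //.
  by rewrite size_poly_gt0 expf_neq0 ?monic_neq0 ?monic_prod_XsubC.
have Hs : (size (\sum_(j < w.+1) (R u j + S u j * f ^+ h) * 'X^(j * Q))%R <= D + h * m.*2 + w * Q)%N.
  apply: size_sum_le => j _; apply: leq_trans (size_polyMleq _ _) _.
  rewrite size_polyXn addnS /= leq_add ?leq_mul2r ?(ltnW (ltn_ord j)) ?orbT //; last by rewrite -ltnS ltn_ord orbT.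
  apply: leq_trans (size_polyD _ _) _; rewrite geq_max (leq_trans (size_poly _ _)) ?leq_addr //=.
  apply: leq_trans (size_polyMleq _ _) _; rewrite size_fexp addnS /= leq_add2r; exact: size_poly.
move=> H; have := size_polyMleq (f ^+ l) (\sum_(j < w.+1) (R u j + S u j * f ^+ h) * 'X^(j * Q)).
rewrite size_fexp addSn /= => H2.
have {H H2 Hs} := leq_trans H (leq_trans H2 (leq_add (leqnn _) Hs)).
rewrite /D /l; nia.
Qed.
End StepanovBound.

(** * The Jacobi symbol as a power of a resultant *)

Lemma perm_eq_prod_XsubC (K : fieldType) (s t : seq K) :
  \prod_(z <- s) ('X - z%:P) = \prod_(z <- t) ('X - z%:P) -> perm_eq s t.
Proof.
by move=> E; apply/allP => x _ /=; rewrite -!mu_prod_XsubC E.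
Qed.

Lemma prodrN_seq (R : comNzRingType) (I : Type) (s : seq I) (G : I -> R) :
  \prod_(i <- s) - G i = (-1) ^+ size s * \prod_(i <- s) G i.
Proof.
elim: s => [|i s IH]; first by rewrite !big_nil mulr1.
by rewrite !big_cons IH exprS; ring.
Qed.

Section Symbol.
Variables (F : finFieldType) (K : closedFieldType) (iota : {rmorphism F -> K}).
Variable hq : nat.
Hypothesis cardF : #|F| = hq.*2.+1.
Hypothesis charF : [pchar F].-nat #|F|.
Implicit Types f g p : {poly F}.
Local Notation q := #|F|.
Local Notation "p ^i" := (map_poly iota p) (at level 2, format "p ^i").

Lemma charK : [pchar K].-nat q.
Proof. by rewrite (eq_pnat _ (fmorph_pchar iota)). Qed.

(** The two anonymous arguments let the instance of ring morphism declared below,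
    which depends on charF and iota, be found from the term. *)
Definition frobq_ (_ : [pchar F].-nat q) (_ : {rmorphism F -> K}) (x : K) : K := x ^+ q.
Local Notation frobq := (frobq_ charF iota).

Lemma frobq_zmod : zmod_morphism frobq.
Proof. by move=> x y; rewrite /frobq_ exprDn_pchar ?charK // exprNn_pchar ?charK. Qed.
Lemma frobq_monoid : monoid_morphism frobq.
Proof. by split=> [|x y]; rewrite /frobq_ ?expr1n ?exprMn. Qed.
HB.instance Definition _ := GRing.isZmodMorphism.Build K K frobq frobq_zmod.
HB.instance Definition _ := GRing.isMonoidMorphism.Build K K frobq frobq_monoid.

Lemma frobq_inj : injective frobq. Proof. exact: fmorph_inj. Qed.

Lemma frobq_iota a : frobq (iota a) = iota a.
Proof. by rewrite /frobq_ -rmorphXn expf_card. Qed.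

(** The elements of F are all the roots of X^q - X. *)
Lemma frobq_fixed x : frobq x = x -> exists a, x = iota a.
Proof.
move=> Hx; have := congr1 (fun p => (map_poly iota p).[x]) (finField_genPoly F).
rewrite rmorphB /= map_polyXn map_polyX !hornerE [x ^+ _]Hx subrr rmorph_prod /=.
rewrite horner_prod => /esym/eqP /prodf_eq0[a _].
rewrite rmorphB /= map_polyX map_polyC /= hornerXsubC subr_eq0 => /eqP.
by exists a.
Qed.

Lemma frobq_map p : map_poly frobq p^i = p^i.
Proof.
by rewrite -map_poly_comp; apply: eq_map_poly => x /=; rewrite frobq_iota.
Qed.

Lemma frobq_horner p x : frobq p^i.[x] = p^i.[frobq x].
Proof. by rewrite -horner_map frobq_map. Qed.

Definition rts g : seq K := sval (closed_field_poly_normal g^i).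

Lemma rtsE g : g \is monic -> g^i = \prod_(z <- rts g) ('X - z%:P).
Proof.
move=> mg; rewrite /rts; case: closed_field_poly_normal => s /= Es.
by rewrite {1}Es lead_coef_map (monicP mg) rmorph1 scale1r.
Qed.

Lemma rts_perm g s : g \is monic -> g^i = \prod_(z <- s) ('X - z%:P) -> perm_eq (rts g) s.
Proof. by move=> mg E; apply: perm_eq_prod_XsubC; rewrite -rtsE. Qed.

Lemma size_rts g : g \is monic -> size (rts g) = (size g).-1.
Proof. by move=> mg; rewrite -(size_map_poly iota) rtsE // size_prod_XsubC. Qed.

Lemma mem_rts g x : g \is monic -> (x \in rts g) = root g^i x.
Proof. by move=> mg; rewrite rtsE // root_prod_XsubC. Qed.

Lemma rtsM f g : f \is monic -> g \is monic -> perm_eq (rts (f * g)) (rts f ++ rts g).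
Proof.
move=> mf mg; apply: rts_perm; first by rewrite monicMl.
by rewrite big_cat /= -!rtsE // rmorphM.
Qed.

Lemma rts_frob g : g \is monic -> perm_eq (rts g) (map frobq (rts g)).
Proof.
move=> mg; apply: rts_perm => //.
by rewrite -[LHS]frobq_map rtsE // map_prod_XsubC big_map.
Qed.

(** The resultant of f and a monic g. *)
Definition root_res g f : K := \prod_(b <- rts g) f^i.[b].

Local Notation res := root_res.

Lemma resMr g f1 f2 : res g (f1 * f2) = res g f1 * res g f2.
Proof. by rewrite -big_split /=; apply: eq_bigr => b _; rewrite rmorphM hornerM. Qed.

Lemma resMl g1 g2 f : g1 \is monic -> g2 \is monic ->
  res (g1 * g2) f = res g1 f * res g2 f.
Proof. by move=> m1 m2; rewrite /root_res (perm_big _ (rtsM m1 m2)) big_cat. Qed.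

Lemma res_mod g f1 f2 : g \is monic -> g %| f1 - f2 -> res g f1 = res g f2.
Proof.
move=> mg /dvdpP[u E]; apply: eq_big_seq => b.
rewrite mem_rts // => /rootP rb; rewrite -(subrK f2 f1) E rmorphD rmorphM /=.
by rewrite hornerD hornerM rb mulr0 add0r.
Qed.

Lemma res_recip f g : f \is monic -> g \is monic ->
  res g f = (-1) ^+ ((size f).-1 * (size g).-1) * res f g.
Proof.
move=> mf mg; rewrite /root_res.
under eq_bigr => b _ do rewrite (rtsE mf) horner_prod.
under [in RHS]eq_bigr => b _ do rewrite (rtsE mg) horner_prod.
rewrite exchange_big /= mulnC -(size_rts mg) -(size_rts mf) exprM.
elim: (rts f) => [|a t IH]; first by rewrite !big_nil mulr1.
rewrite !big_cons IH exprS /=.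
under eq_bigr => b _ do rewrite hornerXsubC -opprB.
under [in RHS]eq_bigr => b _ do rewrite hornerXsubC.
by rewrite prodrN_seq; ring.
Qed.

(** The Frobenius permutes the roots of g, so the resultant lies in F. *)
Lemma frobq_res g f : g \is monic -> frobq (res g f) = res g f.
Proof.
move=> mg; rewrite rmorph_prod /= [RHS](perm_big _ (rts_frob mg)) big_map /=.
by apply: eq_bigr => b _; rewrite frobq_horner.
Qed.

Lemma res_const g (c : F) : g \is monic -> res g c%:P = iota c ^+ (size g).-1.
Proof.
move=> mg; rewrite -size_rts // /root_res; elim: (rts g) => [|b t IH]; first by rewrite big_nil.
by rewrite big_cons IH map_polyC hornerC /= exprS.
Qed.

Definition sgnK (x : K) : int := if x == 0 then 0 else if x == 1 then 1 else -1.
Definition is_sgn (x : K) := [|| x == 0, x == 1 | x == -1].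

Lemma neq_m11 : (-1 == 1 :> K) = false.
Proof.
apply: contraTF charK => /eqP E.
have : (2 : K) = 0 by rewrite -[2]/(1 + 1) -{1}E addNr.
move=> E2; have c2 : 2%N \in [pchar K] by apply/andP; split=> //; apply/eqP.
rewrite (eq_pnat _ (pcharf_eq c2)); apply/negP => /p_natP[[|k] Eq].
  by have := card_finNzRing_gt1 F; rewrite Eq.
by have := congr1 odd Eq; rewrite cardF /= odd_double expnS oddM.
Qed.

Lemma sgnKM x y : is_sgn x -> is_sgn y -> sgnK (x * y) = sgnK x * sgnK y.
Proof.
rewrite /sgnK; case/or3P => /eqP ->; case/or3P => /eqP ->;
 rewrite ?mul0r ?mulr0 ?eqxx ?mul1r ?mulr1 ?mulrNN ?mulr1 ?eqxx ?oppr_eq0 ?oner_eq0 ?neq_m11 //=.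
Qed.

Lemma is_sgn_hq x : frobq x = x -> is_sgn (x ^+ hq).
Proof.
move=> Hx; rewrite /is_sgn; case: (eqVneq x 0) => [->|x0].
  by rewrite expr0n; case: (hq == 0)%N; rewrite ?mulr1n ?mulr0n eqxx ?orbT.
rewrite -eqf_sqr expr1n -exprM muln2.
suff -> : x ^+ hq.*2 = 1 by rewrite eqxx orbT.
by apply: (mulfI x0); rewrite mulr1 -exprS -cardF.
Qed.

(** By Euler's criterion this is the Jacobi symbol (f/g): for irreducible g the
    resultant is the norm of f mod g down to F, and raising it to the power
    hq = (q-1)/2 tests whether f is a square modulo g. Taking this formula as
    the definition makes multiplicativity and reciprocity properties of
    resultants. *)
Definition jacobi f g : int := sgnK (res g f ^+ hq).

Local Notation jac := jacobi.

Lemma jac_is_sgn f g : g \is monic -> is_sgn (res g f ^+ hq).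
Proof. by move=> mg; apply: is_sgn_hq; exact: frobq_res. Qed.

Lemma jacMl f1 f2 g : g \is monic -> jac (f1 * f2) g = jac f1 g * jac f2 g.
Proof. by move=> mg; rewrite /jacobi resMr exprMn sgnKM ?jac_is_sgn. Qed.

Lemma jacMr f g1 g2 : g1 \is monic -> g2 \is monic ->
  jac f (g1 * g2) = jac f g1 * jac f g2.
Proof. by move=> m1 m2; rewrite /jacobi resMl // exprMn sgnKM ?jac_is_sgn. Qed.

Lemma jac_mod f1 f2 g : g \is monic -> g %| f1 - f2 -> jac f1 g = jac f2 g.
Proof. by move=> mg d; rewrite /jacobi (res_mod mg d). Qed.

Lemma sgnK_sign n : sgnK ((-1) ^+ n) = (-1) ^+ n.
Proof.
rewrite -signr_odd -[in RHS]signr_odd; case: odd; rewrite ?expr0 ?expr1 /sgnK ?oner_eq0 ?eqxx //.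
by rewrite oppr_eq0 oner_eq0 neq_m11.
Qed.

Lemma is_sgn_sign n : is_sgn ((-1) ^+ n).
Proof. by rewrite /is_sgn -signr_odd; case: odd; rewrite ?expr0 ?expr1 eqxx ?orbT. Qed.

Lemma jac_recip f g : f \is monic -> g \is monic ->
  jac f g = (-1) ^+ ((size f).-1 * (size g).-1 * hq) * jac g f.
Proof.
move=> mf mg; rewrite /jacobi res_recip // exprMn sgnKM ?jac_is_sgn //; last first.
  by rewrite -exprM is_sgn_sign.
by rewrite -exprM sgnK_sign.
Qed.

Lemma jac1 g : jac 1 g = 1.
Proof.
rewrite /jacobi /root_res big1 => [|b _]; last by rewrite rmorph1 hornerC.
by rewrite expr1n /sgnK oner_eq0 eqxx.
Qed.

Lemma jac_values f g : [\/ jac f g = 0, jac f g = 1 | jac f g = -1].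
Proof.
by rewrite /jacobi /sgnK; case: eqP => _; [constructor 1|case: eqP; [constructor 2|constructor 3]].
Qed.

Lemma hq_gt0 : (0 < hq)%N.
Proof. by have := card_finNzRing_gt1 F; rewrite cardF; case: hq. Qed.

Lemma jac_eq0 f g : g \is monic -> (jac f g == 0) = ~~ coprimep f g.
Proof.
move=> mg; have -> : (jac f g == 0) = (res g f == 0).
  rewrite /jacobi /sgnK; case: (eqVneq (res g f) 0) => [->|nz].
    by rewrite expr0n gtn_eqF ?hq_gt0 // eqxx.
  by rewrite expf_eq0 (negPf nz) andbF; case: ifP.
rewrite /root_res prodf_seq_eq0; apply/hasP/idP => [[b bg /= fb]|].
  apply/negP => cop.
  have cop' : coprimep f^i g^i by rewrite coprimep_map.
  have := coprimep_root cop' fb.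
  by rewrite -[_ != 0]/(~~ root _ _) -mem_rts // bg.
rewrite coprimep_def => sg.
have sg' : size (gcdp f^i g^i) != 1%N by rewrite -gcdp_map size_map_poly.
have [b /= rb] := closed_rootP _ sg'.
exists b; first by rewrite mem_rts // -dvdp_XsubCl (dvdp_trans _ (dvdp_gcdr f^i g^i)) // dvdp_XsubCl.
by rewrite -[_ == 0]/(root _ _) -dvdp_XsubCl (dvdp_trans _ (dvdp_gcdl f^i g^i)) // dvdp_XsubCl.
Qed.
End Symbol.

(** * Pellet's formula *)

Lemma map_traject_self (T : Type) (f : T -> T) x n : map f (traject f x n) = traject f (f x) n.
Proof. by elim: n x => //= n IH x; rewrite IH. Qed.

Lemma perm_traject_loop (T : eqType) (f : T -> T) x n : iter n f x = x ->
  perm_eq (map f (traject f x n)) (traject f x n).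
Proof.
move=> E; rewrite map_traject_self -(perm_cons x) -trajectS trajectSr E.
by rewrite -cats1 -[X in perm_eq _ X]cat1s perm_catC.
Qed.

Section Vdm.
Variable K : fieldType.
Fixpoint vdm (s : seq K) : K :=
  if s is x :: t then \prod_(y <- t) (x - y) * vdm t else 1.

Lemma vdm_rcons s x : vdm (rcons s x) = vdm s * \prod_(y <- s) (y - x).
Proof.
elim: s => [|z s IH] /=; first by rewrite !big_nil mulr1.
by rewrite IH -cats1 big_cat big_seq1 big_cons /=; ring.
Qed.

Lemma vdm_rot s x : vdm (rcons s x) = (-1) ^+ size s * vdm (x :: s).
Proof.
rewrite vdm_rcons /= mulrA -prodrN_seq mulrC; congr (_ * _).
by apply: eq_bigr => y _; rewrite opprB.
Qed.

Lemma vdm_neq0 s : uniq s -> vdm s != 0.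
Proof.
elim: s => [|x s IH] /=; first by rewrite oner_neq0.
move=> /andP[xs us]; rewrite mulf_neq0 ?IH // prodf_seq_neq0.
by apply/allP => y ys /=; rewrite subr_eq0; apply: contraNneq xs => ->.
Qed.

(** The discriminant as a Vandermonde square. *)
Lemma prod_deriv_roots (s : seq K) :
  \prod_(x <- s) (\prod_(y <- s) ('X - y%:P))^`().[x] = (-1) ^+ 'C(size s, 2) * vdm s ^+ 2.
Proof.
elim: s => [|x s IH]; first by rewrite !big_nil /= expr1n mulr1.
have E y : y \in s -> (\prod_(y <- x :: s) ('X - y%:P))^`().[y] =
   (y - x) * (\prod_(y <- s) ('X - y%:P))^`().[y].
  move=> ys; rewrite big_cons derivM hornerD !hornerM derivXsubC hornerXsubC hornerC mul1r.
  have /rootP -> : root (\prod_(y <- s) ('X - y%:P)) y by rewrite root_prod_XsubC.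
  by rewrite add0r.
rewrite [LHS]big_cons (eq_big_seq _ E) big_split /= IH.
rewrite big_cons derivM hornerD !hornerM derivXsubC hornerXsubC hornerC mul1r subrr mul0r addr0.
rewrite horner_prod binS bin1 exprD.
under [X in X * _ = _]eq_bigr => y _ do rewrite hornerXsubC.
under [X in _ * (X * _) = _]eq_bigr => y _ do rewrite -opprB.
by rewrite prodrN_seq; ring.
Qed.
End Vdm.

Lemma vdm_map (K L : fieldType) (f : {rmorphism K -> L}) s : f (vdm s) = vdm (map f s).
Proof.
elim: s => [|x s IH] /=; first by rewrite rmorph1.
rewrite rmorphM IH rmorph_prod big_map; congr (_ * _).
by apply: eq_bigr => y _; rewrite rmorphB.
Qed.

Section Irreducible.
Variables (F : finFieldType) (K : closedFieldType) (iota : {rmorphism F -> K}).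
Variable hq : nat.
Hypothesis cardF : #|F| = hq.*2.+1.
Hypothesis charF : [pchar F].-nat #|F|.
Implicit Types f g p : {poly F}.
Local Notation q := #|F|.
Local Notation "p ^i" := (map_poly iota p) (at level 2, format "p ^i").
Local Notation frobq := (frobq_ charF iota).
Local Notation rts := (rts iota).
Local Notation res := (root_res iota).
Local Notation jac := (jacobi iota hq).

Lemma irr_gcd_root p Q b : irreducible_poly Q -> root Q^i b -> root p^i b -> Q %| p.
Proof.
move=> iQ rQ rp; apply: contraLR isT => /negP nd.
have cop : coprimep Q^i p^i by rewrite coprimep_map irreducible_poly_coprime //; apply/negP.
by have := coprimep_root cop rQ; rewrite -[_ != 0]/(~~ root _ _) rp.
Qed.

Lemma frobq_fixed_poly (r : {poly K}) : map_poly frobq r = r -> exists p, r = p^i.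
Proof.
move=> Hr.
have H j : exists a, r`_j = iota a.
  by apply: frobq_fixed; rewrite -[in RHS]Hr coef_map.
pose g (x : K) := odflt 0 [pick a | iota a == x].
exists (map_poly g r); apply/polyP => j; rewrite coef_map.
rewrite coef_map_id0; last first.
  rewrite /g; case: pickP => [a /eqP E|] //=; apply: (fmorph_inj iota).
  by rewrite E rmorph0.
rewrite /g; case: pickP => [a /eqP //|E].
by have [a Ea] := H j; have := E a; rewrite Ea eqxx.
Qed.

(** The roots of an irreducible polynomial form one Frobenius orbit: the
    product of X - z over the orbit of a root b is fixed by the Frobenius, so
    it comes from a polynomial over F vanishing at b, which Q divides. *)
Lemma irr_rts Q b : Q \is monic -> irreducible_poly Q -> b \in rts Q ->
  [/\ perm_eq (rts Q) (traject frobq b (size Q).-1), uniq (traject frobq b (size Q).-1)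
    & iter (size Q).-1 frobq b = b].
Proof.
move=> mQ iQ bQ; set k := (size Q).-1.
have itQ j : iter j frobq b \in rts Q.
  elim: j => [//|j IH]; rewrite iterS (perm_mem (rts_frob iota charF mQ)).
  exact: map_f.
have inj_it m : injective (iter m frobq).
  by elim: m => [|m IH] x y //= /(frobq_inj (iota := iota)) /IH.
have [m m0 Em] : exists2 m, (0 < m)%N & iter m frobq b = b.
  have : ~~ uniq (traject frobq b k.+1).
    apply/negP => u; have := uniq_leq_size u (_ : {subset _ <= rts Q}).
    rewrite size_traject size_rts // ltnn => H; apply: (notF (H _)) => x /trajectP[j _ ->].
    exact: itQ.
  case/(uniqPn b) => i [j [ij]]; rewrite size_traject => jk.
  rewrite !nth_traject ?(ltn_trans ij) // => E.
  exists (j - i)%N; first by rewrite subn_gt0.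
  by apply: (inj_it i); rewrite -iterD subnKC ?(ltnW ij).
have exm : exists m, (0 < m)%N && (iter m frobq b == b).
  by exists m; rewrite m0 Em eqxx.
case: (ex_minnP exm) => k' /andP[k'0 /eqP Ek'] mink'.
have uk' : uniq (traject frobq b k').
  apply: contraT => /(uniqPn b) [i [j [ij]]]; rewrite size_traject => jk.
  rewrite !nth_traject ?(ltn_trans ij) // => E.
  have := mink' (j - i)%N; rewrite subn_gt0 ij /=.
  have -> : iter (j - i) frobq b = b by apply: (inj_it i); rewrite -iterD subnKC ?(ltnW ij).
  by rewrite eqxx => /(_ isT); lia.
have sub : {subset traject frobq b k' <= rts Q} by move=> x /trajectP[j _ ->].
have [R0 ER] : exists R0 : {poly F}, \prod_(z <- traject frobq b k') ('X - z%:P) = R0^i.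
  apply: frobq_fixed_poly; rewrite map_prod_XsubC -(big_map frobq predT (fun z => 'X - z%:P)).
  exact: perm_big (perm_traject_loop Ek').
have QR : Q %| R0.
  apply: (@irr_gcd_root _ _ b) => //; first by rewrite -mem_rts.
  by rewrite -ER root_prod_XsubC; apply/trajectP; exists 0%N.
have R0nz : R0 != 0.
  by rewrite -(map_poly_eq0 iota) -ER monic_neq0 // monic_prod_XsubC.
have kk' : (k <= k')%N.
  have := dvdp_leq R0nz QR; rewrite -[size R0](size_map_poly iota) -ER size_prod_XsubC size_traject /k.
  by case: (size Q).
have ek : k' = k.
  apply/eqP; rewrite eqn_leq kk' andbT; have := uniq_leq_size uk' sub.
  by rewrite size_traject size_rts.
rewrite -ek; split=> //; rewrite perm_sym.
have ss : (size (rts Q) <= size (traject frobq b k'))%N by rewrite size_traject size_rts // -/k ek.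
apply: uniq_perm => //; first exact: (leq_size_uniq uk' sub ss).
by have [_ H] := uniq_min_size uk' sub ss.
Qed.

Lemma irr_has_root Q : Q \is monic -> irreducible_poly Q -> exists b, b \in rts Q.
Proof.
move=> mQ [sQ _]; have := size_rts iota mQ.
by case: (rts Q) => [|b t _] /=; [case: (size Q) sQ => [|[]] | exists b; rewrite mem_head].
Qed.

(** The sign relating the symbol (f'/f), for f monic of degree N, to mu(f). *)
Definition pellet_sign (N : nat) : int := (-1) ^+ (N + hq * 'C(N, 2)).

Definition pellet f := pellet_sign (size f).-1 * jac f^`() f.

Lemma res_deriv f : f \is monic -> res f f^`() = (-1) ^+ 'C((size f).-1, 2) * vdm (rts f) ^+ 2.
Proof.
move=> mf; rewrite -(size_rts iota mf) -prod_deriv_roots -rtsE // /root_res.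
by apply: eq_bigr => b _; rewrite deriv_map.
Qed.

Lemma perm_vdm_sq (s t : seq K) : perm_eq s t -> vdm s ^+ 2 = vdm t ^+ 2.
Proof.
move=> p; apply: (mulfI (x := (-1) ^+ 'C(size s, 2))); first by rewrite signr_eq0.
rewrite -prod_deriv_roots (perm_size p) -prod_deriv_roots (perm_big _ p) /=.
by apply: eq_bigr => x _; rewrite (perm_big _ p).
Qed.

(** The Frobenius permutes the k roots cyclically, so it multiplies their
    Vandermonde product by (-1)^(k-1); hence the discriminant is a square in F
    exactly when k is odd. *)
Lemma pellet_irr Q : Q \is monic -> irreducible_poly Q -> pellet Q = -1.
Proof.
move=> mQ iQ; have [b bQ] := irr_has_root mQ iQ.
have [p u loop] := irr_rts mQ iQ bQ.
rewrite /pellet /jacobi res_deriv // (perm_vdm_sq p).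
set k := (size Q).-1 in p u loop *.
have k0 : (0 < k)%N by case: iQ => + _; rewrite /k; case: (size Q) => [|[]].
have E : (vdm (traject frobq b k) ^+ 2) ^+ hq = (-1) ^+ k.-1.
  apply: (mulIf (vdm_neq0 u)); rewrite -exprM -exprSr mul2n -cardF.
  rewrite -[LHS]/(frobq _) vdm_map map_traject_self.
  case: k k0 loop {p u} => [//|k] _ loop.
  rewrite trajectSr -iterSr loop vdm_rot size_traject //=.
rewrite exprMn E -exprM -exprD (sgnK_sign iota cardF charF) /pellet_sign -exprD.
rewrite -signr_odd !oddD oddM [in X in _ (+) X]oddM.
by case: k k0 {p u loop E} => [//|k _] /=; case: (odd k); case: (odd hq); case: (odd 'C(_, _)).
Qed.

Lemma jac_sq f g : g \is monic -> jac f g ^+ 2 = (coprimep f g)%:R.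
Proof.
move=> mg; have := jac_eq0 iota cardF f mg.
by case: (jac_values iota hq f g) => ->; case: (coprimep f g).
Qed.

(** Modulo f the derivative of f g is f' g, so the two cross symbols (g/f) and
    (f/g) appear; reciprocity merges them into a square, and the sign it
    produces is the one by which [pellet_sign] fails to be multiplicative. *)
Lemma pelletM f g : f \is monic -> g \is monic ->
  pellet (f * g) = pellet f * pellet g * (coprimep f g)%:R.
Proof.
move=> mf mg; have mfg : f * g \is monic by rewrite monicMl.
rewrite /pellet (jacMr iota cardF charF) // derivM.
have -> : jac (f^`() * g + f * g^`()) f = jac f^`() f * jac g f.
  rewrite -(jacMl iota cardF charF) //; apply: jac_mod => //.
  by rewrite addrC addKr dvdp_mulr.
have -> : jac (f^`() * g + f * g^`()) g = jac f g * jac g^`() g.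
  rewrite -(jacMl iota cardF charF) //; apply: jac_mod => //.
  by rewrite addrK dvdp_mull.
rewrite (jac_recip iota cardF charF mg mf) -(jac_sq f mg).
have -> : (size (f * g)).-1 = ((size f).-1 + (size g).-1)%N.
  rewrite size_monicM ?monic_neq0 //.
  have := monic_neq0 mf; have := monic_neq0 mg; rewrite -!size_poly_gt0.
  by case: (size f) => [|a] //; case: (size g) => [|b] //= _ _; rewrite addnS.
set x := (size f).-1; set y := (size g).-1.
have -> : pellet_sign (x + y) = pellet_sign x * pellet_sign y * (-1) ^+ (y * x * hq).
  rewrite /pellet_sign -!exprD; congr (_ ^+ _).
  have -> : 'C(x + y, 2) = ('C(x, 2) + 'C(y, 2) + x * y)%N.
    elim: x => [|x IH]; first by rewrite add0n bin0n mul0n addn0.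
    rewrite addSn !binS !bin1 IH; lia.
  ring.
have sq1 : (-1) ^+ (y * x * hq) * (-1) ^+ (y * x * hq) = 1 :> int.
  by rewrite -exprD addnn -signr_odd odd_double.
transitivity (pellet_sign x * pellet_sign y * jac f^`() f * jac g^`() g * jac f g ^+ 2 * ((-1) ^+ (y * x * hq) * (-1) ^+ (y * x * hq))).
  by ring.
by rewrite sq1; ring.
Qed.

(** Euler's criterion in the residue field F(b), whose order is 2H + 1. *)
Lemma jac_irr_root w Q b H : Q \is monic -> irreducible_poly Q -> b \in rts Q ->
  (q ^ (size Q).-1 = H.*2.+1)%N -> jac w Q = sgnK (w^i.[b] ^+ H).
Proof.
move=> mQ iQ bQ EH; rewrite /jacobi; congr sgnK.
have [p _ _] := irr_rts mQ iQ bQ.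
rewrite /root_res (perm_big _ p) /=.
move: (size Q).-1 EH => k EH {p}.
have -> : \prod_(z <- traject frobq b k) w^i.[z] = w^i.[b] ^+ (\sum_(j < k) q ^ j).
  elim: k {EH} => [|k IH]; first by rewrite big_nil big_ord0.
  rewrite trajectSr -cats1 big_cat big_seq1 IH big_ord_recr exprD /=; congr (_ * _).
  elim: k {IH} => [|k IH]; first by rewrite expn0 expr1.
  by rewrite iterS -frobq_horner IH /frobq_ -exprM expnSr.
rewrite -exprM; congr (_ ^+ _).
have := predn_exp q k; rewrite EH cardF /=; lia.
Qed.
End Irreducible.

(** * Complete character sums modulo an irreducible polynomial *)

Section Polys.
Variable F : finFieldType.

Definition polys (n : nat) : seq {poly F} := [seq rVpoly v | v : 'rV[F]_n].

Lemma polys_uniq n : uniq (polys n).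
Proof. by rewrite map_inj_uniq ?enum_uniq //; exact: can_inj rVpolyK. Qed.

Lemma mem_polys n p : (p \in polys n) = (size p <= n)%N.
Proof.
apply/mapP/idP => [[v _ ->]|H]; first exact: size_poly.
by exists (poly_rV p); rewrite ?mem_enum // poly_rV_K.
Qed.

Lemma size_polys n : size (polys n) = (#|F| ^ n)%N.
Proof. by rewrite size_map -cardE card_mx mul1n. Qed.

Lemma polysD n p r : p \in polys n -> r \in polys n -> p + r \in polys n.
Proof.
rewrite !mem_polys => Hp Hr; apply: leq_trans (size_polyD _ _) _.
by rewrite geq_max Hp.
Qed.

Lemma polysN n p : (- p \in polys n) = (p \in polys n).
Proof. by rewrite !mem_polys size_polyN. Qed.

Lemma polysB n p r : p \in polys n -> r \in polys n -> p - r \in polys n.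
Proof. by move=> Hp Hr; rewrite polysD // polysN. Qed.

Lemma sum_polys_shift (V : nmodType) n c (G : {poly F} -> V) : c \in polys n ->
  \sum_(z <- polys n) G (z + c) = \sum_(z <- polys n) G z.
Proof.
move=> Hc; rewrite -(big_map (fun z => z + c) predT G) /=; apply: perm_big.
apply: uniq_perm; [|exact: polys_uniq|].
  by rewrite map_inj_uniq ?polys_uniq // => x y /addIr.
move=> z; apply/mapP/idP => [[y Hy ->]|Hz]; first exact: polysD.
by exists (z - c); rewrite ?polysB // subrK.
Qed.
End Polys.

Lemma sum_sgn_count (T : eqType) (s : seq T) (G : T -> int) :
  (forall z, [\/ G z = 0, G z = 1 | G z = -1]) ->
  \sum_(z <- s) G z = (count (fun z => G z == 1) s)%:Z - (count (fun z => G z == -1) s)%:Z.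
Proof.
move=> H; elim: s => [|z s IH]; first by rewrite big_nil.
rewrite big_cons IH /=.
by case: (H z) => -> /=; lia.
Qed.

Lemma count_sgn_size (T : eqType) (s : seq T) (G : T -> int) :
  (forall z, [\/ G z = 0, G z = 1 | G z = -1]) ->
  (count (fun z => G z == 1%R) s + count (fun z => G z == (-1)%R) s + count (fun z => G z == 0%R) s)%N = size s.
Proof.
move=> H; elim: s => //= z s IH.
by case: (H z) => -> /=; lia.
Qed.

Lemma floor_sqrt_scaled c X : (0 < c)%N -> exists w, (w * w * c <= X < w.+1 * w.+1 * c)%N.
Proof.
move=> c0; have ex0 : exists w, (w * w * c <= X)%N by exists 0%N.
have b w : (w * w * c <= X)%N -> (w <= X)%N by nia.
case: (ex_maxnP ex0 b) => w Hw mx; exists w; rewrite Hw ltnNge.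
by apply/negP => /mx; rewrite ltnn.
Qed.

(** A constant for the square of a complete sum; only its independence of the
    field matters. *)
Definition weilC (m : nat) := (72 * m * m + (2 * m + 1) ^ 2 * (34 * m + 17) + 10 * m + 5)%N.

(** Upper bounds for the numbers N1 and N2 of values 1 and -1 suffice for a
    bound on their difference, since N1 + N2 is almost Q. *)
Lemma weil_numeric m Q H N1 N2 N0 : Q = H.*2.+1 -> (N1 + N2 + N0)%N = Q -> (N0 <= m.*2)%N ->
  (forall w N, (0 < w)%N -> (w * (4 * m * w + w + 1) + m <= H)%N -> N = N1 \/ N = N2 ->
    (w.*2 * N <= w * Q + 4 * w * m + H + 2 * m * H)%N) ->
  (`|(N1%:Z - N2%:Z)%R| ^ 2 <= weilC m * Q)%N.
Proof.
move=> EQ EN HN0 Hw.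
set S := `|_|%N.
have SQ : (S <= Q)%N by rewrite /S; lia.
have Q0 : (0 < Q)%N by rewrite EQ.
case: (leqP (5 * m + 2) H) => HH; last first.
  have Q1 : (Q <= 10 * m + 5)%N by lia.
  apply: (@leq_trans (Q * Q)); first by rewrite -mulnn leq_mul.
  rewrite leq_mul2r; apply/orP; right; apply: leq_trans Q1 _; rewrite /weilC; lia.
(* After division by w the error terms are of order m and m H / w, so w should
   be as large as the hypothesis permits, which is of order sqrt (H / m). *)
have [w /andP[w1 w2]] := @floor_sqrt_scaled (4 * m + 2) (H - m) ltac:(lia).
have w0 : (0 < w)%N by case: w w2 {w1} => // ; lia.
have Hc : (w * (4 * m * w + w + 1) + m <= H)%N.
  have : (w <= w * w)%N by nia.
  nia.
have A1 := Hw w N1 w0 Hc (or_introl erefl).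
have A2 := Hw w N2 w0 Hc (or_intror erefl).
have Sb : (w * S * 2 <= 12 * w * m + (2 * m + 1) * Q)%N.
  have A3 : (w.*2 * N1 + w.*2 * N2 + w.*2 * N0 = w.*2 * Q)%N by rewrite -!mulnDr EN.
  have A4 : (w.*2 * N0 <= w.*2 * m.*2)%N by rewrite leq_mul2l HN0 orbT.
  have A5 : (w * S * 2 <= w.*2 * N1 - w.*2 * N2 \/ w * S * 2 <= w.*2 * N2 - w.*2 * N1)%N.
    case: (leqP N1 N2) => C; [right|left]; rewrite -mulnBr -muln2 mulnAC leq_mul2l /S; lia.
  have -> : (12 * w * m + (2 * m + 1) * Q = 12 * (w * m) + 4 * (m * H) + 2 * m + 2 * H + 1)%N.
    by rewrite EQ; clear; lia.
  have D3 : (w.*2 * Q = 2 * (w * Q))%N by clear; lia.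
  have D4 : (w.*2 * m.*2 = 4 * (w * m))%N by clear; lia.
  rewrite D3 in A3; rewrite D4 in A4; move: A1 A2 A3 A4 A5; rewrite -!mulnA.
  move: (w.*2 * N1)%N (w.*2 * N2)%N (w.*2 * N0)%N (w * Q)%N (w * m)%N (m * H)%N (w * (S * 2))%N.
  by clear; lia.
have QC : (Q <= (34 * m + 17) * (w * w))%N.
  have w2w : (w.+1 <= 2 * w)%N by move: w0; clear; lia.
  have V : (w.+1 * w.+1 * (4 * m + 2) <= 4 * (w * w) * (4 * m + 2))%N.
    rewrite leq_mul2r; apply/orP; right; apply: leq_trans (leq_mul w2w w2w) _.
    by rewrite mulnACA.
  have W1 : (1 <= w * w)%N by rewrite muln_gt0 w0.
  have Wm : (m <= w * w * m)%N by rewrite leq_pmull.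
  have -> : ((34 * m + 17) * (w * w) = 34 * (w * w * m) + 17 * (w * w))%N by clear; lia.
  have V2 : (4 * (w * w) * (4 * m + 2) = 16 * (w * w * m) + 8 * (w * w))%N by clear; lia.
  rewrite V2 in V; move: w2 V W1 Wm HH; rewrite EQ.
  move: (w.+1 * w.+1 * (4 * m + 2))%N (w * w * m)%N (w * w)%N => x y z; clear; lia.
have S2 : (w * w * 4 * S ^ 2 <= 288 * (w * w) * m * m + 2 * (2 * m + 1) ^ 2 * (Q * Q))%N.
  have E1 : (w * w * 4 * S ^ 2 = (w * S * 2) ^ 2)%N by rewrite -!mulnn; lia.
  rewrite E1; apply: (@leq_trans ((12 * w * m + (2 * m + 1) * Q) ^ 2)); first by rewrite leq_exp2r.
  have [+ _] := nat_Cauchy (12 * w * m) ((2 * m + 1) * Q).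
  have -> : (288 * (w * w) * m * m + 2 * (2 * m + 1) ^ 2 * (Q * Q) =
    2 * ((12 * w * m) ^ 2 + ((2 * m + 1) * Q) ^ 2))%N by rewrite -!mulnn; lia.
  move: (12 * w * m)%N ((2 * m + 1) * Q)%N => u v; rewrite sqrnD.
  move: (2 * (u * v))%N (u ^ 2)%N (v ^ 2)%N; lia.
have QQ : (Q * Q <= (34 * m + 17) * (w * w) * Q)%N by exact: leq_mul QC (leqnn Q).
have ww : (0 < w * w * 4)%N by rewrite !muln_gt0 w0.
rewrite -(leq_pmul2l ww); apply: leq_trans S2 _.
have H1 : (2 * (2 * m + 1) ^ 2 * (Q * Q) <= 2 * (2 * m + 1) ^ 2 * ((34 * m + 17) * (w * w) * Q))%N by exact: leq_mul (leqnn _) QQ.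
have H2 : (m * m * (w * w) <= m * m * (w * w) * Q)%N by rewrite leq_pmulr.
rewrite /weilC; move: H1 H2; rewrite -!mulnn; move: (w * w)%N => W H1 H2; lia.
Qed.

Section Weil.
Variables (F : finFieldType) (K : closedFieldType) (iota : {rmorphism F -> K}).
Variable hq : nat.
Hypothesis cardF : #|F| = hq.*2.+1.
Hypothesis charF : [pchar F].-nat #|F|.
Local Notation q := #|F|.
Local Notation "p ^i" := (map_poly iota p) (at level 2, format "p ^i").
Local Notation frobq := (frobq_ charF iota).
Local Notation rts := (rts iota).
Local Notation jac := (jacobi iota hq).

Lemma iter_frobq k x : iter k frobq x = x ^+ (q ^ k).
Proof. by elim: k => [|k IH]; rewrite ?expr1 // iterS IH /frobq_ -exprM expnSr. Qed.

Lemma iter_map_frobq k (p : {poly K}) i :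
  (iter k (map_poly frobq) p)`_i = iter k frobq p`_i.
Proof. by elim: k => // k IH; rewrite !iterS coef_map IH. Qed.

Lemma iter_map_frobq_prod k (cs : seq K) :
  iter k (map_poly frobq) (\prod_(c <- cs) ('X - c%:P)) =
  \prod_(c <- cs) ('X - (iter k frobq c)%:P).
Proof.
elim: k => [//|k IH]; rewrite iterS IH map_prod_XsubC.
by [].
Qed.

(** Stepanov's bound applies in the residue field, embedded in K by sending z to
    its value at a root b of Q, with f the product of the X + y(b). The
    element x occurring exactly once in v provides the root of odd
    multiplicity, without which the product could be a square and the
    sum could have no cancellation. *)
Lemma weil_sum (Q : {poly F}) (v : seq {poly F}) (m : nat) (x : {poly F}) :
  Q \is monic -> irreducible_poly Q ->
  {in v, forall y : {poly F}, (size y < size Q)%N} -> size v = m.*2 -> count_mem x v = 1%N ->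
  (`|(\sum_(z <- polys F (size Q).-1) jac (\prod_(y <- v) (z + y)) Q)%R| ^ 2
     <= weilC m * q ^ (size Q).-1)%N.
Proof.
move=> mQ iQ Hv szv cx; have [b bQ] := irr_has_root iota mQ iQ.
have [_ _ loop] := irr_rts cardF charF mQ iQ bQ.
have sQ : (1 < size Q)%N by case: iQ.
set k := (size Q).-1 in loop *.
have evK (p : {poly F}) : iter k frobq p^i.[b] = p^i.[b].
  rewrite -[in RHS]loop; elim: k {loop} => [//|k IH]; by rewrite !iterS IH frobq_horner.
have ev_inj (y z : {poly F}) : (size y < size Q)%N -> (size z < size Q)%N -> y^i.[b] = z^i.[b] -> y = z.
  move=> sy sz E; apply/eqP; rewrite -subr_eq0.
  apply: contraT => nz; have := @irr_gcd_root _ _ iota (y - z) Q b iQ.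
  rewrite -mem_rts // bQ /root rmorphB hornerD hornerN E subrr eqxx => /(_ isT isT) /(dvdp_leq nz).
  move=> H; have := leq_trans H (size_polyD y (- z)).
  by rewrite size_polyN leq_max => /orP[]; rewrite leqNgt ?sy ?sz.
have [H EH] : exists H, (q ^ k = H.*2.+1)%N.
  have oq : odd (q ^ k) by rewrite oddX cardF /= odd_double orbT.
  by exists (q ^ k)./2; rewrite -[LHS]odd_double_half oq.
pose cs := [seq - y^i.[b] | y <- v]; pose f := \prod_(c <- cs) ('X - c%:P).
have fE z : f.[z^i.[b]] = (\prod_(y <- v) (z + y))^i.[b].
  rewrite rmorph_prod /= !horner_prod big_map; apply: eq_bigr => y _.
  by rewrite hornerXsubC opprK rmorphD hornerD.
have sizef : size f = m.*2.+1 by rewrite size_prod_XsubC size_map szv.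
have xv : x \in v by rewrite -has_pred1 has_count cx.
have simplef : odd (mup (- x^i.[b]) f).
  rewrite mu_prod_XsubC (_ : count _ cs = 1%N) // -[RHS]cx count_map.
  apply: eq_in_count => y yv /=; rewrite eqr_opp; apply/eqP/eqP => [|-> //].
  by apply: ev_inj; apply: Hv.
have frobf i : f`_i ^+ (q ^ k) = f`_i.
  rewrite -iter_frobq -iter_map_frobq; suff -> : iter k (map_poly frobq) f = f by [].
  rewrite iter_map_frobq_prod /f !big_map; apply: eq_bigr => y _; congr ('X - _%:P).
  have -> : - y^i.[b] = (- y)^i.[b] by rewrite rmorphN hornerN.
  exact: evK.
pose G z := jac (\prod_(y <- v) (z + y)) Q.
have GE z : G z = sgnK (f.[z^i.[b]] ^+ H) by rewrite fE /G (jac_irr_root cardF charF _ mQ iQ bQ EH).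
have Gv z : [\/ G z = 0, G z = 1 | G z = -1] by exact: jac_values.
rewrite (sum_sgn_count _ Gv).
apply: (weil_numeric (H := H) (N0 := count (fun z => G z == 0) (polys F k))).
- exact: EH.
- by rewrite count_sgn_size // size_polys.
- rewrite -size_filter -(size_map (fun z : {poly F} => z^i.[b])).
  rewrite -ltnS -sizef; apply: max_poly_roots.
  + by rewrite monic_neq0 // monic_prod_XsubC.
  + apply/allP => _ /mapP[z + ->]; rewrite mem_filter GE /sgnK => /andP[+ _].
    case: (eqVneq (f.[z^i.[b]] ^+ H) 0) => [/eqP|_]; last by case: ifP.
    by rewrite expf_eq0 => /andP[_].
  + rewrite map_inj_in_uniq ?filter_uniq ?polys_uniq // => y z.
    rewrite !mem_filter !mem_polys => /andP[_ sy] /andP[_ sz].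
    by apply: ev_inj; rewrite -[size Q]prednK ?ltnS // ltnW.
move=> w N w0 Hw HN.
have St a (P : pred {poly F}) : (forall z, P z -> f.[z^i.[b]] ^+ H = a) ->
   (w.*2 * count P (polys F k) <= w * q ^ k + 4 * w * m + H + 2 * m * H)%N.
  move=> HP; rewrite -size_filter -(size_map (fun z : {poly F} => z^i.[b])).
  apply: (stepanov_bound _ EH (monic_prod_XsubC _ _ _) sizef frobf simplef w0 Hw).
  + by rewrite pnatX (charK iota charF).
  + rewrite map_inj_in_uniq ?filter_uniq ?polys_uniq // => y z.
    rewrite !mem_filter !mem_polys => /andP[_ sy] /andP[_ sz].
    by apply: ev_inj; rewrite -[size Q]prednK ?ltnS // ltnW.
  + move=> _ /mapP[z + ->]; rewrite mem_filter => /andP[Pz _]; split; last exact: HP.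
    by rewrite -iter_frobq evK.
have sg z : is_sgn (f.[z^i.[b]] ^+ H).
  have Hx : (f.[z^i.[b]]) ^+ (q ^ k) = f.[z^i.[b]] by rewrite fE -iter_frobq evK.
  rewrite /is_sgn; case: (eqVneq f.[z^i.[b]] 0) => [->|x0].
    by rewrite expr0n; case: (H == 0)%N; rewrite ?mulr1n ?mulr0n eqxx ?orbT.
  rewrite -eqf_sqr expr1n -exprM muln2.
  suff -> : f.[z^i.[b]] ^+ H.*2 = 1 by rewrite eqxx orbT.
  by apply: (mulfI x0); rewrite mulr1 -exprS -EH.
case: HN => ->.
  apply: (St 1) => z; rewrite GE /sgnK.
  case: (eqVneq (f.[z^i.[b]] ^+ H) 0) => // _.
  by case: (eqVneq (f.[z^i.[b]] ^+ H) 1).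
apply: (St (-1)) => z; rewrite GE /sgnK; have := sg z; rewrite /is_sgn.
case: (eqVneq (f.[z^i.[b]] ^+ H) 0) => //= _.
by case: (eqVneq (f.[z^i.[b]] ^+ H) 1) => //= _ /eqP.
Qed.
End Weil.

(** * Squarefree moduli *)

Section CRT.
Variable F : finFieldType.
Local Notation q := #|F|.
Implicit Types M z : {poly F}.

(** Reduction modulo M1 and M2 is injective on polynomials of size at most the
    degree of M1 M2, hence bijective by counting. *)
Lemma crt_sum M1 M2 (phi1 phi2 : {poly F} -> int) :
  M1 != 0 -> M2 != 0 -> coprimep M1 M2 ->
  (forall x y, M1 %| x - y -> phi1 x = phi1 y) ->
  (forall x y, M2 %| x - y -> phi2 x = phi2 y) ->
  \sum_(z <- polys F ((size M1).-1 + (size M2).-1)) phi1 z * phi2 z =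
  (\sum_(z <- polys F (size M1).-1) phi1 z) * (\sum_(z <- polys F (size M2).-1) phi2 z).
Proof.
move=> M10 M20 cop H1 H2.
set d1 := (size M1).-1; set d2 := (size M2).-1.
pose rd z := (z %% M1, z %% M2).
have modE M z : M %| z - z %% M by rewrite {1}(divp_eq z M) addrK dvdp_mull.
have szm M z : M != 0 -> z %% M \in polys F (size M).-1.
  move=> M0; rewrite mem_polys -ltnS prednK ?size_poly_gt0 //.
  by rewrite ltn_modp.
pose pr := [seq (x, y) | x <- polys F d1, y <- polys F d2].
have inj : {in polys F (d1 + d2) &, injective rd}.
  move=> x y Hx Hy [E1 E2]; apply/eqP; rewrite -subr_eq0; apply: contraT => nz.
  have D1 : M1 %| x - y by rewrite /dvdp modpD modpN E1 subrr.
  have D2 : M2 %| x - y by rewrite /dvdp modpD modpN E2 subrr.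
  have D : M1 * M2 %| x - y by rewrite Gauss_dvdp // D1.
  have := polysB Hx Hy; rewrite mem_polys => Hs.
  have := leq_trans (dvdp_leq nz D) Hs; rewrite size_mul //.
  by move: M10 M20; rewrite -!size_poly_gt0 /d1 /d2; case: (size M1) => [|a] //; case: (size M2) => [|b] // _ _; rewrite addSn addnS /= ltnn.
have um : uniq (map rd (polys F (d1 + d2))) by rewrite map_inj_in_uniq ?polys_uniq.
have sub : {subset map rd (polys F (d1 + d2)) <= pr}.
  by move=> _ /mapP[z _ ->]; apply: allpairs_f; apply: szm.
have sz : (size pr <= size (map rd (polys F (d1 + d2))))%N.
  by rewrite size_allpairs size_map !size_polys expnD.
have pe : perm_eq (map rd (polys F (d1 + d2))) pr.
  apply: uniq_perm => //; first exact: leq_size_uniq um sub sz.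
  by have [_ H] := uniq_min_size um sub sz.
transitivity (\sum_(xy <- pr) phi1 xy.1 * phi2 xy.2).
  rewrite -[RHS](perm_big _ pe) [RHS]big_map /=; apply: eq_bigr => z _ /=.
  by rewrite -(H1 _ _ (modE M1 z)) -(H2 _ _ (modE M2 z)).
rewrite big_allpairs /= mulr_suml; apply: eq_bigr => x _.
by rewrite mulr_sumr.
Qed.

Definition degs (t : seq {poly F}) := (\sum_(Q <- t) (size Q).-1)%N.

Definition monirr (Q : {poly F}) := (Q \is monic) && irreducibleb Q.

Lemma monirrP Q : reflect (Q \is monic /\ irreducible_poly Q) (monirr Q).
Proof. by apply: (iffP andP) => [[mQ /irreducibleP iQ]|[mQ /irreducibleP iQ]]. Qed.

Lemma monirr_monic Q : monirr Q -> Q \is monic. Proof. by case/andP. Qed.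

Lemma monirr_coprime Q1 Q2 : monirr Q1 -> monirr Q2 -> Q1 != Q2 -> coprimep Q1 Q2.
Proof.
move=> /monirrP[m1 i1] /monirrP[m2 i2] ne; rewrite irreducible_poly_coprime //.
apply: contra ne => d; rewrite -eqp_monic //; apply: i2 => //.
by case: i1 => + _; rewrite neq_ltn => ->; rewrite orbT.
Qed.

Lemma monirr_coprime_prod Q t : monirr Q -> all monirr t -> Q \notin t ->
  coprimep Q (\prod_(R <- t) R).
Proof.
move=> mQ; elim: t => [|R t IH] /=; first by rewrite big_nil coprimep1.
move=> /andP[mR mt]; rewrite inE negb_or => /andP[QR Qt].
by rewrite big_cons coprimepMr monirr_coprime // IH.
Qed.

Lemma monic_prod_all t : all monirr t -> \prod_(R <- t) R \is monic.
Proof.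
move=> /allP H; rewrite big_seq; apply: monic_prod => R Rt.
by apply: monirr_monic; apply: H.
Qed.

Lemma size_prod_degs t : all monirr t -> (size (\prod_(R <- t) R)).-1 = degs t.
Proof.
rewrite /degs; elim: t => [|Q t IH] /=; first by rewrite !big_nil size_poly1.
move=> /andP[mQ mt]; rewrite !big_cons -IH // size_monicM ?monirr_monic //; last first.
  by rewrite monic_neq0 // monic_prod_all.
have := monic_neq0 (monirr_monic mQ); have := monic_neq0 (monic_prod_all mt).
by rewrite -!size_poly_gt0; case: (size Q) => [|a] //; case: (size _) => [|b] // _ _; rewrite addSn addnS.
Qed.

Lemma crt_sum_prod t (phi : {poly F} -> {poly F} -> int) :
  uniq t -> all monirr t ->
  {in t, forall Q x y, Q %| x - y -> phi Q x = phi Q y} ->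
  \sum_(z <- polys F (degs t)) \prod_(Q <- t) phi Q z =
  \prod_(Q <- t) \sum_(z <- polys F (size Q).-1) phi Q z.
Proof.
elim: t => [|Q t IH] /=.
  move=> _ _ _; rewrite big_nil /degs big_nil.
  under eq_bigr => z _ do rewrite big_nil.
  by rewrite big_const_seq count_predT size_polys.
move=> /andP[Qt ut] /andP[mQ mt] H; rewrite big_cons -IH //; last first.
  by move=> R Rt; apply: H; rewrite inE Rt orbT.
rewrite /degs big_cons -/(degs t) -(size_prod_degs mt).
rewrite -crt_sum ?monic_neq0 ?monic_prod_all ?monirr_monic ?monirr_coprime_prod //.
- by apply: eq_bigr => z _; rewrite big_cons.
- by apply: H; rewrite mem_head.
- move=> x y D; apply: eq_big_seq => R Rt; apply: H; first by rewrite inE Rt orbT.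
  by apply: dvdp_trans D; rewrite (big_rem R) //= dvdp_mulr.
Qed.
End CRT.

(** * Moments of short character sums *)

Section Tuples.
Variable T : eqType.
Implicit Types (s v : seq T).

Fixpoint tups s n : seq (seq T) :=
  if n is m.+1 then [seq x :: v | x <- s, v <- tups s m] else [:: [::]].

Lemma size_tups s n : size (tups s n) = (size s ^ n)%N.
Proof. by elim: n => //= n IH; rewrite size_allpairs IH expnS. Qed.

Lemma mem_tups s n v : (v \in tups s n) = (size v == n) && all (mem s) v.
Proof.
elim: n v => [|n IH] [|x v] //=.
  by apply/allpairsP => -[[y w]] [].
apply/allpairsP/idP => [[[y w] /= [ys wt [-> ->]]]|/andP[sv /andP[xs av]]].
  by move: wt; rewrite IH eqSS => /andP[-> ->]; rewrite andbT; exact: ys.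
by exists (x, v); split=> //=; rewrite IH -eqSS sv.
Qed.

Lemma tups_uniq s n : uniq s -> uniq (tups s n).
Proof.
move=> us; elim: n => //= n IH; apply: allpairs_uniq => // -[x v] [y w] _ _ /= [-> ->] //.
Qed.

Lemma expr_sum_tups (R : comNzRingType) (G : T -> R) s n :
  (\sum_(x <- s) G x) ^+ n = \sum_(v <- tups s n) \prod_(y <- v) G y.
Proof.
elim: n => [|n IH] /=; first by rewrite big_seq1 big_nil.
rewrite big_allpairs_dep /= exprS IH mulr_suml; apply: eq_bigr => x _.
by rewrite mulr_sumr; apply: eq_bigr => v _; rewrite big_cons.
Qed.

Definition no_single v := all (fun x => count_mem x v != 1%N) v.

Lemma sum_count_mem_uniq s v : uniq s -> {subset v <= s} ->
  size v = (\sum_(x <- s) count_mem x v)%N.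
Proof.
move=> us; elim: v => [|y v IH] /= H; first by rewrite big1.
rewrite big_split /= -IH => [|x xv]; last by apply: H; rewrite inE xv orbT.
have -> : (\sum_(x <- s) (y == x) = count_mem y s)%N.
  rewrite -sum1_count [RHS]big_mkcond /=; apply: eq_bigr => x _.
  by rewrite eq_sym; case: eqP.
by rewrite count_uniq_mem // H ?mem_head.
Qed.

Lemma size_undup_no_single v : no_single v -> (2 * size (undup v) <= size v)%N.
Proof.
move=> /allP H.
have -> : size v = (\sum_(x <- undup v) count_mem x v)%N.
  by apply: sum_count_mem_uniq; rewrite ?undup_uniq // => x; rewrite mem_undup.
rewrite -sum1_size big_distrr /= [X in (_ <= X)%N]big_seq [X in (X <= _)%N]big_seq.
apply: leq_sum => x; rewrite mem_undup => xv; have := H x xv.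
have : (0 < count_mem x v)%N by rewrite -has_count has_pred1.
by move: (count_mem x v) => [|[|c]].
Qed.

End Tuples.

(** A tuple in which no entry occurs exactly once has at most r distinct
    entries: it is given by a list of r elements and a function from the 2r
    positions to this list. *)
Lemma count_no_single (T : eqType) (s : seq T) r : uniq s -> s != [::] ->
  (count (@no_single T) (tups s (2 * r)) <= size s ^ r * r ^ (2 * r))%N.
Proof.
move=> us s0; rewrite -size_filter.
case: s us s0 => // x0 s us _; set S := x0 :: s.
pose im := [seq [seq nth x0 w i | i <- idx] | w <- tups S r, idx <- tups (iota 0 r) (2 * r)].
have <- : size im = (size S ^ r * r ^ (2 * r))%N.
  by rewrite size_allpairs !size_tups size_iota.
apply: uniq_leq_size; first by rewrite filter_uniq // tups_uniq.
move=> v; rewrite mem_filter mem_tups => /andP[ns /andP[/eqP sv /allP av]].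
have su : (size (undup v) <= r)%N by have := size_undup_no_single ns; rewrite sv; lia.
apply/allpairsP; exists (undup v ++ nseq (r - size (undup v)) x0, map (fun x => index x (undup v)) v).
split=> /=.
- rewrite mem_tups size_cat size_nseq subnKC // eqxx all_cat /=; apply/andP; split.
    by apply/allP => x; rewrite mem_undup => /av.
  by apply/allP => x /nseqP[-> _]; apply: mem_head.
- rewrite mem_tups size_map sv eqxx; apply/allP => _ /mapP[x xv ->] /=.
  by rewrite mem_iota add0n (leq_trans _ su) // index_mem mem_undup.
- rewrite -map_comp -[LHS]map_id; apply/eq_in_map => x xv /=.
  by rewrite nth_cat index_mem mem_undup xv nth_index // mem_undup.
Qed.

Lemma abs_sum_le (T : Type) (s : seq T) (G : T -> int) :
  (`|(\sum_(x <- s) G x)%R| <= \sum_(x <- s) `|G x|)%N.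
Proof.
elim: s => [|x s IH]; first by rewrite !big_nil.
have tri (u w : int) : (`|(u + w)%R| <= `|u| + `|w|)%N by lia.
by rewrite !big_cons; apply: leq_trans (tri _ _) (leq_add (leqnn _) IH).
Qed.

Lemma abs_prod_seq (T : Type) (s : seq T) (G : T -> int) :
  (`|(\prod_(x <- s) G x)%R| = \prod_(x <- s) `|G x|)%N.
Proof. by elim: s => [|x s IH]; rewrite ?big_nil // !big_cons abszM IH. Qed.

Section Moment.
Variables (F : finFieldType) (K : closedFieldType) (iota : {rmorphism F -> K}).
Variable hq : nat.
Hypothesis cardF : #|F| = hq.*2.+1.
Hypothesis charF : [pchar F].-nat #|F|.
Local Notation q := #|F|.
Local Notation jac := (jacobi iota hq).
Implicit Types (t : seq {poly F}) (w z : {poly F}).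

(** The symbol modulo the product of t, as a product over t itself so that the
    Chinese remainder theorem applies factor by factor. *)
Definition jacobi_prod t w : int := \prod_(Q <- t) jac w Q.

Local Notation chi := jacobi_prod.

Lemma chiM t a b : all (@monirr F) t -> chi t (a * b) = chi t a * chi t b.
Proof.
move=> /allP mt; rewrite -big_split; apply: eq_big_seq => Q /mt /monirr_monic mQ.
exact: jacMl.
Qed.

Lemma chi1 t : chi t 1 = 1.
Proof. by rewrite /jacobi_prod big1 // => Q _; rewrite jac1. Qed.

Lemma chi_prod t (v : seq {poly F}) : all (@monirr F) t ->
  chi t (\prod_(y <- v) y) = \prod_(y <- v) chi t y.
Proof.
by move=> mt; elim: v => [|y v IH]; rewrite ?big_nil ?chi1 // !big_cons chiM // IH.
Qed.

Lemma chi_mod t a b : all (@monirr F) t -> {in t, forall Q, Q %| a - b} -> chi t a = chi t b.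
Proof.
move=> /allP mt H; apply: eq_big_seq => Q Qt; apply: jac_mod; last exact: H.
exact: monirr_monic (mt _ Qt).
Qed.

Lemma chi_values t w : [\/ chi t w = 0, chi t w = 1 | chi t w = -1].
Proof.
elim: t => [|Q t IH]; first by constructor 2; rewrite /jacobi_prod big_nil.
rewrite /jacobi_prod big_cons -/(chi t w).
case: (jac_values iota hq w Q) => ->; case: IH => ->; rewrite ?mul0r ?mulr0 ?mul1r ?mulr1 ?mulrNN;
 by [constructor 1|constructor 2|constructor 3].
Qed.

Lemma abs_chi t w : (`|chi t w| <= 1)%N.
Proof. by case: (chi_values t w) => ->. Qed.

Lemma chi_cube t w : chi t w ^+ 3 = chi t w.
Proof. by case: (chi_values t w) => ->. Qed.

Lemma chi_unit t w : all (@monirr F) t -> {in t, forall Q, coprimep w Q} ->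
  `|chi t w|%N = 1%N.
Proof.
move=> /allP mt H.
suff : chi t w != 0 by case: (chi_values t w) => ->.
rewrite prodf_seq_neq0; apply/allP => Q Qt /=.
by rewrite (jac_eq0 iota cardF) ?(monirr_monic (mt _ Qt)) // H.
Qed.

(** Each prime modulus contributes a constant and a square-root saving. *)
Lemma complete_sum t (v : seq {poly F}) (m : nat) (x : {poly F}) :
  uniq t -> all (@monirr F) t ->
  {in t, forall Q : {poly F}, {in v, forall y : {poly F}, (size y < size Q)%N}} ->
  size v = m.*2 -> count_mem x v = 1%N ->
  (`|(\sum_(z <- polys F (degs t)) chi t (\prod_(y <- v) (z + y)))%R| ^ 2
     <= weilC m ^ size t * q ^ degs t)%N.
Proof.
move=> ut mt Hv sv cx.
rewrite /jacobi_prod (crt_sum_prod (phi := fun Q z => jac (\prod_(y <- v) (z + y)) Q)) //; last first.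
  move=> Q Qt a b D; apply: jac_mod; first exact: monirr_monic (allP mt _ Qt).
  elim: v {Hv sv cx} => [|y v IH]; first by rewrite !big_nil subrr dvdp0.
  rewrite !big_cons.
  set A := \prod_(i <- v) _; set B := \prod_(i <- v) _.
  have -> : (a + y) * A - (b + y) * B = (a - b) * A + (b + y) * (A - B) by ring.
  by apply: dvdp_add; [exact: dvdp_mulr | exact: dvdp_mull].
rewrite abs_prod_seq /degs.
elim: t ut mt Hv => [|Q t IH] /=; first by rewrite !big_nil.
move=> /andP[_ ut] /andP[/monirrP[mQ iQ] mt] Hv.
rewrite !big_cons expnMn expnD (expnS (weilC m)).
have H1 := weil_sum iota cardF charF mQ iQ (Hv Q (mem_head _ _)) sv cx.
rewrite [X in (_ <= X)%N]mulnACA; apply: leq_mul; first exact: H1.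
by apply: IH => // R Rt; apply: Hv; rewrite inE Rt orbT.
Qed.

Variables (t : seq {poly F}) (l r n0 : nat).
Hypothesis ut : uniq t.
Hypothesis mt : all (@monirr F) t.
Hypothesis lt : {in t, forall Q : {poly F}, (l < size Q)%N}.
Hypothesis szt : (size t <= n0)%N.
Local Notation b := (degs t).

Definition short_sum z := \sum_(y <- polys F l) chi t (z + y).

Local Notation shortsum := short_sum.

(** The first term bounds the contribution of tuples with no entry occurring
    exactly once, for which the complete sum is bounded trivially; the second
    that of the remaining tuples, for which [complete_sum] applies. *)
Definition momentB := (q ^ (l * r) * r ^ (2 * r) * q ^ b
   + q ^ (l * (2 * r)) * (weilC r ^ n0 * q ^ uphalf b))%N.

Lemma weilC_gt0 m : (0 < weilC m)%N. Proof. by rewrite /weilC !addnS. Qed.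

Lemma q_gt0 : (0 < q)%N. Proof. by rewrite cardF. Qed.

Lemma moment_bound : (0 < r)%N ->
  \sum_(z <- polys F b) shortsum z ^+ (2 * r) <= momentB%:Z.
Proof.
move=> r0.
pose S (v : seq {poly F}) := \sum_(z <- polys F b) chi t (\prod_(y <- v) (z + y)).
have -> : \sum_(z <- polys F b) shortsum z ^+ (2 * r) = \sum_(v <- tups (polys F l) (2 * r)) S v.
  rewrite /S exchange_big /=; apply: eq_bigr => z _.
  rewrite /short_sum expr_sum_tups; apply: eq_bigr => v _.
  rewrite -(big_map (fun y => z + y) predT (fun y => chi t y)) -chi_prod //.
  by rewrite big_map.
have triv v : (`|S v| <= q ^ b)%N.
  apply: leq_trans (abs_sum_le _ _) _; rewrite -(size_polys F b) -sum1_size.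
  by apply: leq_sum => z _; exact: abs_chi.
have good v : v \in tups (polys F l) (2 * r) -> ~~ no_single v ->
    (`|S v| <= weilC r ^ n0 * q ^ uphalf b)%N.
  rewrite mem_tups => /andP[/eqP sv /allP av] /allPn[x xv]; rewrite negbK => /eqP cx.
  rewrite -leq_sqr; apply: leq_trans (complete_sum (m := r) ut mt _ _ cx) _.
  - move=> Q Qt y yv; apply: leq_ltn_trans (lt Qt).
    by have := av y yv; rewrite /= -mem_polys.
  - by rewrite sv mul2n.
  rewrite expnMn -!expnM leq_mul //.
    rewrite leq_pexp2l ?weilC_gt0 //; lia.
  rewrite leq_pexp2l ?q_gt0 //; lia.
rewrite (bigID (@no_single _)) /= /momentB PoszD lerD //.
  apply: (@le_trans _ _ (\sum_(v <- tups (polys F l) (2 * r) | no_single v) (q ^ b)%:Z)).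
    apply: ler_sum => v _; have := triv v; lia.
  rewrite big_const_seq iter_addr_0 -mulr_natr natz -PoszM lez_nat mulnC leq_mul //.
  rewrite expnM -(size_polys F l) count_no_single ?polys_uniq //.
  by rewrite -size_eq0 size_polys -lt0n expn_gt0 q_gt0.
rewrite big_seq_cond.
apply: (@le_trans _ _ (\sum_(v <- tups (polys F l) (2 * r) | (v \in tups (polys F l) (2 * r)) && ~~ no_single v) (weilC r ^ n0 * q ^ uphalf b)%:Z)).
  by apply: ler_sum => v /andP[Hv nv]; have := good v Hv nv; lia.
rewrite big_const_seq iter_addr_0 -mulr_natr natz -PoszM lez_nat mulnC leq_mul //.
by apply: leq_trans (count_size _ _) _; rewrite size_tups size_polys -expnM.
Qed.

Lemma count_large_values C : (0 < r)%N ->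
  (count (fun z => q ^ l <= C * `|shortsum z|)%N (polys F b) * q ^ (l * (2 * r))
    <= C ^ (2 * r) * momentB)%N.
Proof.
move=> r0; rewrite -lez_nat !PoszM; apply: le_trans (ler_pM _ _ (lexx _) (moment_bound r0)) => //; last first.
  by apply: sumr_ge0 => z _; rewrite exprM exprn_ge0 // sqr_ge0.
rewrite mulr_sumr (bigID (fun z => q ^ l <= C * `|shortsum z|)%N) /= -[X in X <= _]addr0.
have pos z : 0 <= shortsum z ^+ (2 * r) by rewrite exprM exprn_ge0 // sqr_ge0.
apply: lerD; last by apply: sumr_ge0 => z _; rewrite mulr_ge0.
apply: (@le_trans _ _ (\sum_(z <- polys F b | (q ^ l <= C * `|shortsum z|)%N) (q ^ (l * (2 * r)))%:Z)).
  by rewrite big_const_seq iter_addr_0 -mulr_natr natz mulrC.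
apply: ler_sum => z Hz.
have -> : shortsum z ^+ (2 * r) = (`|shortsum z| ^ (2 * r))%N%:Z.
  by rewrite -abszX gez0_abs.
by rewrite -PoszM lez_nat -expnMn expnM leq_exp2r // muln_gt0.
Qed.
End Moment.

(** * Counting by residue classes, and the equation e u' = e' u *)

Section Counting.
Variable F : finFieldType.
Local Notation q := #|F|.
Implicit Types (u w z Q M : {poly F}).

(** Elements congruent modulo Q that agree on coefficients from l on are equal,
    their difference being too small to be divisible by Q. *)
Lemma class_count Q (P : pred {poly F}) n l : (l < size Q)%N ->
  {in polys F n &, forall c1 c2, P c1 -> P c2 -> Q %| c1 - c2} ->
  (count P (polys F n) <= q ^ (n - l))%N.
Proof.
move=> lQ H; rewrite -size_filter -(size_polys F (n - l)) -(size_map (drop_poly l)).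
apply: uniq_leq_size.
  rewrite map_inj_in_uniq ?filter_uniq ?polys_uniq // => c1 c2.
  rewrite !mem_filter => /andP[P1 c1n] /andP[P2 c2n] E.
  apply/eqP; rewrite -subr_eq0; apply: contraT => nz.
  have := dvdp_leq nz (H _ _ c1n c2n P1 P2).
  have -> : c1 - c2 = take_poly l (c1 - c2).
    rewrite -[LHS](poly_take_drop l) [X in _ + X * _]linearB /= E subrr mul0r addr0 //.
  by move=> Hle; have := leq_trans Hle (size_take_poly l _); rewrite leqNgt lQ.
move=> _ /mapP[c + ->]; rewrite mem_filter !mem_polys => /andP[_ cn].
by rewrite size_drop_poly leq_sub2r.
Qed.

Definition monics n : seq {poly F} := [seq 'X^n + w | w <- polys F n].

Lemma monics_uniq n : uniq (monics n).
Proof. by rewrite map_inj_uniq ?polys_uniq // => x y /addrI. Qed.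

Lemma size_monics n : size (monics n) = (q ^ n)%N.
Proof. by rewrite size_map size_polys. Qed.

Lemma mem_monics n u : (u \in monics n) = (u \is monic) && (size u == n.+1).
Proof.
apply/mapP/andP => [[w + ->]|[mu /eqP su]].
  rewrite mem_polys => sw; have lt : (size w < size ('X^n : {poly F}))%N by rewrite size_polyXn.
  by rewrite monicE lead_coefDl // lead_coefXn size_polyDl // size_polyXn.
exists (u - 'X^n); last by rewrite addrC subrK.
rewrite mem_polys; apply/leq_sizeP => j Hj; rewrite coefB coefXn.
case: (eqVneq j n) => [->|jn]; last first.
  by rewrite nth_default ?subr0 // su ltn_neqAle eq_sym jn.
by move: mu; rewrite monicE /lead_coef su /= => /eqP ->; rewrite subrr.
Qed.

Lemma monic_gcd_decomp u w : u \is monic -> w \is monic ->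
  exists g u1 w1, [/\ u = g * u1, w = g * w1 & g \is monic] /\
    [/\ u1 \is monic, w1 \is monic & coprimep u1 w1].
Proof.
move=> mu mw; set d := gcdp u w.
have u0 := monic_neq0 mu.
have d0 : d != 0 by rewrite gcdp_eq0 negb_and u0.
pose g := (lead_coef d)^-1 *: d.
have lc0 : lead_coef d != 0 by rewrite lead_coef_eq0.
have mg : g \is monic by rewrite monicE lead_coefZ mulVf.
have gd : g %= d by rewrite eqp_scale // invr_eq0.
have gu : g %| u by rewrite (eqp_dvdl _ gd) dvdp_gcdl.
have gw : g %| w by rewrite (eqp_dvdl _ gd) dvdp_gcdr.
exists g, (u %/ g), (w %/ g).
have Eu : u = g * (u %/ g) by rewrite mulrC divpK.
have Ew : w = g * (w %/ g) by rewrite mulrC divpK.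
have m1 : u %/ g \is monic by move: mu; rewrite {1}Eu monicMl.
have m2 : w %/ g \is monic by move: mw; rewrite {1}Ew monicMl.
split; split=> //.
by rewrite /g !divpZr ?invr_eq0 // coprimepZl ?coprimepZr ?invr_eq0 ?invrK // coprimep_div_gcd // u0.
Qed.

Definition prodseq (T1 T2 : Type) (s1 : seq T1) (s2 : seq T2) := [seq (x, y) | x <- s1, y <- s2].

Lemma mem_prodseq (T1 T2 : eqType) (s1 : seq T1) (s2 : seq T2) x y :
  ((x, y) \in prodseq s1 s2) = (x \in s1) && (y \in s2).
Proof.
apply/allpairsP/andP => [[[a b] /= [? ? [-> ->]]]|[? ?]] //.
by exists (x, y).
Qed.

Lemma prodseq_uniq (T1 T2 : eqType) (s1 : seq T1) (s2 : seq T2) :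
  uniq s1 -> uniq s2 -> uniq (prodseq s1 s2).
Proof. by move=> u1 u2; apply: allpairs_uniq => // -[? ?] [? ?] _ _ [-> ->]. Qed.

(** Divide u and u' by their monic gcd, of degree i: writing u = g u1 and
    u' = g u1', the solutions are e = k u1, e' = k u1'. For each of the a + 1
    values of i there are q^(i + 2 (a - i) + h - (a - i)) = q^(h + a)
    possibilities for (g, k, u1, u1'). *)
Lemma quad_count a h : (a <= h)%N ->
  (count (fun x => x.2.1 * x.1.2 == x.2.2 * x.1.1)%R
     (prodseq (prodseq (monics a) (monics a)) (prodseq (polys F h) (polys F h)))
   <= a.+1 * q ^ (h + a))%N.
Proof.
move=> ah; rewrite -size_filter.
pose im i := [seq ((gk.1 * uu.1, gk.1 * uu.2), (gk.2 * uu.1, gk.2 * uu.2)) |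
  gk <- prodseq (monics i) (polys F (h - (a - i))), uu <- prodseq (monics (a - i)) (monics (a - i))].
pose IM := flatten [seq im i | i <- iota 0 a.+1].
have <- : size IM = (a.+1 * q ^ (h + a))%N.
  rewrite size_flatten /shape -map_comp sumnE big_map.
  rewrite (eq_big_seq (fun _ => (q ^ (h + a))%N)) => [|i].
    by rewrite big_const_seq count_predT size_iota iter_addn_0 mulnC.
  rewrite mem_iota add0n ltnS => /andP[_ ia] /=.
  rewrite !size_allpairs !size_monics size_polys -!expnD; congr (_ ^ _)%N.
  by move: ah ia; clear; lia.
apply: uniq_leq_size.
  by rewrite filter_uniq // !prodseq_uniq ?monics_uniq ?polys_uniq.
move=> [[u u'] [e e']]; rewrite mem_filter !mem_prodseq !mem_monics !mem_polys /=.
move=> /andP[/eqP E /andP[/andP[/andP[mu /eqP su] /andP[mu' /eqP su']] /andP[se se']]].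
have [g [u1 [u1' [[Eu Eu' mg] [m1 m1' cop]]]]] := monic_gcd_decomp mu mu'.
have g0 := monic_neq0 mg; have u10 := monic_neq0 m1; have u10' := monic_neq0 m1'.
have E1 : e * u1' = e' * u1.
  by apply: (mulfI g0); rewrite mulrCA [in RHS]mulrCA -Eu -Eu'.
have /dvdpP[k Ek] : u1 %| e.
  by have := dvdp_mull e' (dvdpp u1); rewrite -E1 Gauss_dvdpl.
have Ek' : e' = k * u1' by apply: (mulIf u10); rewrite -E1 Ek mulrAC.
have sgu : (size g + size u1 = a.+2)%N.
  have := su; rewrite Eu size_mul //; have := g0; rewrite -size_poly_gt0.
  by move: (size g) (size u1) => x y; clear; lia.
have sgu' : (size g + size u1' = a.+2)%N.
  have := su'; rewrite Eu' size_mul //; have := g0; rewrite -size_poly_gt0.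
  by move: (size g) (size u1') => x y; clear; lia.
have sg0 : (0 < size g)%N by rewrite size_poly_gt0.
have su0 : (0 < size u1)%N by rewrite size_poly_gt0.
pose i := (size g).-1.
apply/flattenP; exists (im i); first by apply: map_f; rewrite mem_iota add0n /i /=; move: (size g) (size u1) sgu su0 => x y; clear; lia.
apply/allpairsP; exists ((g, k), (u1, u1')); split=> /=.
- rewrite mem_prodseq mem_monics mg /i prednK // eqxx mem_polys /=.
  case: (eqVneq k 0) => [->|k0]; first by rewrite size_poly0.
  have := se; rewrite Ek size_mul //; move: (size g) (size u1) (size k) sgu sg0 su0 => x y z; clear; lia.
- rewrite mem_prodseq !mem_monics m1 m1' /i /=.
  by move: (size g) (size u1) (size u1') sgu sgu' sg0 su0 => x y z; clear; lia.
- by rewrite -Eu -Eu' -Ek -Ek'.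
Qed.
End Counting.

(** * Burgess' bound *)

Lemma count_prodseq (T1 T2 : Type) (s1 : seq T1) (s2 : seq T2) (P : pred (T1 * T2)) :
  count P (prodseq s1 s2) = (\sum_(x <- s1) \sum_(y <- s2) P (x, y))%N.
Proof.
rewrite -sum1_count /prodseq big_mkcond big_allpairs /=.
by apply: eq_bigr => x _; apply: eq_bigr => y _; case: (P _).
Qed.

Lemma sum_fibres_sq (T U : eqType) (f : T -> U) (PR : seq T) (s : seq U) : uniq s ->
  (\sum_(z <- s) (count (fun p => f p == z) PR) ^ 2
    <= \sum_(p <- PR) \sum_(p' <- PR) (f p == f p'))%N.
Proof.
move=> us.
have cE z : count (fun p => f p == z) PR = (\sum_(p <- PR) (f p == z))%N.
  by rewrite -sum1_count big_mkcond; apply: eq_bigr => p _; case: eqP.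
under eq_bigr => z _ do rewrite cE -mulnn big_distrl /=.
rewrite exchange_big /=; apply: leq_sum => p _.
under eq_bigr => z _ do rewrite big_distrr /=.
rewrite exchange_big /=; apply: leq_sum => p' _.
case: (eqVneq (f p) (f p')) => [<-|ne] /=.
  apply: (@leq_trans (\sum_(z <- s) (z == f p))).
    by apply: leq_sum => z _; rewrite eq_sym; case: eqP.
  by rewrite -(big_mkcond (fun z => z == f p) (fun=> 1%N)) sum1_count (count_uniq_mem _ us) leq_b1.
rewrite big1 // => z _; case: eqP => // <-; case: eqP => // E.
by rewrite E eqxx in ne.
Qed.

Section BurgessCore.
Variables (F : finFieldType) (K : closedFieldType) (iota : {rmorphism F -> K}).
Variable hq : nat.
Hypothesis cardF : #|F| = hq.*2.+1.
Hypothesis charF : [pchar F].-nat #|F|.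
Local Notation q := #|F|.
Local Notation chi := (jacobi_prod iota hq).
Variables (t : seq {poly F}) (l r n0 a h C : nat).
Hypothesis ut : uniq t.
Hypothesis mt : all (@monirr F) t.
Hypothesis lt : {in t, forall Q : {poly F}, (l < size Q)%N}.
Hypothesis szt : (size t <= n0)%N.
Local Notation b := (degs t).
Local Notation shortsum := (short_sum iota hq t l).
Let M := \prod_(Q <- t) Q.
Hypothesis hal : h = (a + l)%N.
Hypothesis hab : (h + a < b)%N.
Hypothesis la : (l <= a)%N.

Let monM : M \is monic. Proof. exact: monic_prod_all. Qed.
Let M0 : M != 0. Proof. exact: monic_neq0. Qed.
Let sizeM : (size M).-1 = b. Proof. exact: size_prod_degs. Qed.

Let modM w : w %% M \in polys F b.
Proof. by rewrite mem_polys -sizeM -ltnS prednK ?size_poly_gt0 // ltn_modp. Qed.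

Let QM Q : Q \in t -> Q %| M.
Proof. by move=> Qt; rewrite /M (big_rem Q) //= dvdp_mulr. Qed.

Let modE w : M %| w - w %% M.
Proof. by rewrite {1}(divp_eq w M) addrK dvdp_mull. Qed.

Lemma invMP u : coprimep u M -> exists w, M %| u * w - 1.
Proof.
move/Bezout_eq1_coprimepP => [[x z] /= E]; exists x.
have -> : u * x - 1 = - z * M by rewrite -E; ring.
exact: dvdp_mull.
Qed.

Variable y : {poly F}.

(* [zeta (u, c)] represents (y + c) / u modulo M. *)
Let units := [seq u <- monics F a | coprimep u M].
Let PR := prodseq units (polys F h).
Let inv u := nth 0 (polys F b) (find (fun w => M %| u * w - 1) (polys F b)).
Let zeta (p : {poly F} * {poly F}) := ((y + p.2) * inv p.1) %% M.

Let invE u : coprimep u M -> M %| u * inv u - 1.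
Proof.
move=> cu; rewrite /inv.
apply: (nth_find 0 (a := fun w => M %| u * w - 1)); apply/hasP.
have [w Hw] := invMP cu; exists (w %% M) => //=.
have -> : u * (w %% M) - 1 = (u * w - 1) - u * (w - w %% M) by ring.
by apply: dvdp_sub => //; apply: dvdp_mull; exact: modE.
Qed.

Let sum_v u c : coprimep u M ->
  `|(\sum_(v <- polys F l) chi t (y + c + u * v))%R|%N = `|shortsum (zeta (u, c))|%N.
Proof.
move=> cu.
have -> : \sum_(v <- polys F l) chi t (y + c + u * v) = chi t u * shortsum (zeta (u, c)).
  rewrite /short_sum mulr_sumr; apply: eq_bigr => v _.
  rewrite -(chiM iota cardF charF) //; apply: chi_mod => // Q Qt.
  apply: dvdp_trans (QM Qt) _.
  have -> : y + c + u * v - u * (zeta (u, c) + v) =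
     u * ((y + c) * inv u - zeta (u, c)) - (y + c) * (u * inv u - 1) by ring.
  apply: dvdp_sub; first by apply: dvdp_mull; exact: modE.
  by apply: dvdp_mull; exact: invE.
rewrite abszM (chi_unit iota cardF) ?mul1n // => Q Qt.
exact: coprimep_dvdl (QM Qt) cu.
Qed.

Lemma noncoprime_count : (count (fun u => ~~ coprimep u M) (monics F a) <= n0 * q ^ (a - l))%N.
Proof.
have H1 u : ~~ coprimep u M -> has (fun Q => Q %| u) t.
  apply: contraNT => /hasPn H; rewrite coprimep_sym /M.
  rewrite big_seq; apply: (big_ind (fun N => coprimep N u)) => [|x z cx cz|Q Qt].
  - exact: coprime1p.
  - by rewrite coprimepMl cx.
  - have /monirrP[_ iQ] := allP mt _ Qt.
    by rewrite irreducible_poly_coprime // H.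
apply: (@leq_trans (\sum_(Q <- t) count (fun u : {poly F} => (Q %| u)%R) (monics F a))).
  elim: (monics F a) => [|u s IH] /=; first by rewrite big1.
  rewrite big_split /= leq_add //; case: (boolP (coprimep u M)) => //= cu.
  have /hasP[Q Qt Qu] := H1 u cu.
  by rewrite (big_rem Q) //= Qu.
apply: (@leq_trans (\sum_(Q <- t) q ^ (a - l))).
  rewrite big_seq [X in (_ <= X)%N]big_seq; apply: leq_sum => Q Qt.
  rewrite count_map; apply: (class_count (lt Qt)) => w1 w2 _ _ /= D1 D2.
  by have := dvdp_sub D1 D2; rewrite opprD addrACA subrr add0r.
by rewrite big_const_seq count_predT iter_addn_0 mulnC leq_mul2r szt orbT.
Qed.

Let nu z := count (fun p => zeta p == z) PR.

Let zeta_eq u c u' c' : coprimep u M -> coprimep u' M ->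
  zeta (u, c) = zeta (u', c') -> M %| (y + c) * u' - (y + c') * u.
Proof.
move=> cu cu' E.
have H : M %| (y + c) * inv u - (y + c') * inv u'.
  by rewrite /dvdp modpD modpN /zeta /= in E *; rewrite E subrr.
have -> : (y + c) * u' - (y + c') * u =
  ((y + c) * inv u - (y + c') * inv u') * (u * u')
   - (y + c) * u' * (u * inv u - 1) + (y + c') * u * (u' * inv u' - 1) by ring.
by apply: dvdp_add; [apply: dvdp_sub; [exact: dvdp_mulr|]|]; apply: dvdp_mull; exact: invE.
Qed.

(** The pairs (c, c') with (y + c)/u = (y + c')/u' form a coset, or are absent;
    translating by one of them leaves the homogeneous congruence
    c u' = c' u mod M, which is an equality since both sides have degree
    less than b = deg M. *)
Let fibre_le u u' : u \in units -> u' \in units ->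
  (\sum_(c <- polys F h) \sum_(c' <- polys F h) (zeta (u, c) == zeta (u', c'))
   <= \sum_(e <- polys F h) \sum_(e' <- polys F h) (e * u' == e' * u)%R)%N.
Proof.
rewrite !mem_filter !mem_monics => /andP[cu /andP[_ /eqP su]] /andP[cu' /andP[_ /eqP su']].
case: (boolP (has (fun p => zeta (u, p.1) == zeta (u', p.2)) (prodseq (polys F h) (polys F h)))).
  move=> /hasP[[c0 c0']]; rewrite mem_prodseq => /andP[h0 h0'] /= /eqP E0.
  rewrite -(sum_polys_shift (c := c0)) // [X in (X <= _)%N]big_seq [X in (_ <= X)%N]big_seq.
  apply: leq_sum => c ch; rewrite -(sum_polys_shift (c := c0')) //.
  rewrite [X in (X <= _)%N]big_seq [X in (_ <= X)%N]big_seq.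
  apply: leq_sum => c' ch'; case: (eqVneq (zeta _) (zeta _)) => // E.
  suff -> : c * u' == c' * u by [].
  rewrite -subr_eq0; apply: contraT => nz.
  have D : M %| c * u' - c' * u.
    have -> : c * u' - c' * u =
      ((y + (c + c0)) * u' - (y + (c' + c0')) * u) - ((y + c0) * u' - (y + c0') * u) by ring.
    by apply: dvdp_sub; apply: zeta_eq.
  have := dvdp_leq nz D.
  have sz (e w : {poly F}) : e \in polys F h -> size w = a.+1 -> (size (e * w)%R <= h + a)%N.
    rewrite mem_polys => se sw; apply: leq_trans (size_polyMleq _ _) _.
    by rewrite sw addnS /= leq_add2r.
  have S1 := sz _ _ ch su'; have S2 := sz _ _ ch' su.
  have S3 : (size (c * u' - c' * u)%R <= h + a)%N.
    by apply: leq_trans (size_polyD _ _) _; rewrite size_polyN geq_max S1.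
  move=> D2; have := leq_trans D2 S3; rewrite leqNgt => /negP[].
  by apply: leq_trans hab _; rewrite -sizeM leq_pred.
move=> /hasPn H; rewrite big_seq big1 // => c ch; rewrite big_seq big1 // => c' ch'.
have := H (c, c'); rewrite mem_prodseq ch ch' => /(_ isT) /=.
by case: eqP.
Qed.

Let nu_sq : (\sum_(z <- polys F b) nu z ^ 2 <= a.+1 * q ^ (h + a))%N.
Proof.
apply: leq_trans (sum_fibres_sq _ _ (polys_uniq _ _)) _.
apply: leq_trans (quad_count F (_ : a <= h)%N); last by rewrite hal leq_addr.
pose G u u' := (\sum_(e <- polys F h) \sum_(e' <- polys F h) (e * u' == e' * u)%R)%N.
have sub_le (f : {poly F} -> nat) : (\sum_(u <- units) f u <= \sum_(u <- monics F a) f u)%N.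
  by rewrite big_filter big_mkcond /=; apply: leq_sum => u _; case: ifP.
apply: (@leq_trans (\sum_(u <- monics F a) \sum_(u' <- monics F a) G u u')%N); last first.
  rewrite count_prodseq big_allpairs /=; apply: leq_sum => u _; apply: leq_sum => u' _.
  by rewrite big_allpairs.
apply: (@leq_trans (\sum_(u <- units) \sum_(u' <- units) G u u')%N); last first.
  apply: leq_trans (sub_le _) _; apply: leq_sum => u _; exact: sub_le.
rewrite {1}/PR /prodseq big_allpairs /= [X in (X <= _)%N]big_seq [X in (_ <= X)%N]big_seq.
apply: leq_sum => u uu.
under eq_bigr => c _ do rewrite /PR /prodseq big_allpairs /=.
rewrite exchange_big /= [X in (X <= _)%N]big_seq [X in (_ <= X)%N]big_seq.
by apply: leq_sum => u' uu'; exact: fibre_le.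
Qed.

Hypothesis C0 : (0 < C)%N.
Hypothesis r0 : (0 < r)%N.
Hypothesis Cn0 : (C * n0 <= q ^ l)%N.
Hypothesis momH : (C ^ 4 * a.+1 * C ^ (2 * r) * momentB t l r n0 <= q ^ (h + a) * q ^ (l * (2 * r)))%N.

(* The points where the short sum is larger than a proportion 1/C of the trivial
   bound. *)
Let bad := fun z => (q ^ l <= C * `|shortsum z|)%N.

Let few_bad : (C ^ 4 * a.+1 * count bad (polys F b) <= q ^ (h + a))%N.
Proof.
have H := count_large_values iota cardF charF ut mt lt szt C r0.
rewrite -(leq_pmul2r (_ : 0 < q ^ (l * (2 * r)))%N) ?expn_gt0 ?(q_gt0 cardF) //.
apply: leq_trans momH; rewrite -!(mulnA (C ^ 4 * a.+1)%N).
exact: leq_mul (leqnn _) H.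
Qed.

Let bad_pairs : (C ^ 2 * count (fun p => bad (zeta p)) PR <= 2 * q ^ (h + a))%N.
Proof.
have E : count (fun p => bad (zeta p)) PR = (\sum_(z <- polys F b | bad z) nu z)%N.
  rewrite /nu; under eq_bigr => z _ do rewrite -sum1_count big_mkcond /=.
  rewrite exchange_big /= -sum1_count big_mkcond /=; apply: eq_bigr => p _.
  case: (boolP (bad (zeta p))) => bp.
    rewrite -big_filter (bigD1_seq (zeta p)) ?filter_uniq ?polys_uniq ?mem_filter ?bp ?modM //=.
    by rewrite eqxx big1 // => z; rewrite eq_sym; case: eqP.
  by rewrite big1 // => z bz; case: eqP => // E; rewrite E bz in bp.
(* Sum lam * nu <= lam^2 + nu^2 over the bad points; this lam makes both
   contributions of the same order. *)
set lam := (C ^ 2 * a.+1)%N.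
have lam0 : (0 < lam)%N by rewrite muln_gt0 expn_gt0 C0.
have H : (lam * count (fun p => bad (zeta p)) PR <= lam ^ 2 * count bad (polys F b) + a.+1 * q ^ (h + a))%N.
  apply: leq_trans (leq_add (leqnn _) nu_sq); rewrite E big_distrr /=.
  rewrite -sum1_count big_distrr /= [X in (_ <= _ + X)%N](bigID bad) /= addnA.
  apply: leq_trans (leq_addr _ _); rewrite -big_split /=; apply: leq_sum => z _.
  by have [+ _] := nat_AGM2 lam (nu z); rewrite muln1 sqrnD; lia.
rewrite -(leq_pmul2l (ltn0Sn a)).
have F1 := few_bad; rewrite /lam in H.
have F2 : ((C ^ 2 * a.+1) ^ 2 * count bad (polys F b) = a.+1 * (C ^ 4 * a.+1 * count bad (polys F b)))%N.
  by rewrite expnMn -expnM -!mulnA; lia.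
rewrite F2 in H; have F3 := leq_mul (leqnn a.+1) F1; lia.
Qed.

(** Averaging over the translations c -> c + u v, with u monic of degree a and v
    of size at most l, replaces the sum by short sums at the points (y + c)/u.
    At most points the short sum is small, by the moment bound; the other
    points are few, and cannot be hit by too many pairs (u, c) since the second
    moment of the number of hits is controlled. *)
Lemma burgess_core :
  (C * `|(\sum_(c <- polys F h) chi t (y + c))%R| <= 4 * q ^ h)%N.
Proof.
set S := `|_|%N.
pose ts u c := `|(\sum_(v <- polys F l) chi t (y + c + u * v))%R|%N.
have ts_triv u c : (ts u c <= q ^ l)%N.
  apply: leq_trans (abs_sum_le _ _) _; rewrite -(size_polys F l) -sum1_size.
  by apply: leq_sum => v _; exact: abs_chi.
(* Translation by u v permutes the range of c, since a + l = h. *)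
have main : (q ^ a * q ^ l * S <= \sum_(u <- monics F a) \sum_(c <- polys F h) ts u c)%N.
  rewrite -mulnA -(size_monics F a) -sum1_size big_distrl /= [X in (X <= _)%N]big_seq [X in (_ <= X)%N]big_seq.
  apply: leq_sum => u; rewrite mem_monics mul1n => /andP[_ /eqP su].
  have -> : (q ^ l * S)%N = `|(\sum_(c <- polys F h) \sum_(v <- polys F l) chi t (y + c + u * v))%R|%N.
    rewrite exchange_big /=.
    have E v : v \in polys F l -> \sum_(c <- polys F h) chi t (y + c + u * v) =
         \sum_(c <- polys F h) chi t (y + c).
      rewrite mem_polys => sv.
      have uvh : u * v \in polys F h.
        rewrite mem_polys; apply: leq_trans (size_polyMleq _ _) _.
        by rewrite su addSn /= hal leq_add2l.
      rewrite -[RHS](sum_polys_shift _ uvh) /=; apply: eq_bigr => c _.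
      by rewrite addrA.
    rewrite (eq_big_seq _ E) big_const_seq count_predT iter_addr_0 size_polys -mulr_natr natz.
    by rewrite abszM mulnC.
  exact: abs_sum_le.
(* The u that are not invertible modulo M are few and are bounded trivially. *)
have split_u : (\sum_(u <- monics F a) \sum_(c <- polys F h) ts u c <=
    n0 * q ^ (a - l) * (q ^ h * q ^ l) + \sum_(p <- PR) `|shortsum (zeta p)|)%N.
  rewrite (bigID (fun u => coprimep u M)) /= addnC; apply: leq_add.
    apply: (@leq_trans (\sum_(u <- monics F a | ~~ coprimep u M) (q ^ h * q ^ l))%N).
      apply: leq_sum => u _; rewrite -(size_polys F h) -sum1_size big_distrl /=.
      by apply: leq_sum => c _; rewrite mul1n.
    by rewrite big_const_seq iter_addn_0 mulnC leq_mul2r noncoprime_count orbT.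
  rewrite -big_filter -/units /PR /prodseq big_allpairs /=.
  rewrite [X in (X <= _)%N]big_seq [X in (_ <= X)%N]big_seq; apply: leq_sum => u.
  rewrite mem_filter => /andP[cu _]; apply: leq_sum => c _.
  by rewrite /ts sum_v.
have short_le p : (C * `|shortsum (zeta p)| <= q ^ l + C * q ^ l * bad (zeta p))%N.
  rewrite /bad; case: (leqP (q ^ l) (C * _)) => H; last by rewrite muln0 addn0 ltnW.
  rewrite muln1; apply: leq_trans (leq_addl _ _); rewrite leq_mul2l; apply/orP; right.
  apply: leq_trans (abs_sum_le _ _) _; rewrite -(size_polys F l) -sum1_size.
  by apply: leq_sum => v _; exact: abs_chi.
have szPR : (size PR <= q ^ a * q ^ h)%N.
  rewrite size_allpairs size_polys leq_mul2r -(size_monics F a).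
  by rewrite size_filter count_size orbT.
have sum_short : (C * \sum_(p <- PR) `|shortsum (zeta p)| <=
    q ^ a * q ^ h * q ^ l + C * q ^ l * count (fun p => bad (zeta p)) PR)%N.
  rewrite big_distrr /=; apply: leq_trans (leq_sum _ (fun p _ => short_le p)) _.
  rewrite big_split /= big_const_seq count_predT iter_addn_0 mulnC leq_add ?leq_mul2r ?szPR ?orbT //.
  rewrite -big_distrr /= leq_mul2l; apply/orP; right.
  by rewrite -sum1_count [X in (_ <= X)%N]big_mkcond; apply: leq_sum => p _; case: (bad _).
have BP := bad_pairs.
set X := count (fun p => bad (zeta p)) PR in sum_short BP.
have qa : (q ^ (a - l) * q ^ l = q ^ a)%N by rewrite -expnD subnK.
have qpos n : (0 < q ^ n)%N by rewrite expn_gt0 (q_gt0 cardF).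
rewrite -(leq_pmul2l (qpos a)) -(leq_pmul2l (qpos l)) -(leq_pmul2l C0).
rewrite expnD in BP.
move: main split_u sum_short BP Cn0 qa; rewrite -mulnn.
move: (\sum_(u <- monics F a) _)%N (\sum_(p <- PR) _)%N => A B.
move: (q ^ a)%N (q ^ l)%N (q ^ h)%N (q ^ (a - l))%N => ea el eh em M1 M2 M3 M4 M5 M6.
set U := (ea * eh * el)%N.
have N1 : (C * C * (ea * el * S) <= C * C * A)%N by rewrite leq_mul2l M1 orbT.
have N2 : (C * C * A <= C * C * (n0 * em * (eh * el) + B))%N by rewrite leq_mul2l M2 orbT.
have N3 : (C * (C * B) <= C * (U + C * el * X))%N by rewrite leq_mul2l M3 orbT.
have N4 : (el * (C * C * X) <= el * (2 * (eh * ea)))%N by rewrite leq_mul2l M4 orbT.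
have N5 : (C * n0 * (C * em * eh * el) <= el * (C * em * eh * el))%N by rewrite leq_mul2r M5 orbT.
have N6 : (el * (C * em * eh * el) = C * U)%N by rewrite /U -M6; lia.
have N7 : (U <= C * U)%N by rewrite leq_pmull.
have N8 : (C * C * (n0 * em * (eh * el) + B) = C * n0 * (C * em * eh * el) + C * (C * B))%N by lia.
have N9 : (C * (U + C * el * X) = C * U + el * (C * C * X))%N by lia.
have N10 : (el * (2 * (eh * ea)) = 2 * U)%N by rewrite /U; lia.
have -> : (C * (el * (ea * (C * S))) = C * C * (ea * el * S))%N by lia.
have -> : (C * (el * (ea * (4 * eh))) = 4 * (C * U))%N by rewrite /U; lia.
rewrite N8 in N2; rewrite N9 in N3; rewrite N6 in N5; rewrite N10 in N4.
move: N1 N2 N3 N4 N5 N7.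
move: (C * C * (ea * el * S))%N (C * C * A)%N (C * n0 * (C * em * eh * el))%N (C * (C * B))%N.
move: (C * U)%N (el * (C * C * X))%N; clear; lia.
Qed.
End BurgessCore.

Lemma linear_le_exp2 A B : exists b0, forall b, (b0 <= b)%N -> (A * b.+1 <= 2 ^ (b %/ 25 - B))%N.
Proof.
exists (25 * (B + 2 * (A * (50 + 25 * B))))%N => b Hb.
set E := (b %/ 25 - B)%N.
have HE : (2 * (A * (50 + 25 * B)) <= E)%N.
  rewrite /E; move: Hb; move: (A * (50 + 25 * B))%N => x; lia.
have Eb : (b < 25 * (E + B).+1)%N by rewrite /E; lia.
pose y := (E %/ 2)%N.
have yE : (2 * y <= E <= 2 * y + 1)%N by rewrite /y; lia.
have yA : (A * (50 + 25 * B) <= y)%N by rewrite /y; move: HE; move: (A * _)%N => x; lia.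
apply: (@leq_trans (y.+1 * y.+1)%N).
  apply: (@leq_trans (A * ((50 + 25 * B) * y.+1))%N); first by rewrite leq_mul2l; apply/orP; right; nia.
  by rewrite mulnA leq_mul2r (leq_trans yA) ?orbT.
apply: (@leq_trans (2 ^ y * 2 ^ y)%N); first by apply: leq_mul; apply: ltn_expl.
by rewrite -expnD leq_exp2l //; lia.
Qed.

(** The two inequalities needed for the two terms of the moment, with E = b/25
    absorbing all constants. Up to bounded terms h + (h - l) = 4b/7 - l,
    2 l r = b and l <= b/40, so they follow from 1 + 1/25 < 4/7 - 1/40 + 1/2 and
    1/2 + 1/25 < 4/7 - 1/40. That there is room for such margins is due to
    2/7 exceeding 1/4. *)
Lemma burgess_exponents b r l (h := (2 * b %/ 7)%N) (E := (b %/ 25 - (r + 3))%N) :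
  (2 * (l * r) <= b)%N -> (b < 2 * (l * r) + 2 * r)%N -> (40 * l <= b)%N ->
  (25 * (r + 3) <= b)%N ->
  [/\ (l <= h - l)%N, (h + (h - l) < b)%N, (h - l <= b)%N,
      (E + (l * r + b) <= h + (h - l) + l * (2 * r))%N
    & (E + (l * (2 * r) + uphalf b) <= h + (h - l) + l * (2 * r))%N].
Proof.
have h7 : (7 * h <= 2 * b < 7 * h + 7)%N.
  by rewrite /h; clear; lia.
have E25 : (25 * (r + 3) <= b -> 25 * (E + (r + 3)) <= b)%N.
  move=> Hb; rewrite /E subnK; first by rewrite mulnC leq_trunc_div.
  by rewrite leq_divRL // mulnC.
have ub : (2 * uphalf b <= b.+1)%N by clear; lia.
have -> : (l * (2 * r) = 2 * (l * r))%N by rewrite mulnCA.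
move: h7 E25 ub; clearbody h E.
move: (uphalf b) (l * r)%N => u x h7 E25 ub x1 x2 l40 b25.
have {}E25 := E25 b25; split; lia.
Qed.

Section Burgess.
Variables (F : finFieldType) (K : closedFieldType) (iota : {rmorphism F -> K}).
Variable hq : nat.
Hypothesis cardF : #|F| = hq.*2.+1.
Hypothesis charF : [pchar F].-nat #|F|.
Local Notation q := #|F|.
Local Notation chi := (jacobi_prod iota hq).

Lemma size_le_degs t r : (0 < degs t)%N -> (0 < r)%N ->
  {in t, forall Q : {poly F}, (degs t <= 2 * r * (size Q).-1)%N} -> (size t <= 2 * r)%N.
Proof.
move=> d0 r0 H; rewrite -(leq_pmul2r d0).
apply: (@leq_trans (\sum_(Q <- t) degs t)%N).
  by rewrite big_const_seq count_predT iter_addn_0 mulnC.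
rewrite [X in (_ <= _ * X)%N]/degs big_distrr /=.
by rewrite [X in (X <= _)%N]big_seq [X in (_ <= X)%N]big_seq; apply: leq_sum => Q; exact: H.
Qed.

(** The length 2/7 of the interval is any proportion strictly between the
    threshold 1/4 and the available 1/3. The lower bound on the degrees of
    the primes makes their number at most 2r, and makes residues of
    size l = deg / 2r distinct modulo each of them. *)
Theorem burgess C r : (0 < C)%N -> (20 <= r)%N -> exists b0, forall t,
  uniq t -> all (@monirr F) t -> (b0 <= degs t)%N ->
  {in t, forall Q : {poly F}, (degs t <= 2 * r * (size Q).-1)%N} ->
  forall y, (C * `|(\sum_(c <- polys F (2 * degs t %/ 7)) chi t (y + c))%R|
     <= 4 * q ^ (2 * degs t %/ 7))%N.
Proof.
move=> C0 r20; have r0 : (0 < r)%N by apply: leq_trans r20.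
pose W := (weilC r ^ (2 * r))%N.
pose A := (C ^ 4 * C ^ (2 * r) * (r ^ (2 * r) + W) * 2)%N.
have [b1 Hb1] := linear_le_exp2 A (r + 3).
exists (maxn (maxn b1 (25 * (r + 3))) (2 * r * (C * (2 * r)) + 2 * r))%N => t ut mt.
set b := degs t; rewrite !geq_max => /andP[/andP[Hb Hb2] Hb3] HQ y.
have b0 : (0 < b)%N by lia.
pose l := (b %/ (2 * r))%N; pose h := (2 * b %/ 7)%N; pose a := (h - l)%N.
have szt : (size t <= 2 * r)%N by apply: size_le_degs.
have L1 : (2 * (l * r) <= b)%N by have := leq_trunc_div b (2 * r); rewrite -/l; lia.
have L2 : (b < 2 * (l * r) + 2 * r)%N.
  have := ltn_ceil b (_ : 0 < 2 * r)%N; rewrite -/l muln_gt0 r0 => /(_ isT); lia.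
have L3 : (40 * l <= b)%N.
  apply: leq_trans L1; have := leq_mul (leqnn l) r20; lia.
have L4 : (C * (2 * r) <= l)%N by rewrite /l leq_divRL ?muln_gt0 //; lia.
have [lh hab ab e1 e2] := burgess_exponents L1 L2 L3 Hb2.
have q2 : (1 < q)%N by exact: card_finNzRing_gt1.
apply: (@burgess_core F K iota hq cardF charF t l r (2 * r) a) => //.
- move=> Q Qt; have /monirrP[mQ _] := allP mt _ Qt.
  have := leq_div2r (2 * r) (HQ Q Qt); rewrite mulKn ?muln_gt0 // -/b -/l => lQ.
  by apply: leq_ltn_trans lQ _; rewrite prednK ?size_poly_gt0 ?monic_neq0.
- by rewrite /a -/h subnK // (leq_trans lh) // leq_subr.
- by apply: leq_trans L4 _; apply: ltnW; apply: ltn_expl.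
rewrite -/b -/h.
pose E := (b %/ 25 - (r + 3))%N.
have HE : (A * a.+1 <= q ^ E)%N.
  apply: leq_trans (_ : _ <= A * b.+1)%N _; first by rewrite leq_mul2l ltnS ab orbT.
  apply: leq_trans (Hb1 b Hb) _; rewrite -/E; case: (E) => // E'.
  by rewrite leq_exp2r.
have qle e e' : (e <= e')%N -> (q ^ e <= q ^ e')%N by move=> ee; rewrite leq_pexp2l // ltnW.
have X1 := leq_trans (leq_mul HE (leqnn (q ^ (l * r + b)))) (_ : q ^ E * q ^ (l * r + b) <= q ^ (h + a + l * (2 * r)))%N.
have {}X1 := X1 (eq_ind _ (fun x => x <= _)%N (qle _ _ e1) _ (expnD _ _ _)).
have X2 := leq_trans (leq_mul HE (leqnn (q ^ (l * (2 * r) + uphalf b)))) (_ : q ^ E * q ^ (l * (2 * r) + uphalf b) <= q ^ (h + a + l * (2 * r)))%N.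
have {}X2 := X2 (eq_ind _ (fun x => x <= _)%N (qle _ _ e2) _ (expnD _ _ _)).
rewrite -expnD /momentB -/b -/W.
move: X1 X2; rewrite !(expnD q (l * _)) /A.
move: (q ^ (h + a + _))%N (q ^ (l * r))%N (q ^ (l * (2 * r)))%N (q ^ b)%N (q ^ uphalf b)%N => T x1 x2 x3 x4.
move: (C ^ 4)%N (C ^ (2 * r))%N (r ^ (2 * r))%N (W) (a.+1) => c1 c2 c3 w a1.
clear; move=> X1 X2.
have Y1 : (2 * (c1 * a1 * c2 * (x1 * c3 * x3)) <= T)%N.
  by apply: leq_trans X1; rewrite [X in (_ <= X)%N](_ : _ = 2 * (c1 * a1 * c2 * (x1 * c3 * x3)) + c1 * c2 * w * 2 * a1 * (x1 * x3))%N; [exact: leq_addr | lia].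
have Y2 : (2 * (c1 * a1 * c2 * (x2 * (w * x4))) <= T)%N.
  by apply: leq_trans X2; rewrite [X in (_ <= X)%N](_ : _ = 2 * (c1 * a1 * c2 * (x2 * (w * x4))) + c1 * c2 * c3 * 2 * a1 * (x2 * x4))%N; [exact: leq_addr | lia].
rewrite mulnDr; lia.
Qed.
End Burgess.

(** * The Moebius function of polynomials as a Jacobi symbol *)

Section Factor.
Variable F : finFieldType.
Implicit Types f g Q : {poly F}.

Lemma monic_factor f : f \is monic -> exists s, all (@monirr F) s /\ f = \prod_(Q <- s) Q.
Proof.
move: {2}(size f) (leqnn (size f)) => n; elim: n f => [|n IH] f sf mf.
  by move: sf (monic_neq0 mf); rewrite -size_poly_gt0; case: (size f).
case: (boolP (monirr f)) => [irf|]; first by exists [:: f]; rewrite /= irf big_seq1.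
rewrite /monirr mf /= => nirr.
case: (leqP (size f) 1) => s1.
  exists [::]; split=> //; rewrite big_nil.
  have /size_poly1P[c c0 Ec] : size f == 1%N.
    by rewrite eqn_leq s1 size_poly_gt0 monic_neq0.
  by move: mf; rewrite Ec monicE lead_coefC => /eqP ->.
have [g [ng1 gf ngf]] : exists g, [/\ size g != 1%N, g %| f & ~~ (g %= f)].
  apply/not_existsP => H; move/negP: nirr; apply; apply/irreducibleP; split=> // g g1 gf.
  by apply: contraT => ngf; case: (H g).
have f0 := monic_neq0 mf.
have g0 : g != 0 by apply: contraTneq gf => ->; rewrite dvd0p.
pose g' := (lead_coef g)^-1 *: g.
have lc0 : lead_coef g != 0 by rewrite lead_coef_eq0.
have mg : g' \is monic by rewrite monicE lead_coefZ mulVf.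
have eg : g' %= g by rewrite eqp_scale // invr_eq0.
have g'f : g' %| f by rewrite (eqp_dvdl _ eg).
have Ef : f = g' * (f %/ g') by rewrite mulrC divpK.
have mh : f %/ g' \is monic by move: mf; rewrite {1}Ef monicMl.
have sg' : (1 < size g')%N.
  by rewrite (eqp_size eg) ltn_neqAle eq_sym ng1 size_poly_gt0.
have sgf : (size g' < size f)%N.
  rewrite ltn_neqAle dvdp_leq // andbT; apply: contra ngf => /eqP E.
  by rewrite -(eqp_ltrans eg) -dvdp_size_eqp // E.
have sh : (size (f %/ g')%R < size f)%N.
  rewrite size_divp ?monic_neq0 //; move: sg' s1; move: (size g') (size f) => x y; clear; lia.
have [s1' [ms1 E1]] := IH g' (leq_trans sgf sf) mg.
have [s2' [ms2 E2]] := IH (f %/ g') (leq_trans sh sf) mh.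
exists (s1' ++ s2'); rewrite all_cat ms1 ms2 big_cat /= -E1 -E2; split=> //.
Qed.

Lemma monirr_prod_mem Q s : monirr Q -> all (@monirr F) s -> Q %| \prod_(R <- s) R -> Q \in s.
Proof.
move=> mQ ms; apply: contraTT => Qs.
have := monirr_coprime_prod mQ ms Qs; have /monirrP[_ iQ] := mQ.
by rewrite irreducible_poly_coprime.
Qed.

Lemma dvdp_prod_mem (s : seq {poly F}) Q : Q \in s -> Q %| \prod_(R <- s) R.
Proof. by move=> Qs; rewrite (big_rem Q) //= dvdp_mulr. Qed.

Lemma monic_irreducibleE Q : monic_irreducible Q <-> monirr Q.
Proof. by split=> [[m i]|/monirrP] //; apply/monirrP. Qed.

Lemma poly_mu_prod s : all (@monirr F) s ->
  poly_mu (\prod_(R <- s) R) = if uniq s then (-1) ^+ size s else 0.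
Proof.
move=> ms; rewrite /poly_mu.
have -> : `[< exists Q, monic_irreducible Q /\ Q ^+ 2 %| \prod_(R <- s) R >] = ~~ uniq s.
  apply/asboolP/idP => [[Q [/monic_irreducibleE mQ d]]|nu].
    apply/negP => us; have Qs : Q \in s.
      by apply: monirr_prod_mem => //; apply: dvdp_trans d; rewrite expr2 dvdp_mulr.
    have /monirrP[monQ [sQ _]] := mQ.
    move: d; rewrite (big_rem Q) //= expr2 dvdp_mul2l ?monic_neq0 // => d.
    have : Q \in rem Q s.
      apply: monirr_prod_mem => //; apply/allP => R /mem_rem; exact: (allP ms).
    by rewrite mem_rem_uniq // !inE eqxx.
  have [Q Qs Q2] : exists2 Q, Q \in s & Q \in rem Q s.
    elim: s nu {ms} => //= R s IH; rewrite negb_and negbK => /orP[Rs|/IH[Q Qs Q2]].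
      by exists R; rewrite ?inE ?eqxx.
    exists Q; rewrite ?inE ?Qs ?orbT //; case: eqP => // _.
    by rewrite inE Q2 orbT.
  exists Q; split; first by apply/monic_irreducibleE; exact: (allP ms).
  by rewrite (big_rem Q) //= expr2 dvdp_mul2l ?monic_neq0 ?(monirr_monic (allP ms _ Qs)) ?dvdp_prod_mem.
case: (boolP (uniq s)) => //= us; congr (_ ^+ _).
have -> : prime_divisors (\prod_(R <- s) R) = [set` seq_fset tt s]%classic.
  have memE Q : [set` seq_fset tt s]%classic Q = (Q \in s) :> Prop.
    by rewrite -(seq_fsetE tt s).
  apply/seteqP; split=> [Q [/monic_irreducibleE mQ d]|Q]; rewrite memE.
    exact: monirr_prod_mem.
  move=> Qs; split; last exact: dvdp_prod_mem.
  by apply/monic_irreducibleE; exact: (allP ms).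
by rewrite set_fsetK size_seq_fset undup_id.
Qed.

Variables (K : closedFieldType) (iota : {rmorphism F -> K}) (hq : nat).
Hypothesis cardF : #|F| = hq.*2.+1.
Hypothesis charF : [pchar F].-nat #|F|.

Lemma pellet_prod s : all (@monirr F) s ->
  pellet iota hq (\prod_(R <- s) R) = if uniq s then (-1) ^+ size s else 0.
Proof.
elim: s => [_|Q s IH] /=.
  rewrite big_nil /pellet size_poly1 /pellet_sign bin0n muln0 expr0 mul1r /jacobi /root_res.
  have -> : rts iota 1 = [::].
    by apply: size0nil; rewrite size_rts ?monic1 // size_poly1.
  by rewrite big_nil expr1n /sgnK oner_eq0 eqxx.
move=> /andP[mQ ms]; have /monirrP[monQ iQ] := mQ.
rewrite big_cons (pelletM iota cardF charF) ?monic_prod_all // IH // (pellet_irr iota cardF charF) //.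
case: (boolP (Q \in s)) => Qs /=.
  have -> : coprimep Q (\prod_(R <- s) R) = false; last by rewrite mulr0.
  rewrite irreducible_poly_coprime //; apply/negbTE; rewrite negbK.
  exact: dvdp_prod_mem.
rewrite monirr_coprime_prod // mulr1; case: uniq; by rewrite ?mulr0 // exprS.
Qed.

(** Both sides vanish on non-squarefree polynomials, and are multiplicative on
    coprime factors with value -1 at primes. *)
Lemma poly_mu_pellet f : f \is monic -> poly_mu f = pellet iota hq f.
Proof.
by move=> /monic_factor[s [ms ->]]; rewrite poly_mu_prod // pellet_prod.
Qed.
End Factor.

(** * Averaging over cubes *)

Section GoodAverage.
Variable F : finFieldType.
Variables (K : closedFieldType) (iota : {rmorphism F -> K}) (hq : nat).
Hypothesis cardF : #|F| = hq.*2.+1.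
Hypothesis charF : [pchar F].-nat #|F|.
Hypothesis char3 : 3%N \in [pchar F].
Local Notation q := #|F|.
Local Notation chi := (jacobi_prod iota hq).
Local Notation jac := (jacobi iota hq).
Implicit Types (f g Q P D : {poly F}) (s t : seq {poly F}).

Lemma chi_jac s f : all (@monirr F) s -> jac f (\prod_(Q <- s) Q) = chi s f.
Proof.
elim: s => [_|Q s IH] /=.
  rewrite /jacobi_prod !big_nil /jacobi /root_res.
  have -> : rts iota 1 = [::] by apply: size0nil; rewrite size_rts ?monic1 // size_poly1.
  by rewrite big_nil expr1n /sgnK oner_eq0 eqxx.
move=> /andP[mQ ms]; rewrite /jacobi_prod !big_cons (jacMr iota cardF charF) ?(monirr_monic mQ) ?monic_prod_all //.
by rewrite IH.
Qed.

Lemma jac_const f (c : F) : f \is monic ->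
  jac c%:P f = sgnK ((iota c ^+ (size f).-1) ^+ hq).
Proof. by move=> mf; rewrite /jacobi res_const. Qed.

(** By Pellet's formula mu(f) is a sign times (P/f)^e (c/f) (prod s/f).
    Reciprocity inverts the first and last symbols; (f/P) = 1 as f = 1 mod P,
    and (c/f) depends only on deg f = N. So ep does not depend on f. *)
Lemma mu_jac P e D s (c : F) N : P \is monic -> D = c *: \prod_(Q <- s) Q -> c != 0 ->
  all (@monirr F) s ->
  exists ep : int, (`|ep| = 1)%N /\ forall f, f \is monic -> size f = N.+1 ->
    f^`() = P ^+ e * D -> ((0 < e)%N -> P %| f - 1) -> poly_mu f = ep * chi s f.
Proof.
move=> mP ED c0 ms.
pose sP : int := (-1) ^+ ((size P).-1 * N * hq).
pose sD : int := (-1) ^+ ((size (\prod_(Q <- s) Q)%R).-1 * N * hq).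
pose sc := sgnK ((iota c ^+ N) ^+ hq).
exists (pellet_sign hq N * sP ^+ e * sc * sD); split.
  have sgn1 k : `|((-1) ^+ k : int)|%N = 1%N by rewrite abszX exp1n.
  rewrite !abszM abszX /pellet_sign /sP /sD !sgn1 exp1n !mul1n muln1 /sc /sgnK.
  by rewrite !expf_eq0 fmorph_eq0 (negPf c0) !andbF /=; case: ifP.
move=> f mf sf Ef HP; rewrite (poly_mu_pellet iota cardF charF mf) /pellet sf /= -!mulrA; congr (_ * _).
have mD := monic_prod_all ms.
rewrite Ef (jacMl iota cardF charF) // ED -mul_polyC (jacMl iota cardF charF) // jac_const // sf /=.
rewrite -/sc (jac_recip iota cardF charF mD mf) sf /= -/sD chi_jac //.
suff -> : jac (P ^+ e) f = sP ^+ e by ring.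
case: e Ef HP => [|e] Ef HP; first by rewrite !expr0 jac1.
have : jac P f = sP.
  rewrite (jac_recip iota cardF charF mP mf) sf /= -/sP.
  by rewrite (jac_mod iota hq mP (HP isT)) jac1 mulr1.
move=> EP; elim: e.+1 => [|k IH]; first by rewrite !expr0 jac1.
by rewrite !exprS (jacMl iota cardF charF) // EP IH.
Qed.

Lemma cubeB (a b : {poly F}) : a ^+ 3 - b ^+ 3 = (a - b) ^+ 3.
Proof.
have c3 : [pchar {poly F}].-nat 3.
  by rewrite (eq_pnat _ (pchar_lalg {poly F})) pnatE // .
by rewrite exprDn_pchar // exprNn_pchar.
Qed.

Lemma prime_dvd_cube Q (a : {poly F}) : monirr Q -> Q %| a ^+ 3 -> Q %| a.
Proof.
move=> /monirrP[_ iQ]; apply: contraTT => nd.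
by rewrite -irreducible_poly_coprime // coprimep_expr // irreducible_poly_coprime.
Qed.

Lemma prod_dvd_all t (a : {poly F}) : uniq t -> all (@monirr F) t ->
  {in t, forall Q : {poly F}, Q %| a} -> \prod_(Q <- t) Q %| a.
Proof.
elim: t => [|Q t IH] /=; first by rewrite big_nil dvd1p.
move=> /andP[Qt ut] /andP[mQ mt] H; rewrite big_cons Gauss_dvdp ?monirr_coprime_prod //.
by rewrite H ?mem_head // IH // => R Rt; apply: H; rewrite inE Rt orbT.
Qed.

(** Cubing is additive, and injective modulo a product of distinct
    primes, hence bijective on residues. *)
Lemma cube_root_mod t (W f0 : {poly F}) : uniq t -> all (@monirr F) t ->
  {in t, forall Q : {poly F}, ~~ (Q %| W)} ->
  exists y, {in t, forall Q : {poly F}, Q %| f0 - (W * y) ^+ 3}.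
Proof.
move=> ut mt HW; set M := \prod_(Q <- t) Q.
have monM : M \is monic by exact: monic_prod_all.
have M0 := monic_neq0 monM.
have sM : (size M).-1 = degs t by exact: size_prod_degs.
have szm z : z %% M \in polys F (degs t).
  by rewrite mem_polys -sM -ltnS prednK ?size_poly_gt0 // ltn_modp.
pose ph (y : {poly F}) := (W * y) ^+ 3 %% M.
have inj : {in polys F (degs t) &, injective ph}.
  move=> y z Hy Hz E; apply/eqP; rewrite -subr_eq0; apply: contraT => nz.
  have D : M %| (W * (y - z)) ^+ 3.
    by rewrite mulrBr -cubeB /dvdp modpD modpN -/(ph y) -/(ph z) E subrr.
  have D2 : M %| y - z.
    apply: prod_dvd_all => // Q Qt.
    have mQ := allP mt _ Qt.
    have : Q %| W * (y - z) by apply: prime_dvd_cube => //; apply: dvdp_trans D; exact: dvdp_prod_mem.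
    have /monirrP[_ iQ] := mQ.
    by rewrite Gauss_dvdpr // irreducible_poly_coprime // HW.
  have := dvdp_leq nz D2; have := polysB Hy Hz; rewrite mem_polys -sM => H1 H2.
  have := leq_trans H2 H1; move: M0; rewrite -size_poly_gt0; by case: (size M) => // k _; rewrite ltnn.
have um : uniq (map ph (polys F (degs t))) by rewrite map_inj_in_uniq ?polys_uniq.
have sub : {subset map ph (polys F (degs t)) <= polys F (degs t)}.
  by move=> _ /mapP[y _ ->]; exact: szm.
have [_ E] := uniq_min_size um sub (eq_leq (esym (size_map _ _))).
have : f0 %% M \in map ph (polys F (degs t)) by rewrite E szm.
case/mapP => y _ Ey; exists y => Q Qt; apply: dvdp_trans (dvdp_prod_mem Qt) _.
by rewrite /dvdp modpD modpN Ey -/(ph y) subrr.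
Qed.

Lemma average_shift (phi : {poly F} -> int) h h0 C B : (h <= h0)%N ->
  (forall y, C * `|(\sum_(c <- polys F h) phi (y + c))%R| <= B * q ^ h)%N ->
  forall y, (C * `|(\sum_(c <- polys F h0) phi (y + c))%R| <= B * q ^ h0)%N.
Proof.
move=> hh H y.
have sub c : c \in polys F h -> c \in polys F h0.
  by rewrite !mem_polys => /leq_trans; apply.
have E : (q ^ h)%:Z * \sum_(c <- polys F h0) phi (y + c) =
   \sum_(c0 <- polys F h0) \sum_(c <- polys F h) phi (y + c0 + c).
  rewrite exchange_big /= [RHS](eq_big_seq (fun _ => \sum_(c <- polys F h0) phi (y + c))).
    by rewrite big_const_seq count_predT iter_addr_0 size_polys -mulr_natl natz.
  move=> c /sub ch; rewrite -[RHS](sum_polys_shift _ ch) /=.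
  by apply: eq_bigr => c0 _; rewrite addrA.
have qp : (0 < q ^ h)%N by rewrite expn_gt0 ltnW ?card_finNzRing_gt1.
rewrite -(leq_pmul2l qp) mulnCA -[X in (C * (X * _))%N]absz_nat -abszM E.
apply: (@leq_trans (\sum_(c0 <- polys F h0) C * `|(\sum_(c <- polys F h) phi (y + c0 + c))%R|)%N).
  by rewrite -big_distrr leq_mul2l abs_sum_le orbT.
apply: (@leq_trans (\sum_(c0 <- polys F h0) B * q ^ h)%N).
  by apply: leq_sum => c0 _; exact: H.
by rewrite big_const_seq count_predT iter_addn_0 size_polys mulnAC mulnC.
Qed.
End GoodAverage.

Section Parts.
Variable F : finFieldType.
(** A factorization s splits according to the degree of the primes, at most j
    or not, and the large primes according to the parity of their
    multiplicities. *)
Definition small_part (s : seq {poly F}) j := [seq Q : {poly F} <- undup s | ((size Q).-1 <= j)%N].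
Definition odd_part (s : seq {poly F}) j :=
  [seq Q : {poly F} <- undup s | (j < (size Q).-1)%N && odd (count_mem Q s)].
Definition even_part (s : seq {poly F}) j :=
  [seq Q : {poly F} <- undup s | (j < (size Q).-1)%N && ~~ odd (count_mem Q s)].
End Parts.

Section GoodSum.
Variable F : finFieldType.
Variables (K : closedFieldType) (iota : {rmorphism F -> K}) (hq : nat).
Hypothesis cardF : #|F| = hq.*2.+1.
Hypothesis charF : [pchar F].-nat #|F|.
Hypothesis char3 : 3%N \in [pchar F].
Local Notation q := #|F|.
Local Notation chi := (jacobi_prod iota hq).
Local Notation jac := (jacobi iota hq).
Implicit Types (f g Q P D : {poly F}) (s t : seq {poly F}).

Lemma jac_expn f Q k : (0 < k)%N -> jac f Q ^+ k = if odd k then jac f Q else jac f Q ^+ 2.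
Proof.
move=> k0; have E : jac f Q ^+ 3 = jac f Q.
  by case: (jac_values iota hq f Q) => ->.
have H m : jac f Q ^+ m.*2.+1 = jac f Q.
  by elim: m => [|m IH] //; rewrite doubleS -(addn2 m.*2.+1) exprD IH -exprS E.
rewrite -[k in LHS]odd_double_half; case: (boolP (odd k)) => ok; first by rewrite add1n H.
rewrite add0n; have : (0 < k./2)%N by case: k k0 ok => [|[|k]].
by case: (k./2) => // m _; rewrite doubleS exprS H expr2.
Qed.

Lemma chi_split s j f : chi s f =
  chi [seq Q : {poly F} <- s | ((size Q).-1 <= j)%N] f * chi (odd_part s j) f
   * \prod_(Q <- even_part s j) jac f Q ^+ 2.
Proof.
rewrite /jacobi_prod (bigID (fun Q : {poly F} => ((size Q).-1 <= j)%N)) /= big_filter -mulrA; congr (_ * _).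
rewrite -big_undup_iterop_count /=.
rewrite /odd_part /even_part !big_filter.
have cnt (Q : {poly F}) : Q \in undup s -> (0 < count_mem Q s)%N.
  by rewrite mem_undup -has_count has_pred1.
rewrite (bigID (fun Q : {poly F} => odd (count_mem Q s))) /=; congr (_ * _).
  rewrite big_seq_cond [RHS]big_seq_cond; apply: eq_big => [Q|Q]; first by rewrite ltnNge.
  by move=> /and3P[Qs _ oQ]; rewrite -[LHS]/(_ ^+ _) jac_expn ?cnt // oQ.
rewrite big_seq_cond [RHS]big_seq_cond; apply: eq_big => [Q|Q]; first by rewrite ltnNge.
by move=> /and3P[Qs _ oQ]; rewrite -[LHS]/(_ ^+ _) jac_expn ?cnt // (negPf oQ).
Qed.

Lemma mem_parts s j Q : Q \in odd_part s j ++ even_part s j -> Q \in s /\ (j < (size Q).-1)%N.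
Proof.
by rewrite mem_cat !mem_filter mem_undup => /orP[] /andP[/andP[-> _] ->].
Qed.

Variables (s : seq {poly F}) (j ne h h0 C B : nat) (W f0 : {poly F}).
Hypothesis ms : all (@monirr F) s.
Hypothesis Wsmall : {in s, forall Q : {poly F}, ((size Q).-1 <= j)%N -> Q %| W}.
Hypothesis Wlarge : {in s, forall Q : {poly F}, (j < (size Q).-1)%N -> ~~ (Q %| W)}.
Hypothesis sizeE : (size (even_part s j) <= ne)%N.
Hypothesis hh0 : (h <= h0)%N.
Hypothesis burg : forall y, (C * `|(\sum_(c <- polys F h) chi (odd_part s j) (y + c))%R| <= B * q ^ h)%N.
Let fc (c : {poly F}) := f0 + (W * c) ^+ 3.

Let m_odd : all (@monirr F) (odd_part s j).
Proof. by apply/allP => Q; rewrite mem_filter mem_undup => /andP[_]; exact: (allP ms). Qed.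

Let odd_in Q : Q \in odd_part s j -> Q \in s /\ (j < (size Q).-1)%N.
Proof. by move=> H; apply: mem_parts; rewrite mem_cat H. Qed.

(** With f0 = (W y)^3 modulo each prime Q of the odd part, additivity of the cube
    gives f0 + (W c)^3 = (W (y + c))^3 mod Q, and the symbol, having values
    0, 1, -1, equals its cube. *)
Lemma odd_part_sum : (C * `|(\sum_(c <- polys F h0) chi (odd_part s j) (fc c))%R| <= B * q ^ h0)%N.
Proof.
have nW : {in odd_part s j, forall Q : {poly F}, ~~ (Q %| W)}.
  by move=> Q /odd_in[Qs jQ]; exact: Wlarge.
have uo : uniq (odd_part s j) by rewrite filter_uniq // undup_uniq.
have [y Hy] := cube_root_mod char3 f0 uo m_odd nW.
have E c : chi (odd_part s j) (fc c) = chi (odd_part s j) W * chi (odd_part s j) (y + c).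
  rewrite -(chi_cube iota hq _ (_ + c)) -(chi_cube iota hq _ W) -exprMn.
  rewrite -!(chiM iota cardF charF) // !exprS expr0 mulr1 -!(chiM iota cardF charF) //.
  apply: chi_mod => // Q Qt; rewrite /fc.
  have -> : f0 + (W * c) ^+ 3 - W * (y + c) * (W * (y + c) * (W * (y + c)))
     = (f0 - (W * y) ^+ 3) + ((W * y) ^+ 3 + (W * c) ^+ 3 - (W * (y + c)) ^+ 3) by ring.
  have -> : (W * (y + c)) ^+ 3 = (W * y) ^+ 3 + (W * c) ^+ 3.
    by rewrite mulrDr -[in LHS](opprK (W * c)) -(cubeB char3) exprNn_pchar ?opprK // (eq_pnat _ (pchar_lalg {poly F})) pnatE.
  by rewrite subrr addr0 Hy.
under eq_bigr => c _ do rewrite E.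
rewrite -mulr_sumr abszM (chi_unit iota cardF) ?mul1n //.
  by have := average_shift hh0 burg y.
move=> Q Qt; have /monirrP[_ iQ] := allP m_odd _ Qt.
by rewrite coprimep_sym irreducible_poly_coprime // nW.
Qed.

(** The small primes divide W, so their symbols do not depend on c; the primes of
    even multiplicity contribute the factor 1 unless they divide f0 + (W c)^3,
    which happens for a proportion at most q^-j of the c. *)
Lemma good_sum : (C * `|(\sum_(c <- polys F h0) chi s (fc c))%R| <= B * q ^ h0 + C * (ne * q ^ (h0 - j)))%N.
Proof.
pose E (c : {poly F}) := \prod_(Q <- even_part s j) jac (fc c) Q ^+ 2.
pose S := \sum_(c <- polys F h0) chi (odd_part s j) (fc c) * E c.
have sm c : chi [seq Q : {poly F} <- s | ((size Q).-1 <= j)%N] (fc c) =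
            chi [seq Q : {poly F} <- s | ((size Q).-1 <= j)%N] f0.
  apply: chi_mod => [|Q]; first by apply/allP => Q; rewrite mem_filter => /andP[_]; exact: (allP ms).
  rewrite mem_filter => /andP[jQ Qs]; rewrite /fc addrAC subrr add0r exprS.
  by apply: dvdp_mulr; apply: dvdp_mulr; exact: Wsmall.
have H1 : (`|(\sum_(c <- polys F h0) chi s (fc c))%R| <= `|S|)%N.
  have -> : \sum_(c <- polys F h0) chi s (fc c) = chi [seq Q : {poly F} <- s | ((size Q).-1 <= j)%N] f0 * S.
    rewrite /S mulr_sumr; apply: eq_bigr => c _.
    by rewrite (chi_split _ j) sm mulrA.
  by rewrite abszM; apply: leq_trans (leq_mul (abs_chi _ _ _ _) (leqnn _)) _; rewrite mul1n.
have E01 c : E c = (all (fun Q => coprimep (fc c) Q) (even_part s j))%:R.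
  rewrite /E; have : all (@monirr F) (even_part s j).
    by apply/allP => Q; rewrite mem_filter mem_undup => /andP[_]; exact: (allP ms).
  elim: (even_part s j) => [|Q t IH] /=; first by rewrite big_nil.
  move=> /andP[mQ mt]; rewrite big_cons IH // (jac_sq iota cardF) ?(monirr_monic mQ) //.
  by case: coprimep; case: all.
have H2 : (`|S| <= `|(\sum_(c <- polys F h0) chi (odd_part s j) (fc c))%R| +
    count (fun c => has (fun Q : {poly F} => (Q %| fc c)%R) (even_part s j)) (polys F h0))%N.
  rewrite -sum1_count [X in (_ <= _ + X)%N]big_mkcond.
  have tri (u w : int) : (`|w| <= `|u| + `|(u - w)%R|)%N by lia.
  apply: leq_trans (tri (\sum_(c <- polys F h0) chi (odd_part s j) (fc c)) S) _.
  rewrite leq_add2l /S -sumrB; apply: leq_trans (abs_sum_le _ _) _; apply: leq_sum => c _.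
  rewrite E01; case: allP => H; first by rewrite mulr1 subrr.
  rewrite mulr0 subr0; apply: leq_trans (abs_chi _ _ _ _) _.
  case: hasP => // H'; case: H => Q Qe.
  have Qs : Q \in s by have [] := mem_parts (j := j) (s := s) (Q := Q); rewrite // mem_cat Qe orbT.
  have /monirrP[_ iQ] := allP ms _ Qs.
  rewrite coprimep_sym irreducible_poly_coprime //; apply/negP => d.
  by case: H'; exists Q.
have H3 : (count (fun c => has (fun Q : {poly F} => (Q %| fc c)%R) (even_part s j)) (polys F h0) <= ne * q ^ (h0 - j))%N.
  apply: (@leq_trans (\sum_(Q <- even_part s j) count (fun c => (Q %| fc c)%R) (polys F h0))).
    elim: (polys F h0) => [|c u IH] /=; first by rewrite big1.
    rewrite big_split /= leq_add //; case: hasP => // -[Q Qt Qc].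
    by rewrite (big_rem Q) //= Qc.
  apply: (@leq_trans (\sum_(Q <- even_part s j) q ^ (h0 - j))).
    rewrite big_seq [X in (_ <= X)%N]big_seq; apply: leq_sum => Q Qe.
    have [Qs jQ] : Q \in s /\ (j < (size Q).-1)%N by apply: mem_parts; rewrite mem_cat Qe orbT.
    have mQ := allP ms _ Qs; have /monirrP[_ iQ] := mQ.
    apply: (class_count (Q := Q)) => [|c1 c2 _ _ d1 d2]; first by apply: leq_trans jQ (leq_pred _).
    have D : Q %| (W * (c1 - c2)) ^+ 3.
      have := dvdp_sub d1 d2; rewrite /fc opprD addrACA subrr add0r.
      by rewrite (cubeB char3) -mulrBr.
    have := prime_dvd_cube mQ D; rewrite Gauss_dvdpr // irreducible_poly_coprime //.
    exact: Wlarge.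
  by rewrite big_const_seq count_predT iter_addn_0 mulnC leq_mul2r sizeE orbT.
apply: leq_trans (leq_mul (leqnn C) H1) _.
apply: leq_trans (leq_mul (leqnn C) H2) _.
rewrite mulnDr leq_add ?odd_part_sum // leq_mul2l H3 orbT //.
Qed.
End GoodSum.

(** * Exceptional polynomials *)

Section Irrs.
Variable F : finFieldType.
Local Notation q := #|F|.
Implicit Types (f g Q P D : {poly F}) (s t : seq {poly F}).

Definition irrs j := [seq Q : {poly F} <- polys F j.+1 | monirr Q].

Lemma irrs_uniq j : uniq (irrs j). Proof. by rewrite filter_uniq ?polys_uniq. Qed.

Lemma mem_irrs j Q : (Q \in irrs j) = monirr Q && ((size Q).-1 <= j)%N.
Proof.
by rewrite mem_filter mem_polys; congr (_ && _); case: (size Q).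
Qed.

Lemma card_dvd_monics Q j : Q \is monic -> ((size Q).-1 <= j)%N ->
  (q ^ (j - (size Q).-1) <= count (fun f : {poly F} => (Q %| f)%R) (monics F j))%N.
Proof.
move=> mQ Qj; rewrite -(size_monics F) -(size_map (fun f => Q * f)) -size_filter.
have Q0 := monic_neq0 mQ.
apply: uniq_leq_size; first by rewrite map_inj_uniq ?monics_uniq //; exact: mulfI.
move=> _ /mapP[f + ->]; rewrite mem_filter !mem_monics dvdp_mulIl /= => /andP[mf /eqP sf].
rewrite monicMl // mf size_monicM ?(monic_neq0 mf) // sf.
by move: Q0 Qj; rewrite -size_poly_gt0; case: (size Q) => // k _ /= kj; rewrite addnS subnKC.
Qed.

Lemma sum_uniq_sub (T : eqType) (A B : seq T) (w : T -> nat) : uniq A -> uniq B -> {subset A <= B} ->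
  (\sum_(x <- A) w x = \sum_(x <- B) w x * (x \in A))%N.
Proof.
move=> uA uB AB.
have -> : (\sum_(x <- B) w x * (x \in A) = \sum_(x <- B | x \in A) w x)%N.
  by rewrite [RHS]big_mkcond; apply: eq_bigr => x _; case: ifP; rewrite ?muln1 ?muln0.
rewrite -[RHS]big_filter; apply: perm_big; apply: uniq_perm; rewrite ?filter_uniq //.
by move=> x; rewrite mem_filter; case: (boolP (x \in A)) => // /AB ->.
Qed.

(** Chebyshev's form of Mertens' theorem: count the pairs (Q, f) with f monic of
    degree j divisible by Q, weighted by deg Q; the primes dividing a given
    f have total degree at most j. *)
Lemma sum_irr_deg_le j : (\sum_(Q <- irrs j) (size Q).-1 * q ^ (j - (size Q).-1) <= j * q ^ j)%N.
Proof.
apply: (@leq_trans (\sum_(f <- monics F j) \sum_(Q <- irrs j) (size Q).-1 * (Q %| f)%R)); last first.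
  rewrite -(size_monics F j) -sum1_size big_distrr /= big_seq [X in (_ <= X)%N]big_seq.
  apply: leq_sum => f; rewrite mem_monics muln1 => /andP[mf /eqP sf].
  have -> : (\sum_(Q <- irrs j) (size Q).-1 * (Q %| f)%R = degs [seq Q : {poly F} <- irrs j | (Q %| f)%R])%N.
    rewrite /degs big_filter [RHS]big_mkcond; apply: eq_bigr => Q _.
    by case: ifP; rewrite ?muln1 ?muln0.
  have mt : all (@monirr F) [seq Q : {poly F} <- irrs j | (Q %| f)%R].
    by apply/allP => Q; rewrite mem_filter mem_irrs => /and3P[].
  rewrite -size_prod_degs //; apply: (@leq_trans (size f).-1); last by rewrite sf.
  have : (size (\prod_(R <- [seq Q : {poly F} <- irrs j | (Q %| f)%R]) R)%R <= size f)%N.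
    apply: dvdp_leq; first exact: monic_neq0.
    apply: prod_dvd_all => //; first by rewrite filter_uniq // irrs_uniq.
    by move=> Q; rewrite mem_filter => /andP[].
  by rewrite -!subn1; exact: leq_sub2r.
rewrite exchange_big /= big_seq [X in (_ <= X)%N]big_seq.
apply: leq_sum => Q; rewrite mem_irrs => /andP[mQ Qj].
rewrite -big_distrr leq_mul2l; apply/orP; right.
apply: leq_trans (card_dvd_monics (monirr_monic mQ) Qj) _.
by rewrite -sum1_count [X in (X <= _)%N]big_mkcond; apply: leq_sum => f _; case: ifP.
Qed.

End Irrs.

Section BadCount.
Variable F : finFieldType.
Variables (K : closedFieldType) (iota : {rmorphism F -> K}) (hq : nat).
Hypothesis cardF : #|F| = hq.*2.+1.
Hypothesis charF : [pchar F].-nat #|F|.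
Local Notation q := #|F|.
Implicit Types (f g Q D : {poly F}) (s : seq {poly F}).

Lemma irr_factors_ex D : exists s, all (@monirr F) s /\
  (if D == 0 then s = [::] else D = lead_coef D *: \prod_(Q <- s) Q).
Proof.
case: (eqVneq D 0) => [_|D0]; first by exists [::].
have lc0 : lead_coef D != 0 by rewrite lead_coef_eq0.
have mD : (lead_coef D)^-1 *: D \is monic by rewrite monicE lead_coefZ mulVf.
have [s [ms E]] := monic_factor mD.
by exists s; rewrite -E scalerA mulfV // scale1r.
Qed.

(** The irreducible factors with multiplicities; the empty list for D = 0. *)
Definition irr_factors D := projT1 (cid (irr_factors_ex D)).

Lemma irr_factors_spec D : all (@monirr F) (irr_factors D) /\
  (if D == 0 then irr_factors D = [::] else D = lead_coef D *: \prod_(Q <- irr_factors D) Q).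
Proof. exact: projT2 (cid (irr_factors_ex D)). Qed.

Lemma irr_factorsP D : D != 0 -> all (@monirr F) (irr_factors D) /\ D = lead_coef D *: \prod_(Q <- irr_factors D) Q.
Proof. by move=> D0; have := irr_factors_spec D; rewrite (negPf D0). Qed.

Lemma irr_factors0 : irr_factors 0 = [::].
Proof. by have := irr_factors_spec 0; rewrite eqxx => -[]. Qed.

Lemma irr_factors_monirr D : all (@monirr F) (irr_factors D).
Proof.
by have [] := irr_factors_spec D.
Qed.

Lemma irr_factors_dvd D Q : Q \in irr_factors D -> Q %| D.
Proof.
case: (eqVneq D 0) => [->|D0] Qs; first by rewrite dvdp0.
have [_ ->] := irr_factorsP D0; rewrite dvdpZr ?lead_coef_eq0 //; exact: dvdp_prod_mem.
Qed.

Variables (P : {poly F}) (n2 : nat).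
Hypothesis mP : monirr P.
Local Notation p := (size P).-1.

(** The polynomial D in f' = P^(3m) D. *)
Definition twisted_deriv g := (P ^+ n2 * g)^`().

Local Notation DD := twisted_deriv.

(** Irreducible polynomials over a finite field are separable; here this is read
    off from the nonvanishing of Pellet's symbol. *)
Lemma irr_coprime_deriv Q : monirr Q -> coprimep Q Q^`().
Proof.
move=> /monirrP[mQ iQ].
have := pellet_irr iota cardF charF mQ iQ; rewrite /pellet.
case: (boolP (coprimep Q Q^`())) => // nc; move: nc; rewrite coprimep_sym.
by rewrite -(jac_eq0 iota cardF _ mQ) => /eqP ->; rewrite mulr0.
Qed.

(** Suppose that g1 and g2 are congruent modulo
    Q, agree on coefficients from 2 deg Q on, and that Q divides both
    derivatives. Then their difference w is divisible by Q, and so is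
    (P^n2 w)'; since Q is separable and prime to P, Q^2 divides w, which
    is too small unless it is 0. *)
Lemma count_dvd Q (d : nat) : monirr Q -> Q != P -> (2 * (size Q).-1 <= d)%N ->
  (count (fun g => (Q %| DD g)%R) (monics F d) <= q ^ (d - (size Q).-1))%N.
Proof.
move=> mQ QP Qd; have /monirrP[monQ iQ] := mQ; have Q0 := monic_neq0 monQ.
set k := (size Q).-1 in Qd *.
have sQ : size Q = k.+1 by rewrite prednK ?size_poly_gt0.
pose mp (w : {poly F}) := (('X^d + w) %% Q, drop_poly (2 * k) w).
rewrite count_map -size_filter.
pose tgt := prodseq (polys F k) (polys F (d - 2 * k)).
have <- : size tgt = (q ^ (d - k))%N by rewrite size_allpairs !size_polys -expnD; congr (_ ^ _)%N; lia.
rewrite -(size_map mp); apply: uniq_leq_size.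
  rewrite map_inj_in_uniq ?filter_uniq ?polys_uniq // => w1 w2.
  rewrite !mem_filter => /andP[/= D1 w1d] /andP[/= D2 w2d] [E1 E2].
  apply/eqP; rewrite -subr_eq0; set w := w1 - w2.
  have sw : (size w <= 2 * k)%N.
    have -> : w = take_poly (2 * k) w.
      by rewrite -[LHS](poly_take_drop (2 * k)) [X in _ + X * _]linearB /= E2 subrr mul0r addr0.
    exact: size_take_poly.
  have Ew : ('X^d + w1) - ('X^d + w2) = w by rewrite /w; ring.
  have Qw : Q %| w by rewrite -Ew /dvdp modpD modpN E1 subrr.
  have Dw : Q %| DD w.
    have -> : DD w = DD ('X^d + w1) - DD ('X^d + w2) by rewrite -derivB -mulrBr Ew.
    exact: dvdp_sub.
  case/dvdpP: Qw => v Ev.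
  have Qv : Q %| v.
    have E : DD w = (P ^+ n2 * v)^`() * Q + v * (P ^+ n2 * Q^`()).
      by rewrite /twisted_deriv Ev mulrA derivM; ring.
    have cop : coprimep Q (P ^+ n2 * Q^`()).
      by rewrite coprimepMr coprimep_expr ?irr_coprime_deriv ?monirr_coprime.
    move: Dw; rewrite E dvdp_addr ?dvdp_mulIr // Gauss_dvdpl //.
  apply: contraT => w0; have v0 : v != 0 by apply: contraNneq w0 => E; rewrite Ev E mul0r.
  have := dvdp_leq v0 Qv; have := sw; rewrite Ev size_mul // sQ.
  rewrite addnS /= => H1 H2; have := leq_trans (leq_add H2 (leqnn k)) H1.
  by rewrite mul2n -addnn addSn ltnn.
move=> _ /mapP[w + ->]; rewrite mem_filter mem_prodseq !mem_polys => /andP[_ wd].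
rewrite -ltnS -sQ ltn_modp Q0 /= size_drop_poly leq_sub2r //.
Qed.

Definition small_part_deg g j := degs (small_part (irr_factors (DD g)) j).

Local Notation small_deg := small_part_deg.

(** Markov's inequality: by [count_dvd] and [sum_irr_deg_le], the mean of the degree
    of the small part is at most p + j, the p accounting for the prime P. *)
Lemma count_large_small_part (j d t : nat) : (2 * j <= d)%N ->
  (t * count (fun g => t <= small_deg g j)%N (monics F d) <= (p + j) * q ^ d)%N.
Proof.
move=> jd.
apply: (@leq_trans (\sum_(g <- monics F d) small_deg g j)).
  rewrite -sum1_count big_distrr /= big_mkcond; apply: leq_sum => g _.
  by case: ifP => // tg; rewrite muln1.
have H g : (small_deg g j <= \sum_(Q <- irrs F j) (size Q).-1 * (Q %| DD g)%R)%N.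
  rewrite /small_part_deg /degs (sum_uniq_sub (B := irrs F j)).
  - apply: leq_sum => Q _; rewrite leq_mul2l; apply/orP; right.
    rewrite mem_filter mem_undup; case: (boolP (Q \in irr_factors (DD g))) => [/irr_factors_dvd ->|]; last by rewrite andbF.
    exact: leq_b1.
  - by rewrite filter_uniq // undup_uniq.
  - exact: irrs_uniq.
  - move=> Q; rewrite mem_filter mem_undup mem_irrs => /andP[-> Qs].
    by rewrite (allP (irr_factors_monirr _) _ Qs).
apply: leq_trans (leq_sum _ (fun g _ => H g)) _.
rewrite exchange_big /=.
have cE Q : (\sum_(g <- monics F d) (size Q).-1 * (Q %| DD g)%R =
   (size Q).-1 * count (fun g => (Q %| DD g)%R) (monics F d))%N.
  rewrite -big_distrr /= -sum1_count; congr (_ * _)%N; rewrite [RHS]big_mkcond.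
  by apply: eq_bigr => g _; case: ifP.
under eq_bigr => Q _ do rewrite cE.
rewrite (bigID (fun Q => Q == P)) /= mulnDl; apply: leq_add.
  rewrite big_mkcond /=.
  apply: (@leq_trans (\sum_(Q <- irrs F j) (Q == P) * (p * q ^ d))).
    apply: leq_sum => Q _; case: eqP => // ->; rewrite mul1n leq_mul2l.
    by rewrite -(size_monics F d) count_size orbT.
  rewrite -big_distrl /= -[X in (_ <= X)%N]mul1n leq_mul2r; apply/orP; right.
  have -> : (\sum_(Q <- irrs F j) (Q == P) = count_mem P (irrs F j))%N.
    by rewrite -sum1_count [RHS]big_mkcond; apply: eq_bigr => Q _ /=; case: eqP.
  by rewrite count_uniq_mem ?irrs_uniq // leq_b1.
have M := sum_irr_deg_le F j.
have qd : (q ^ d = q ^ j * q ^ (d - j))%N by rewrite -expnD subnKC //; lia.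
rewrite qd mulnA; apply: leq_trans (leq_mul M (leqnn _)); rewrite big_distrl /=.
rewrite big_mkcond big_seq [X in (_ <= X)%N]big_seq; apply: leq_sum => Q.
rewrite mem_irrs => /andP[mQ Qj]; case: ifP => // QP.
rewrite -mulnA leq_mul2l; apply/orP; right; rewrite -expnD.
apply: leq_trans (count_dvd mQ QP _) _; first by lia.
rewrite leq_pexp2l ?(q_gt0 cardF) //.
by move: Qj jd; move: (size Q).-1 => k; clear; lia.
Qed.
End BadCount.

Section BadSquare.
Variable F : finFieldType.
Hypothesis char3 : 3%N \in [pchar F].
Local Notation q := #|F|.
Implicit Types (f g Q D : {poly F}) (s : seq {poly F}).
Variables (P : {poly F}) (n2 : nat).
Hypothesis mP : monirr P.
Local Notation p := (size P).-1.
Local Notation DD := (twisted_deriv P n2).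
Local Notation small_deg := (small_part_deg P n2).

Let monP : P \is monic. Proof. exact: monirr_monic. Qed.

Lemma deriv0_coef (G : {poly F}) : G^`() = 0 -> forall k, ~~ (3 %| k)%N -> G`_k = 0.
Proof.
move=> G0 [|k] nk; first by rewrite dvdn0 in nk.
have := coef_deriv G k; rewrite G0 coef0 => /esym/eqP.
rewrite -mulr_natr mulf_eq0 -(dvdn_pcharf char3) (negPf nk) orbF => /eqP //.
Qed.

Lemma size_exp_monic (R : idomainType) (f : {poly R}) n : f != 0 -> size (f ^+ n) = (n * (size f).-1).+1.
Proof.
move=> f0; rewrite mulnC -size_exp prednK // size_poly_gt0 expf_neq0 //.
Qed.

Lemma size_Pg g d : g \in monics F d -> size (P ^+ n2 * g)%R = (n2 * p + d).+1.
Proof.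
rewrite mem_monics => /andP[mg /eqP sg].
by rewrite size_monicM ?monic_exp ?monic_neq0 // sg size_exp_monic ?monic_neq0 // addnS.
Qed.

(** If two g have the same derivative D, the difference of the P^n2 g is a
    polynomial in X^3, determined by a third of its coefficients. *)
Lemma fibre_count d D0 :
  (count (fun g => DD g == D0) (monics F d) <= q ^ ((n2 * p + d) %/ 3).+1)%N.
Proof.
set e := (n2 * p + d)%N; rewrite -size_filter -(size_polys F).
pose mp (g : {poly F}) := \poly_(i < (e %/ 3).+1) (P ^+ n2 * g)`_(3 * i).
rewrite -(size_map mp); apply: uniq_leq_size; last first.
  by move=> _ /mapP[g _ ->]; rewrite mem_polys size_poly.
rewrite map_inj_in_uniq ?filter_uniq ?monics_uniq // => g1 g2.
rewrite !mem_filter => /andP[/eqP D1 m1] /andP[/eqP D2 m2] E.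
have G0 : (P ^+ n2 * (g1 - g2))^`() = 0.
  by rewrite mulrBr derivB -/(DD g1) -/(DD g2) D1 D2 subrr.
have Gz : P ^+ n2 * (g1 - g2) = 0.
  apply/polyP => k; rewrite coef0; case: (boolP (3 %| k)%N) => [/dvdnP[i]|]; last exact: deriv0_coef.
  rewrite mulnC => Ei.
  have := congr1 (fun f : {poly F} => f`_i) E; rewrite !coef_poly Ei mulrBr coefB.
  case: ltnP => Hi; first by move=> ->; rewrite subrr.
  have big g : g \in monics F d -> (P ^+ n2 * g)`_(3 * i) = 0.
    by move=> mg; rewrite nth_default // (size_Pg mg) -/e; lia.
  by rewrite !big // subrr.
apply/eqP; rewrite -subr_eq0; move/eqP: Gz; rewrite mulf_eq0 expf_eq0 (negPf (monic_neq0 monP)) andbF //.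
Qed.

Lemma odd_square_split s : all (@monirr F) s ->
  \prod_(Q <- s) Q = \prod_(Q <- [seq Q : {poly F} <- undup s | odd (count_mem Q s)]) Q
     * (\prod_(Q <- undup s) Q ^+ (count_mem Q s)./2) ^+ 2.
Proof.
move=> ms; rewrite -big_undup_iterop_count /= big_filter -prodrXl.
rewrite [X in _ = X * _]big_mkcond -big_split /=; apply: eq_bigr => Q _; rewrite -[LHS]/(Q ^+ _) -exprM muln2 -[in LHS](odd_double_half (count_mem Q s)) exprD.
by case: odd.
Qed.

(** If the odd part is empty, D is the product of a square and of the primes
    of odd multiplicity, which are small, of total degree less than t. The number
    of such D is at most q^(t + e/2), up to a constant, and each comes from at
    most q^(e/3) polynomials g. As 1/2 + 1/3 < 1, these are few. *)
Lemma count_trivial_odd_part d j (t : nat) (e := (n2 * p + d)%N) :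
  (count (fun g => (odd_part (irr_factors (DD g)) j == [::]) && (small_deg g j < t)%N) (monics F d)
    <= q ^ (t + (e %/ 2).+1 + (e %/ 3).+1))%N.
Proof.
pose im := [seq A * B ^+ 2 | A <- polys F t, B <- polys F (e %/ 2).+1].
have szim : size im = (q ^ (t + (e %/ 2).+1))%N by rewrite size_allpairs !size_polys expnD.
apply: (@leq_trans (\sum_(D0 <- im) count (fun g => DD g == D0) (monics F d))); last first.
  apply: (@leq_trans (\sum_(D0 <- im) q ^ (e %/ 3).+1)); first by apply: leq_sum => D0 _; exact: fibre_count.
  by rewrite big_const_seq count_predT iter_addn_0 szim mulnC -expnD.
have inim g : g \in monics F d -> (odd_part (irr_factors (DD g)) j == [::]) && (small_deg g j < t)%N -> DD g \in im.
  move=> mg /andP[/eqP O st].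
  case: (eqVneq (DD g) 0) => [->|D0].
    apply/allpairsP; exists (0, 0); rewrite /= !mem_polys size_poly0; split=> //.
    by rewrite mul0r.
  have [ms ED] := irr_factorsP D0; set s := irr_factors (DD g) in O ms ED.
  set oL := [seq Q : {poly F} <- undup s | odd (count_mem Q s)].
  have uL : uniq oL by rewrite filter_uniq // undup_uniq.
  have mL : all (@monirr F) oL by apply/allP => Q; rewrite mem_filter mem_undup => /andP[_]; exact: (allP ms).
  pose B := \prod_(Q <- undup s) Q ^+ (count_mem Q s)./2.
  have E := odd_square_split ms; rewrite -/oL -/B in E.
  have lc0 : lead_coef (DD g) != 0 by rewrite lead_coef_eq0.
  have S0 : B != 0.
    apply: contraNneq D0 => S0; rewrite ED E S0 expr0n /= mulr0 scaler0 //.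
  have L0 : \prod_(Q <- oL) Q != 0 by rewrite monic_neq0 // monic_prod_all.
  have subL : {subset oL <= small_part s j}.
    move=> Q; rewrite !mem_filter => /andP[oQ Qs]; rewrite Qs andbT leqNgt; apply/negP => jQ.
    have : Q \in odd_part s j by rewrite mem_filter jQ oQ Qs.
    by rewrite O.
  have dL : (degs oL < t)%N.
    apply: leq_ltn_trans st; rewrite /small_part_deg -/s /degs (sum_uniq_sub _ uL _ subL) ?filter_uniq ?undup_uniq //.
    by apply: leq_sum => Q _; case: (_ \in _); rewrite ?muln1 ?muln0.
  apply/allpairsP; exists (lead_coef (DD g) *: \prod_(Q <- oL) Q, B); split=> /=.
  - rewrite mem_polys size_scale //; have := size_prod_degs mL.
    by move: L0; rewrite -size_poly_gt0; case: (size _) => // k _ /= ->.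
  - have sD : (size (DD g) <= e)%N.
      rewrite -ltnS -(size_Pg mg); apply: lt_size_deriv.
      by rewrite -size_poly_gt0 (size_Pg mg).
    have : (size (B ^+ 2)%R <= e)%N.
      apply: leq_trans sD; apply: dvdp_leq => //.
      by rewrite ED dvdpZr // E dvdp_mulIr.
    rewrite size_exp_monic // mem_polys; move: S0; rewrite -size_poly_gt0.
    by move: (size B) => x; clear; lia.
  - by rewrite -scalerAl -E.
rewrite -sum1_count.
under [X in (_ <= X)%N]eq_bigr => D0 _ do rewrite -sum1_count big_mkcond /=.
rewrite exchange_big /= big_seq_cond [X in (X <= _)%N]big_mkcond [X in (_ <= X)%N]big_seq_cond [X in (_ <= X)%N]big_mkcond.
apply: leq_sum => g _; case: ifP => [/andP[mg Hg]|]; last by [].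
rewrite mg /= (big_rem _ (inim g mg Hg)) /= eqxx //.
Qed.
End BadSquare.

(** * The sum over polynomials of a given degree *)

Section Assembly.
Variable F : finFieldType.
Variables (K : closedFieldType) (iota : {rmorphism F -> K}) (hq : nat).
Hypothesis cardF : #|F| = hq.*2.+1.
Hypothesis charF : [pchar F].-nat #|F|.
Hypothesis char3 : 3%N \in [pchar F].
Local Notation q := #|F|.
Implicit Types (f g Q D : {poly F}) (s : seq {poly F}).
Variables (P : {poly F}).
Hypothesis mP : monirr P.
Local Notation p := (size P).-1.
Local Notation chi := (jacobi_prod iota hq).

Lemma deriv_cube (a : {poly F}) : (a ^+ 3)^`() = 0.
Proof. by rewrite deriv_exp -mulr_natr -polyC_natr (pcharf0 char3) mulr0. Qed.

Lemma deriv_cubeM (a b : {poly F}) : (a ^+ 3 * b)^`() = a ^+ 3 * b^`().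
Proof. by rewrite derivM deriv_cube mul0r add0r. Qed.

Lemma degs_sub s D : D != 0 -> uniq s -> all (@monirr F) s -> {in s, forall Q, Q %| D} ->
  (degs s <= (size D).-1)%N.
Proof.
move=> D0 us ms H; rewrite -size_prod_degs // -!subn1 leq_sub2r //.
by apply: dvdp_leq => //; exact: prod_dvd_all.
Qed.

Lemma size_mul_degs s j : {in s, forall Q, (j < (size Q).-1)%N} -> (j.+1 * size s <= degs s)%N.
Proof.
move=> H; rewrite mulnC -sum1_size big_distrl /= /degs big_seq [X in (_ <= X)%N]big_seq.
by apply: leq_sum => Q Qs; rewrite mul1n; exact: H.
Qed.

Variables (d n m n2 C e b0 j t h0 : nat).
Hypothesis n0 : (0 < n)%N.
Hypothesis En : n = (3 * m + n2)%N.
Hypothesis n22 : (n2 <= 2)%N.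
Hypothesis jdef : (d < e * j.+1)%N.
Hypothesis pj : (p <= j)%N.
Hypothesis b0j : (b0 <= j)%N.
Hypothesis jh0 : (j <= h0)%N.
Hypothesis Cej : (C * (2 * e) <= q ^ j)%N.
Hypothesis h0b : (2 * (d + 2 * p) %/ 7 <= h0)%N.
Hypothesis h0d : (4 * p + 3 * t + 3 * h0 <= d)%N.
Hypothesis pd : (2 * p <= d)%N.
Hypothesis burg : forall s, uniq s -> all (@monirr F) s -> (b0 <= degs s)%N ->
  {in s, forall Q : {poly F}, (degs s <= 2 * e * (size Q).-1)%N} ->
  forall y, (C * `|(\sum_(c <- polys F (2 * degs s %/ 7)) chi s (y + c))%R|
     <= 4 * q ^ (2 * degs s %/ 7))%N.

Local Notation DD := (twisted_deriv P n2).

(** Goodness and the multiplier of the shift are functions of D alone: as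
    the shift preserves D, this makes [cube_shift c] injective. On bad D the
    multiplier is 0, so that bad polynomials are fixed. *)
Definition goodD D := (odd_part (irr_factors D) j != [::]) && (degs (small_part (irr_factors D) j) < t)%N.
Definition shift_factor D : {poly F} := if goodD D then \prod_(Q <- small_part (irr_factors D) j) Q else 0.
Definition cube_shift (c g : {poly F}) : {poly F} := g + P ^+ (2 * n2) * (shift_factor (DD g) * c) ^+ 3.

Let monP : P \is monic. Proof. exact: monirr_monic. Qed.
Let p0 : (0 < p)%N.
Proof. by have /monirrP[_ [+ _]] := mP; case: (size P) => [|[]]. Qed.

Lemma DD_cube_shift c g : DD (cube_shift c g) = DD g.
Proof.
rewrite /twisted_deriv /cube_shift mulrDr derivD; set w := _ * c.
have -> : P ^+ n2 * (P ^+ (2 * n2) * w ^+ 3) = (P ^+ n2 * w) ^+ 3.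
  by rewrite mulrA -exprD [RHS]exprMn -exprM; congr (P ^+ _ * _); clear; lia.
by rewrite deriv_cube addr0.
Qed.

Lemma cube_shift_inj c : injective (cube_shift c).
Proof.
move=> g1 g2 E; have E2 : DD g1 = DD g2 by rewrite -(DD_cube_shift c g1) E DD_cube_shift.
by move: E; rewrite /cube_shift E2 => /addIr.
Qed.

Lemma small_monirr D : all (@monirr F) (small_part (irr_factors D) j).
Proof. by apply/allP => Q; rewrite mem_filter mem_undup => /andP[_]; exact: (allP (irr_factors_monirr _)). Qed.

Lemma cube_shift_monics c g : c \in polys F h0 -> g \in monics F d -> cube_shift c g \in monics F d.
Proof.
rewrite mem_polys !mem_monics => ch /andP[mg /eqP sg].
have : (size (P ^+ (2 * n2) * (shift_factor (DD g) * c) ^+ 3)%R < size g)%N.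
  case: (eqVneq (shift_factor (DD g) * c) 0) => [->|w0]; first by rewrite expr0n mulr0 size_poly0 sg.
  have [W0 c0] : shift_factor (DD g) != 0 /\ c != 0 by move: w0; rewrite mulf_eq0 negb_or => /andP[].
  rewrite size_monicM ?monic_exp ?expf_neq0 // !size_exp_monic ?(monic_neq0 monP) // size_mul //.
  have sw : (size (shift_factor (DD g)) <= t)%N.
    move: W0; rewrite /shift_factor; case: ifP => [/andP[_]|]; last by rewrite eqxx.
    rewrite -(size_prod_degs (small_monirr _)) => H W0.
    by move: H W0; rewrite -size_poly_gt0; case: (size _).
  have npp : (2 * n2 * p <= 4 * p)%N by rewrite leq_mul2r; apply/orP; right; move: n22; clear; lia.
  rewrite sg; move: ch sw c0 W0; rewrite -!size_poly_gt0; move: (size c) (size (shift_factor _)) => x y.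
  move: npp h0d; move: (2 * n2 * p)%N p => z z'; clear; lia.
by move=> lt; rewrite /cube_shift size_polyDl // sg eqxx andbT monicE lead_coefDl.
Qed.

Lemma sum_cube_shift (V : nmodType) (Phi : {poly F} -> V) c : c \in polys F h0 ->
  \sum_(g <- monics F d) Phi (cube_shift c g) = \sum_(g <- monics F d) Phi g.
Proof.
move=> ch; rewrite -(big_map (cube_shift c) predT Phi).
have um : uniq (map (cube_shift c) (monics F d)) by rewrite (map_inj_uniq (@cube_shift_inj c)) monics_uniq.
have sub : {subset map (cube_shift c) (monics F d) <= monics F d}.
  by move=> _ /mapP[g gm ->]; exact: cube_shift_monics.
have sz : (size (monics F d) <= size (map (cube_shift c) (monics F d)))%N by rewrite size_map.
apply: perm_big; apply: uniq_perm => //; first exact: monics_uniq.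
by have [_ H] := uniq_min_size um sub sz.
Qed.

Let mu1 g := poly_mu (1 + P ^+ n * g).

(** Along the orbit, 1 + P^n g runs through f0 + (W c)^3 with the same D, so the
    sign ep of [mu_jac] is constant and [good_sum] applies. *)
Lemma good_orbit g : g \in monics F d -> goodD (DD g) ->
  (C * `|(\sum_(c <- polys F h0) mu1 (cube_shift c g))%R| <= 5 * q ^ h0)%N.
Proof.
move=> gm good; have D0 : DD g != 0.
  by apply: contraTneq good => ->; rewrite /goodD /odd_part irr_factors0.
have [ms ED] := irr_factorsP D0; set s := irr_factors (DD g) in ms ED.
have lc0 : lead_coef (DD g) != 0 by rewrite lead_coef_eq0.
pose A := \prod_(Q <- small_part s j) Q.
have wA : shift_factor (DD g) = A by rewrite /shift_factor good.
pose f0 := 1 + P ^+ n * g; pose W := P ^+ (m + n2) * A.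
have fE c : 1 + P ^+ n * cube_shift c g = f0 + (W * c) ^+ 3.
  rewrite /cube_shift wA mulrDr addrA /f0; congr (_ + _).
  by rewrite mulrA -exprD -mulrA [in RHS]exprMn -exprM En; congr (P ^+ _ * _); clear; lia.
have [ep [ep1 Hep]] := mu_jac iota cardF charF (3 * m) (n * p + d) monP ED lc0 ms.
have muE c : c \in polys F h0 -> mu1 (cube_shift c g) = ep * chi s (f0 + (W * c) ^+ 3).
  move=> ch; have := cube_shift_monics ch gm; rewrite mem_monics => /andP[mg /eqP sg].
  have mPg : P ^+ n * cube_shift c g \is monic by rewrite monicMl ?monic_exp.
  have sPg : size (P ^+ n * cube_shift c g) = (n * p + d).+1.
    by rewrite size_monicM ?monic_exp ?monic_neq0 // sg size_exp_monic ?monic_neq0 // addnS.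
  have lt : (size (1 : {poly F})%R < size (P ^+ n * cube_shift c g)%R)%N.
    by rewrite size_poly1 sPg ltnS addn_gt0 muln_gt0 n0 p0.
  rewrite -fE; apply: Hep.
  - by rewrite addrC monicE lead_coefDl.
  - by rewrite addrC size_polyDl.
  - rewrite derivD derivC add0r {1}En exprD -mulrA mulnC exprM deriv_cubeM.
    by rewrite -/(DD (cube_shift c g)) DD_cube_shift.
  - by move=> _; rewrite addrAC subrr add0r -(prednK n0) exprS -mulrA dvdp_mulr.
rewrite (eq_big_seq _ muE) -mulr_sumr abszM ep1 mul1n.
have sD : ((size (DD g)).-1 <= d + 2 * p)%N.
  have : (size (DD g) <= (n2 * p + d))%N.
    rewrite -ltnS -(size_Pg n2 mP gm); apply: lt_size_deriv.
    by rewrite -size_poly_gt0 (size_Pg n2 mP gm).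
  have : (n2 * p <= 2 * p)%N by rewrite leq_mul2r n22 orbT.
  by move: (size (DD g)) (n2 * p)%N p => x y z; clear; lia.
have d_le s' : uniq s' -> {subset s' <= s} -> (degs s' <= d + 2 * p)%N.
  move=> us' ss'; apply: leq_trans sD; apply: degs_sub => //.
    by apply/allP => Q /ss'; exact: (allP ms).
  by move=> Q /ss'; exact: irr_factors_dvd.
have ej : (d + 2 * p <= 2 * e * j.+1)%N by rewrite -mulnA; move: jdef pd; move: (e * _)%N p; clear; lia.
have uo : uniq (odd_part s j) by rewrite filter_uniq // undup_uniq.
have so : {subset odd_part s j <= s} by move=> Q; rewrite mem_filter mem_undup => /andP[].
have lo : {in odd_part s j, forall Q, (j < (size Q).-1)%N} by move=> Q; rewrite mem_filter => /andP[/andP[]].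
have ue : uniq (even_part s j) by rewrite filter_uniq // undup_uniq.
have se : {subset even_part s j <= s} by move=> Q; rewrite mem_filter mem_undup => /andP[].
have le : {in even_part s j, forall Q, (j < (size Q).-1)%N} by move=> Q; rewrite mem_filter => /andP[/andP[]].
have mo : all (@monirr F) (odd_part s j) by apply/allP => Q /so; exact: (allP ms).
have sizeE : (size (even_part s j) <= 2 * e)%N.
  rewrite -(leq_pmul2l (ltn0Sn j)) [X in (_ <= X)%N]mulnC.
  exact: leq_trans (size_mul_degs le) (leq_trans (d_le _ ue se) ej).
have bo : (b0 <= degs (odd_part s j))%N.
  have := size_mul_degs lo; move/andP: good => [/negP on _].
  have : (0 < size (odd_part s j))%N by rewrite lt0n size_eq0; apply/negP.
  move: b0j; move: (size _) (degs _) => x y; clear; nia.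
have hh : (2 * degs (odd_part s j) %/ 7 <= h0)%N.
  apply: leq_trans h0b; apply: leq_div2r; rewrite leq_mul2l; exact: d_le.
have B : forall y, (C * `|(\sum_(c <- polys F (2 * degs (odd_part s j) %/ 7)) chi (odd_part s j) (y + c))%R|
     <= 4 * q ^ (2 * degs (odd_part s j) %/ 7))%N.
  apply: burg => // Q Qo; apply: leq_trans (d_le _ uo so) (leq_trans ej _).
  by rewrite leq_mul2l; apply/orP; right; exact: lo.
apply: leq_trans (good_sum cardF charF char3 f0 ms _ _ sizeE hh B) _.
- move=> Q Qs Qj; apply: dvdp_mull; apply: dvdp_prod_mem.
  by rewrite mem_filter Qj mem_undup.
- move=> Q Qs jQ; have mQ := allP ms _ Qs; have /monirrP[_ iQ] := mQ.
  have QP : Q != P by apply: contraTneq jQ => ->; rewrite -leqNgt.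
  have c1 : coprimep Q (P ^+ (m + n2)) by rewrite coprimep_expr // monirr_coprime.
  have c2 : coprimep Q A.
    apply: monirr_coprime_prod => //; first exact: small_monirr.
    by rewrite mem_filter negb_and -ltnNge jQ.
  by rewrite -irreducible_poly_coprime // coprimepMr c1 c2.
have E : (q ^ h0 = q ^ (h0 - j) * q ^ j)%N by rewrite -expnD subnK.
rewrite mulnA -[5%N]/(4 + 1)%N mulnDl mul1n leq_add2l.
by rewrite [X in (_ <= X)%N]E mulnC leq_mul2l Cej orbT.
Qed.

Hypothesis t0 : (0 < t)%N.
Hypothesis jd : (2 * j <= d)%N.
Hypothesis Cpj : (C * (p + j) <= t)%N.
Hypothesis Csq : (C * q ^ (t + ((n2 * p + d) %/ 2).+1 + ((n2 * p + d) %/ 3).+1) <= q ^ d)%N.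

Lemma few_bad_orbits : (C * count (fun g => ~~ goodD (DD g)) (monics F d) <= 2 * q ^ d)%N.
Proof.
have H1 := count_large_small_part iota cardF charF n2 mP t jd.
have H2 := count_trivial_odd_part char3 n2 mP d j t.
have H3 : (count (fun g => ~~ goodD (DD g)) (monics F d) <=
    count (fun g => t <= small_part_deg P n2 g j)%N (monics F d) +
    count (fun g => (odd_part (irr_factors (DD g)) j == [::]) && (small_part_deg P n2 g j < t)%N) (monics F d))%N.
  rewrite -count_predUI; apply: leq_trans (leq_addr _ _); apply: sub_count => g /=.
  by rewrite /goodD negb_and negbK -leqNgt /small_part_deg; case: leqP => //=; rewrite ?orbT ?orbF ?andbT.
have H4 : (C * count (fun g => t <= small_part_deg P n2 g j)%N (monics F d) <= q ^ d)%N.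
  rewrite -(leq_pmul2l t0) mulnCA; apply: leq_trans (leq_mul (leqnn C) H1) _.
  by rewrite mulnA leq_mul2r Cpj orbT.
apply: leq_trans (leq_mul (leqnn C) H3) _; rewrite mulnDr mul2n -addnn leq_add //.
by apply: leq_trans (leq_mul (leqnn C) H2) Csq.
Qed.

(** Since the shifts permute the monic polynomials of degree d, the sum equals
    the mean over c of the sums over orbits. *)
Lemma monic_sum_bound : (C * `|(\sum_(g <- monics F d) mu1 g)%R| <= 7 * q ^ d)%N.
Proof.
have qp : (0 < q ^ h0)%N by rewrite expn_gt0 (q_gt0 cardF).
rewrite -(leq_pmul2l qp).
have E : (q ^ h0)%:Z * \sum_(g <- monics F d) mu1 g =
    \sum_(g <- monics F d) \sum_(c <- polys F h0) mu1 (cube_shift c g).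
  rewrite exchange_big /= [RHS](eq_big_seq (fun _ => \sum_(g <- monics F d) mu1 g)).
    by rewrite big_const_seq count_predT iter_addr_0 size_polys -mulr_natl natz.
  by move=> c ch; rewrite sum_cube_shift.
rewrite mulnCA -[X in (C * (X * _))%N]absz_nat -abszM E.
apply: (@leq_trans (\sum_(g <- monics F d) (5 * q ^ h0 + C * q ^ h0 * ~~ goodD (DD g)))%N).
  apply: leq_trans (leq_mul (leqnn C) (abs_sum_le _ _)) _.
  rewrite big_distrr /= big_seq [X in (_ <= X)%N]big_seq; apply: leq_sum => g gm.
  case: (boolP (goodD (DD g))) => good; first by rewrite muln0 addn0 good_orbit.
  rewrite muln1; apply: leq_trans (leq_addl _ _); rewrite leq_mul2l; apply/orP; right.
  apply: leq_trans (abs_sum_le _ _) _; rewrite -(size_polys F h0) -sum1_size.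
  apply: leq_sum => c _; rewrite /mu1 /poly_mu; case: ifP => // _.
  by rewrite abszX exp1n.
rewrite big_split /= big_const_seq count_predT iter_addn_0 size_monics -big_distrr /=.
have -> : (\sum_(g <- monics F d) ~~ goodD (DD g) = count (fun g => ~~ goodD (DD g)) (monics F d))%N.
  by rewrite -sum1_count [RHS]big_mkcond; apply: eq_bigr => g _; case: (goodD _).
have H := leq_mul (leqnn (q ^ h0)) few_bad_orbits.
rewrite -[7%N]/(5 + 2)%N mulnDl mulnDr; apply: leq_add; first by rewrite mulnAC mulnC.
by rewrite -mulnA mulnCA.
Qed.
End Assembly.

(** Choice of parameters. Large primes have degree above j = d/e, so their
    number is at most 2e; t = d/30 bounds the degree of the small
    part, and h0, about (d - 3t)/3 = 3d/10, is the room left for c. Then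
    2/7 < 3/10, as Burgess' bound requires; Markov's inequality needs C j
    to be at most t, true for e = 60 C; and polynomials with trivial odd part have
    proportion q^(t + 5d/6 - d) = q^(-4d/30). *)
Lemma monic_sum_decay (F : finFieldType) (k : nat) (P : {poly F}) :
  (0 < k)%N -> #|F| = (3 ^ k)%N -> monirr P -> forall C, (0 < C)%N ->
  exists d0, forall d n, (d0 <= d)%N -> (0 < n)%N ->
    (C * `|(\sum_(g <- monics F d) poly_mu (1 + P ^+ n * g))%R| <= 7 * #|F| ^ d)%N.
Proof.
move=> k0 hF mP C C0; set q := #|F|.
have char3 : 3%N \in [pchar F] by exact: card_finPcharP hF _.
have charF : [pchar F].-nat q by rewrite /q hF pnatX pnatE // char3.
have cardF : q = q./2.*2.+1.
  by rewrite -[LHS]odd_double_half /q hF oddX /= orbT.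
have [K [iota _]] := countable_algebraic_closure F.
pose e := (60 * C)%N.
have e20 : (20 <= e)%N by rewrite /e; lia.
have [b0 burg] := burgess iota cardF charF C0 e20.
set p := (size P).-1.
exists (e * (p + b0 + C * (2 * e)) + 1000 * (p + 1) + 60 * (C * p + 1) + 60 * C)%N => d n dd n0.
have q2 : (1 < q)%N by exact: card_finNzRing_gt1.
have e0 : (0 < e)%N by rewrite /e; lia.
pose j := (d %/ e)%N; pose t := (d %/ 30)%N; pose h0 := ((d - 4 * p - 3 * t) %/ 3)%N.
have jd : (e * j <= d)%N by rewrite mulnC leq_trunc_div.
have jge x : (e * x <= d)%N -> (x <= j)%N by rewrite /j leq_divRL // mulnC.
have n22 : (n %% 3 <= 2)%N by rewrite -ltnS ltn_mod.
have En : n = (3 * (n %/ 3) + n %% 3)%N by rewrite mulnC -divn_eq.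
have Cj : (60 * (C * j) <= d)%N by rewrite mulnA.
have jC : (j <= C * j)%N by rewrite leq_pmull.
have pC : (p <= C * p)%N by rewrite leq_pmull.
have [E1 E2 E3] : [/\ (e * p <= d)%N, (e * b0 <= d)%N & (e * (C * (2 * e)) <= d)%N].
  move: dd; rewrite !mulnDr; move: (e * p)%N (e * b0)%N (e * (C * (2 * e)))%N => x y z; clear; split; lia.
have dd2 : (1000 * (p + 1) + 60 * (C * p + 1) + 60 * C <= d)%N.
  by move: dd; move: (e * _)%N => x; lia.
have np : (n %% 3 * p <= 2 * p)%N by rewrite leq_mul2r n22 orbT.
have fact h : (h <= q ^ h)%N by apply: ltnW; exact: ltn_expl.
apply: (@monic_sum_bound F K iota q./2 cardF charF char3 P mP d n (n %/ 3) (n %% 3) C e b0 j t h0) => //.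
- by rewrite mulnC ltn_ceil.
- exact: jge.
- exact: jge.
- rewrite /h0 /t; lia.
- by apply: leq_trans (fact j); exact: jge.
- rewrite -/p /h0 /t; lia.
- rewrite -/p /h0 /t; lia.
- rewrite -/p; lia.
- rewrite /t; lia.
- lia.
- rewrite -/p mulnDr /t; lia.
- rewrite -/p; move: np; move: (n %% 3 * p)%N => x np.
  apply: leq_trans (leq_mul (fact C) (leqnn _)) _; rewrite -expnD leq_pexp2l //.
  by rewrite /t; lia.
Qed.

(** * Summation over degrees *)

Lemma sum_expn_le q L : (1 < q)%N -> (\sum_(0 <= d < L.+1) q ^ d <= 2 * q ^ L)%N.
Proof.
move=> q2; elim: L => [|L IH]; first by rewrite big_nat1.
rewrite big_nat_recr //= expnS; apply: leq_trans (leq_add IH (leqnn _)) _.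
by rewrite [X in (_ <= X)%N]mul2n -addnn leq_add2r leq_mul2r q2 orbT.
Qed.

Lemma sum_lt_le d0 u : (\sum_(0 <= d < u) (d < d0) <= d0)%N.
Proof.
suff -> : (\sum_(0 <= d < u) (d < d0) = minn u d0)%N by exact: geq_minr.
elim: u => [|u IH]; first by rewrite big_geq // min0n.
by rewrite big_nat_recr //= IH; case: ltnP; lia.
Qed.

Section SumByDegree.
Variable F : finFieldType.
Local Notation q := #|F|.

Definition monics_upto L := [seq g : {poly F} <- polys F L | g \is monic].

Lemma sum_monics_upto (V : nmodType) (Phi : {poly F} -> V) L :
  \sum_(g <- monics_upto L) Phi g = \sum_(0 <= d < L) \sum_(g <- monics F d) Phi g.
Proof.
elim: L => [|L IH].
  rewrite big_geq // /monics_upto big_filter big_seq_cond big1 // => g.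
  by rewrite mem_polys leqn0 size_poly_eq0 => /andP[/eqP -> /monic_neq0]; rewrite eqxx.
rewrite big_nat_recr //= -IH -big_cat; apply: perm_big; apply: uniq_perm.
- by rewrite filter_uniq ?polys_uniq.
- rewrite cat_uniq filter_uniq ?polys_uniq // monics_uniq andbT /=.
  apply/hasPn => g; rewrite mem_monics mem_filter mem_polys => /andP[_ /eqP ->].
  by rewrite ltnn andbF.
- move=> g; rewrite mem_cat mem_filter mem_filter mem_monics !mem_polys.
  by case: (g \is monic) => //=; rewrite leq_eqVlt ltnS orbC.
Qed.

(** The polynomial f = 1 belongs to the progression without being of the form
    1 + P^n g with g monic, and has to be listed separately. *)
Lemma mem_progression (P : {poly F}) n (f : {poly F}) L : monirr P -> (0 < n)%N ->
  (f \in 1 :: [seq 1 + P ^+ n * g | g <- monics_upto L.+1]) =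
  [&& f \is monic, (f == 1) || ((size f).-1 <= n * (size P).-1 + L)%N & P ^+ n %| f - 1].
Proof.
move=> mP n0; have monP := monirr_monic mP.
have monPn : P ^+ n \is monic by rewrite monic_exp.
have sPn : size (P ^+ n) = (n * (size P).-1).+1 by rewrite size_exp_monic ?monic_neq0.
have np : (0 < n * (size P).-1)%N.
  by rewrite muln_gt0 n0; have /monirrP[_ [+ _]] := mP; case: (size P) => [|[]].
rewrite inE; case: (eqVneq f 1) => [->|f1] /=; first by rewrite monic1 subrr dvdp0.
apply/mapP/and3P => [[g + ->]|[mf sf dv]].
  rewrite mem_filter mem_polys => /andP[mg sg].
  have sPg : size (P ^+ n * g) = (n * (size P).-1 + size g)%N.
    by rewrite size_monicM ?monic_neq0 // sPn addSn.
  have g0 : (0 < size g)%N by rewrite size_poly_gt0 monic_neq0.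
  have lt : (size (1 : {poly F})%R < size (P ^+ n * g)%R)%N.
    by rewrite size_poly1 sPg; move: np g0; move: (n * _)%N (size g) => x y; clear; lia.
  rewrite addrC; split.
  - by rewrite monicE lead_coefDl // -monicE monicMl.
  - by rewrite size_polyDl // sPg; move: g0 sg; move: (size g) => x; move: (n * _)%N => y; clear; lia.
  - by rewrite addrK dvdp_mulr.
have f10 : f - 1 != 0 by rewrite subr_eq0.
have sf1 : (1 < size (f - 1)%R)%N.
  by apply: leq_trans (dvdp_leq f10 dv); rewrite sPn.
have sf2 : (1 < size f)%N.
  rewrite ltnNge; apply/negP => s1; have := size_polyD f (-1); rewrite size_polyN size_poly1.
  rewrite (maxn_idPr s1) => H; by have := leq_trans sf1 H.
have mf1 : f - 1 \is monic.
  by rewrite monicE lead_coefDl ?size_polyN ?size_poly1 // -monicE.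
have sff : size (f - 1) = size f by rewrite size_polyDl // size_polyN size_poly1.
have /dvdpP[g Eg] := dv.
have mg : g \is monic by move: mf1; rewrite Eg monicMr.
exists g; last by rewrite mulrC -Eg addrC subrK.
rewrite mem_filter mg mem_polys; move: sf; rewrite -sff Eg size_Mmonic ?monic_neq0 // sPn.
have := monic_neq0 mg; rewrite -size_poly_gt0.
by move: (size g) (n * _)%N => x y; clear; lia.
Qed.
End SumByDegree.

Local Open Scope classical_set_scope.
Local Open Scope ring_scope.

Theorem theorem1p12 (F : finFieldType) (k : nat) (hk : (0 < k)%N)
    (hF : #|F| = (3 ^ k)%N) (P : {poly F}) (hP : irreducible_poly P)
    (R : realType) (eps : R) (heps : 0 < eps) :
  exists N : R, forall (n : nat) (X : R), (0 < n)%N ->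
    N <= X / (pnorm P)%:R ^+ n ->
    `| (\sum_(f \in monic_progression (P ^+ n) X) poly_mu f)%:~R |
      <= eps * (X / (pnorm P)%:R ^+ n).
Proof.
set q := #|F|; have q2 : (1 < q)%N by exact: card_finNzRing_gt1.
have P0 : P != 0 by exact: irredp_neq0.
have lc0 : lead_coef P != 0 by rewrite lead_coef_eq0.
pose P1 := (lead_coef P)^-1 *: P.
have eP : P1 %= P by rewrite eqp_scale // invr_eq0.
have mP1 : monirr P1.
  apply/monirrP; split; first by rewrite monicE lead_coefZ mulVf.
  case: hP => sP irP; split; first by rewrite (eqp_size eP).
  by move=> Q sQ QP; rewrite (eqp_rtrans eP) irP // -(eqp_dvdr _ eP).
have sP1 : size P1 = size P by exact: eqp_size.
set p := (size P).-1.
(* 15 = 1 + 2 * 7: the bounded terms are at most Y, and the geometric series over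
   degrees doubles the constant 7 of [monic_sum_decay]. *)
pose C := (Num.truncn (15%:R / eps)).+1.
have C0 : (0 < C)%N by [].
have CE : 15%:R <= C%:R * eps :> R.
  by rewrite -ler_pdivrMr // ltW // /C truncnS_gt.
(* Degrees below d0 are bounded trivially, at a cost independent of n. *)
have [d0 Hd0] := monic_sum_decay hk hF mP1 C0.
pose B := (C * (1 + d0 * q ^ d0))%N.
exists B%:R => n X n0.
have qn0 : 0 < (pnorm P)%:R ^+ n :> R by rewrite exprn_gt0 // ltr0n expn_gt0 ltnW.
set Y := X / _ => BY.
have Y0 : 0 <= Y by apply: le_trans BY; rewrite ler0n.
(* A polynomial 1 + P^n g satisfies the norm condition when q ^ deg g <= Y. *)
pose M := Num.truncn Y.
have M1 : (0 < M)%N.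
  rewrite truncn_ge_nat //; apply: le_trans BY; rewrite ler_nat muln_gt0 //.
pose L := trunc_log q M.
have /andP[qL Lq] := trunc_log_bounds q2 M1; rewrite -/L in qL Lq.
have qLY : (q ^ L)%:R <= Y by rewrite -truncn_ge_nat.
pose r : seq {poly F} := 1 :: [seq 1 + P1 ^+ n * g | g <- monics_upto F L.+1].
have P1n0 : P1 ^+ n != 0 by rewrite expf_neq0 // -size_poly_gt0 sP1 size_poly_gt0.
have ur : uniq r.
  have inj1 : injective (fun g : {poly F} => 1 + P1 ^+ n * g).
    by move=> x y /addrI /(mulfI P1n0).
  rewrite cons_uniq (map_inj_uniq inj1) filter_uniq ?polys_uniq // andbT.
  apply/negP => /mapP[g + E]; rewrite mem_filter => /andP[/monic_neq0 g0 _].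
  by move: E => /esym/eqP; rewrite -subr_eq0 addrAC subrr add0r mulf_eq0 (negPf P1n0) (negPf g0).
have pn : (pnorm P)%:R ^+ n = (q ^ (n * p))%:R :> R by rewrite -natrX /pnorm -expnM mulnC.
have setE : monic_progression (P ^+ n) X = [set` r]%classic.
  have dvE f : (P ^+ n %| f - 1) = (P1 ^+ n %| f - 1).
    by apply: eqp_dvdl; rewrite eqp_sym eqp_exp.
  have memE f : [set` r]%classic f = (f \in r) :> Prop by [].
  apply/seteqP; split=> f; rewrite memE /r mem_progression // sP1 -/p.
    move=> [mf fX dv]; apply/and3P; split=> //; last by rewrite -dvE.
    case: (eqVneq f 1) => //= f1; rewrite leqNgt; apply/negP => lt.
    have : (q ^ (n * p + L.+1))%:R <= X.
      by apply: le_trans fX; rewrite ler_nat /pnorm leq_exp2l // addnS.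
    rewrite expnD natrM -pn mulrC -ler_pdivlMr // -/Y -truncn_ge_nat // -/M.
    by rewrite leqNgt Lq.
  move=> /and3P[mf fs dv]; split=> //; last by rewrite dvE.
  have : (pnorm f <= q ^ (n * p + L))%N.
    case/orP: fs => [/eqP ->|fs]; last by rewrite /pnorm leq_exp2l.
    by rewrite /pnorm size_poly1 expn0 expn_gt0 ltnW.
  rewrite -(ler_nat R) => H; apply: le_trans H _.
  by rewrite expnD natrM -pn mulrC -ler_pdivlMr // -/Y.
rewrite setE -(fsbig_seq _ _ ur) /r big_cons big_map (sum_monics_upto (fun g => poly_mu (1 + P1 ^+ n * g))).
set T := \sum_(0 <= d < L.+1) _; set m1 := poly_mu 1.
have mu_le f : (`|poly_mu f| <= 1)%N.
  by rewrite /poly_mu; case: ifP => // _; rewrite abszX exp1n.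
have term d : (C * `|(\sum_(g <- monics F d) poly_mu (1 + P1 ^+ n * g))%R| <= C * (d < d0) * q ^ d0 + 7 * q ^ d)%N.
  case: (ltnP d d0) => dd; last by rewrite muln0 mul0n add0n Hd0.
  rewrite muln1; apply: leq_trans (leq_addr _ _); rewrite leq_mul2l; apply/orP; right.
  apply: leq_trans (abs_sum_le _ _) _.
  apply: (@leq_trans (\sum_(g <- monics F d) 1)); first by apply: leq_sum => g _.
  by rewrite sum1_size size_monics leq_pexp2l // ltnW.
have tot : (C * `|(m1 + T)%R| <= B + 14 * q ^ L)%N.
  have tri (u w : int) : (`|(u + w)%R| <= `|u| + `|w|)%N by clear; lia.
  apply: leq_trans (leq_mul (leqnn C) (tri _ _)) _; rewrite mulnDr.
  have HT : (C * `|T| <= C * (d0 * q ^ d0) + 14 * q ^ L)%N.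
    apply: leq_trans (leq_mul (leqnn C) (abs_sum_le _ _)) _; rewrite big_distrr /=.
    apply: leq_trans (leq_sum _ (fun d _ => term d)) _; rewrite big_split /=; apply: leq_add.
      rewrite -big_distrl -big_distrr /= -mulnA leq_mul2l leq_mul2r; apply/orP; right; apply/orP; right.
      exact: sum_lt_le.
    rewrite -big_distrr /= -[14%N]/(7 * 2)%N -mulnA leq_mul2l /=; exact: sum_expn_le.
  rewrite /B mulnDr muln1 -addnA; apply: leq_add HT.
  by rewrite -[X in (_ <= X)%N]muln1 leq_mul2l mu_le orbT.
have totR : C%:R * `|(m1 + T)%:~R| <= (B + 14 * q ^ L)%:R :> R.
  have -> : `|(m1 + T)%:~R| = (`|(m1 + T)%R|%N)%:R :> R by rewrite -intr_norm -abszE.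
  by rewrite -natrM ler_nat.
have : C%:R * `|(m1 + T)%:~R| <= 15%:R * Y.
  apply: le_trans totR _; have -> : 15%:R * Y = Y + 14%:R * Y by ring.
  by rewrite natrD lerD // natrM ler_wpM2l // ler0n.
move=> H; have H2 : C%:R * `|(m1 + T)%:~R| <= C%:R * (eps * Y) :> R.
  by apply: le_trans H _; rewrite mulrA ler_wpM2r.
by move: H2; rewrite ler_pM2l // ltr0n.
Qed.
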